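(* Let $\mathcal R=(\mathbb R,<,+,\dots)$ be an expansion of the ordered additive group of real numbers, and suppose $\mathcal R$ does not define an isomorphic copy of the two-sorted structure $(\mathcal P(\mathbb N),\mathbb N,\in,+,\cdot)$. Then the following are equivalent: (1) $\mathcal R$ defines a non-affine $C^1$ function $f:I\to\mathbb R$ for some nonempty bounded open interval $I$; (2) $\mathcal R$ is of field-type.
   Context: ''Definable'' means definable in $\mathcal R$ with parameters. ''Defines an isomorphic copy'' of a (two-sorted) structure means there are definable sets and definable relations/functions on them forming a structure isomorphic to it. $\mathcal P(\mathbb N)$ is the power set of $\mathbb N$. $\mathcal R$ is of field-type if there are a nonempty bounded open interval $I$ and definable $\oplus,\otimes:I^2\to I$ with $(I,<,\oplus,\otimes)$ isomorphic to $(\mathbb R,<,+,\cdot)$. *)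

(* Defs.v *)
From mathcomp Require Import all_boot all_order all_algebra.
From mathcomp Require Import all_classical all_reals all_analysis.

Set Implicit Arguments.
Unset Strict Implicit.
Unset Printing Implicit Defensive.

Import Order.TTheory GRing.Theory Num.Theory.
Import numFieldNormedType.Exports.

Local Open Scope classical_set_scope.
Local Open Scope ring_scope.

(* An arbitrary first-order language; constants are the symbols in [funs 0]. *)
Record language := Language {
  funs : nat -> Type;
  rels : nat -> Type
}.

Record fo_structure (L : language) (T : Type) := FoStructure {
  fun_interp : forall k, funs L k -> k.-tuple T -> T;
  rel_interp : forall k, rels L k -> k.-tuple T -> Prop
}.

(* [term L n] and [formula L n] have their free variables among 0, ..., n-1. *)
Inductive term (L : language) (n : nat) : Type :=
| Var : 'I_n -> term L n
| App : forall k, funs L k -> ('I_k -> term L n) -> term L n.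

(* [Ex] binds variable 0 of its body and shifts the other variables by one.
   The remaining connectives are classically definable from these. *)
Inductive formula (L : language) : nat -> Type :=
| Eq : forall n, term L n -> term L n -> formula L n
| Rel : forall n k, rels L k -> ('I_k -> term L n) -> formula L n
| Not : forall n, formula L n -> formula L n
| And : forall n, formula L n -> formula L n -> formula L n
| Ex : forall n, formula L n.+1 -> formula L n.

Section Semantics.
Variables (L : language) (T : Type) (M : fo_structure L T).

Fixpoint eval n (v : n.-tuple T) (t : term L n) : T :=
  match t with
  | Var i => tnth v i
  | App _ f args => fun_interp M f [tuple eval v (args i) | i < _]
  end.

Fixpoint sat n (phi : formula L n) : n.-tuple T -> Prop :=
  match phi with
  | Eq _ t u => fun v => eval v t = eval v u
  | Rel _ _ r args => fun v => rel_interp M r [tuple eval v (args i) | i < _]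
  | Not _ phi => fun v => ~ sat phi v
  | And _ phi psi => fun v => sat phi v /\ sat psi v
  | Ex _ phi => fun v => exists x, sat phi (cons_tuple x v)
  end.

(* Definability with parameters: the last [p] variables are filled by [c]. *)
Definition definable n (A : set (n.-tuple T)) : Prop :=
  exists p (phi : formula L (n + p)) (c : p.-tuple T),
    A = [set x | sat phi (cat_tuple x c)].

(* In the four notions below a map or relation lives on the ambient type but only
   its restriction to the given sets matters: definability refers to the (graph
   of the) restriction. *)

Definition definable_fun (X : set T) (f : T -> T) : Prop :=
  definable [set [tuple x; f x] | x in X].

Definition definable_op (X : set T) (op : T -> T -> T) : Prop :=
  definable [set [tuple x; y; op x y] | x in X & y in X].

Definition definable_tuple_op n (X : set (n.-tuple T))
    (op : n.-tuple T -> n.-tuple T -> n.-tuple T) : Prop :=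
  definable [set cat_tuple (cat_tuple x y) (op x y) | x in X & y in X].

Definition definable_tuple_rel m n (X : set (m.-tuple T)) (Y : set (n.-tuple T))
    (E : m.-tuple T -> n.-tuple T -> Prop) : Prop :=
  definable [set z | exists x y, [/\ X x, Y y, E x y & z = cat_tuple x y]].

(* M defines an isomorphic copy of the two-sorted structure
   (P(N), N, \in, +, * ): the sorts P(N) and N are represented by definable sets
   PS and NS of tuples (of possibly different lengths), and (f, g) is the
   isomorphism from the copy. *)
Definition defines_PN_copy : Prop :=
  exists m n (NS : set (m.-tuple T)) (PS : set (n.-tuple T))
    (mem : m.-tuple T -> n.-tuple T -> Prop)
    (add mul : m.-tuple T -> m.-tuple T -> m.-tuple T),
  [/\ definable NS, definable PS, definable_tuple_rel NS PS mem,
      definable_tuple_op NS add & definable_tuple_op NS mul] /\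
  [/\ forall x y, NS x -> NS y -> NS (add x y) &
      forall x y, NS x -> NS y -> NS (mul x y)] /\
  exists (f : n.-tuple T -> set nat) (g : m.-tuple T -> nat),
    [/\ set_bij PS [set: set nat] f,
        set_bij NS [set: nat] g,
        forall x y, NS x -> PS y -> (mem x y <-> f y (g x)),
        forall x y, NS x -> NS y -> g (add x y) = (g x + g y)%N &
        forall x y, NS x -> NS y -> g (mul x y) = (g x * g y)%N].

End Semantics.

Section OverReals.
Variables (R : realType) (L : language) (M : fo_structure L R).

Definition expands_ordered_add_group : Prop :=
  (exists lt : rels L 2,
     forall x y : R, rel_interp M lt [tuple x; y] <-> x < y) /\
  (exists add : funs L 2,
     forall x y : R, fun_interp M add [tuple x; y] = x + y).

Definition C1_on (a b : R) (f : R -> R) : Prop :=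
  {in `]a, b[, forall x, derivable f x 1} /\ {in `]a, b[, continuous (derive1 f)}.

Definition affine_on (a b : R) (f : R -> R) : Prop :=
  exists s t : R, {in `]a, b[, forall x, f x = s * x + t}.

Definition defines_nonaffine_C1 : Prop :=
  exists (a b : R) (f : R -> R),
    [/\ a < b, definable_fun M `]a, b[ f, C1_on a b f & ~ affine_on a b f].

Definition field_type : Prop :=
  exists (a b : R) (oplus otimes : R -> R -> R),
  [/\ a < b,
      {in `]a, b[ &, forall x y, oplus x y \in `]a, b[},
      {in `]a, b[ &, forall x y, otimes x y \in `]a, b[},
      definable_op M `]a, b[ oplus &
      definable_op M `]a, b[ otimes] /\
  exists h : R -> R,
    [/\ set_bij `]a, b[ [set: R] h,
        {in `]a, b[ &, forall x y, (x < y) = (h x < h y)},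
        {in `]a, b[ &, forall x y, h (oplus x y) = h x + h y} &
        {in `]a, b[ &, forall x y, h (otimes x y) = h x * h y}].

End OverReals.

(* Main.v *)
From HB Require Import structures.
From mathcomp Require Import all_boot all_order all_algebra.
From mathcomp Require Import all_classical all_reals all_analysis.
From mathcomp Require Import ring lra.
Require Import Defs.

Set Implicit Arguments.
Unset Strict Implicit.
Unset Printing Implicit Defensive.

Import Order.TTheory GRing.Theory Num.Theory.
Import numFieldNormedType.Exports.

Local Open Scope classical_set_scope.
Local Open Scope ring_scope.

(** Write [sigma] for the derivative of a non-affine C^1 function [f].  The germs
    at 0 of [x |-> f (t + x) - f t] have slopes [sigma t]; sums and compositions of
    germs give sums and products of slopes, so polynomial relations between slopes
    are definable.  The points where [sigma] reaches a new maximum form a definable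
    set [S] on which [sigma] is injective, and [S] carries a definable copy of the
    real field.  If [sigma] is strictly monotone on some interval, then [S] can be
    taken to be an interval.  Otherwise the gaps of [S] mark a dense set of values,
    only finitely many of which come from a gap of length at least [e] for each
    [e > 0].  A definable field with a dense set filtered by finite sets in this way
    codes every relation on that set by finitely many parameters, hence defines a
    copy of the power set of the natural numbers with arithmetic.

    Conversely, let [h] be the isomorphism from a field on an interval onto the
    reals.  By the coding above, definable increasing families of closed sets
    satisfy a Baire category theorem.  Applied to ratios of increments of [h], it
    yields an interval on which [h (x + t) - h x] is asymptotic to [om x * w t], with
    [om] continuous and positive, locally uniformly in [x].  As [w] is asymptotically
    additive, the conjugate by [h] of a smooth map is C^1 with a derivative that can
    be computed; conjugating [s |-> s + (s - s1) ^ 2], which has derivative 1 at its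
    fixed point [s1], gives a non-affine function. *)

(** * Definable predicates *)

(** Slopes and field values are not elements of the structure, and no copy of the natural numbers is
    given; this shapes both halves. A slope is reached only through germs that have it, a field
    value only through its preimage under an isomorphism, so the operations enter as definable
    relations between preimages. A dense set filtered by finite sets is countable, so arithmetic can
    be moved to it along any enumeration, however wild, and the coding makes the resulting graphs
    definable. A set of natural numbers is then a real number, whose bits are read through intervals
    with endpoints in the dense set. The Baire theorem obtained is stronger than the classical one:
    the union has to be dense, not everything. This suits arguments by extrema, which yield one good
    point in each interval. It treats one translation at a time; the classical theorem then finds a
    point that is good for all rational translations. Lengths in the additive group and values in
    the field are not comparable a priori. A bound in the field is therefore indexed by a length [e]
    through the value [h (b - e)], which is unbounded as [e] tends to 0. *)

Section Renaming.
Variables (L : language) (T : Type) (M : fo_structure L T).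

Fixpoint ren_term n m (f : 'I_n -> 'I_m) (t : term L n) : term L m :=
  match t with
  | Var i => Var L (f i)
  | App k s args => App s (fun j => ren_term f (args j))
  end.

Lemma eval_ren n m (f : 'I_n -> 'I_m) (t : term L n) (w : m.-tuple T) :
  eval M w (ren_term f t) = eval M [tuple tnth w (f i) | i < n] t.
Proof.
elim: t => [i|k s args IH] /=; first by rewrite tnth_mktuple.
by congr fun_interp; apply: eq_from_tnth => j; rewrite !tnth_mktuple IH.
Qed.

Definition ren_up n m (f : 'I_n -> 'I_m) (i : 'I_n.+1) : 'I_m.+1 :=
  if unlift ord0 i is Some j then lift ord0 (f j) else ord0.

Fixpoint ren n (phi : formula L n) : forall m, ('I_n -> 'I_m) -> formula L m :=
  match phi with
  | Eq _ t u => fun m f => Eq (ren_term f t) (ren_term f u)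
  | Rel _ _ r args => fun m f => Rel r (fun j => ren_term f (args j))
  | Not _ phi => fun m f => Not (ren phi f)
  | And _ phi psi => fun m f => And (ren phi f) (ren psi f)
  | Ex _ phi => fun m f => Ex (ren phi (ren_up f))
  end.

Lemma sat_ren n (phi : formula L n) m (f : 'I_n -> 'I_m) (w : m.-tuple T) :
  sat M (ren phi f) w <-> sat M phi [tuple tnth w (f i) | i < n].
Proof.
elim: phi m f w => {n} [n t u|n k r args|n phi IH|n phi IHp psi IHq|n phi IH] m f w /=.
- by rewrite !eval_ren.
- rewrite (_ : [tuple _ | i < k] =
    [tuple eval M [tuple tnth w (f i0) | i0 < n] (args i) | i < k]) //.
  by apply: eq_from_tnth => j; rewrite !tnth_mktuple eval_ren.
- by rewrite IH.
- by rewrite IHp IHq.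
- suff E x : [tuple tnth (cons_tuple x w) (ren_up f i) | i < n.+1] =
    cons_tuple x [tuple tnth w (f i) | i < n].
    by split=> -[x]; rewrite ?IH => h; exists x; move: h; rewrite ?IH E.
  apply: eq_from_tnth => i; rewrite tnth_mktuple /ren_up.
  by case: unliftP => [j ->|->]; rewrite ?tnthS ?tnth0 ?tnth_mktuple.
Qed.

(* A variable of a formula is assigned either a coordinate of an infinite
   environment or a parameter. *)
Definition look (v : nat -> T) (s : nat + T) : T :=
  match s with inl k => v k | inr c => c end.

Definition Def (P : (nat -> T) -> Prop) : Prop :=
  exists n (phi : formula L n) (rho : 'I_n -> nat + T),
    forall v, P v <-> sat M phi [tuple look v (rho i) | i < n].

Lemma Def_ext P Q : (forall v, P v <-> Q v) -> Def P -> Def Q.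
Proof. by move=> PQ [n [phi [rho h]]]; exists n, phi, rho => v; rewrite -PQ. Qed.

Lemma Def_not P : Def P -> Def (fun v => ~ P v).
Proof. by move=> [n [phi [rho h]]]; exists n, (Not phi), rho => v /=; rewrite h. Qed.

Lemma Def_and P Q : Def P -> Def Q -> Def (fun v => P v /\ Q v).
Proof.
move=> [n [phi [rho h]]] [m [psi [tau h']]].
pose rt (i : 'I_(n + m)) := match fintype.split i with inl j => rho j | inr j => tau j end.
exists (n + m)%N, (And (ren phi (@lshift n m)) (ren psi (@rshift n m))), rt.
move=> v /=; rewrite h h' !sat_ren.
rewrite (_ : [tuple _ | i < n] = [tuple tnth [tuple look v (rt i) | i < n + m] (lshift m i) | i < n]).
  rewrite (_ : [tuple _ | i < m] =
    [tuple tnth [tuple look v (rt i) | i < n + m] (rshift n i) | i < m]) //.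
  apply: eq_from_tnth => i; rewrite !tnth_mktuple /rt.
  by rewrite -[rshift n i]/(unsplit (inr i)) unsplitK.
apply: eq_from_tnth => i; rewrite !tnth_mktuple /rt.
by rewrite -[lshift m i]/(unsplit (inl i)) unsplitK.
Qed.

Lemma Def_ren P (s : nat -> nat) : Def P -> Def (fun v => P (fun i => v (s i))).
Proof.
move=> [n [phi [rho h]]].
exists n, phi, (fun i => match rho i with inl k => inl (s k) | inr c => inr c end).
move=> v; rewrite h (_ : mktuple _ = [tuple look v
  match rho i with inl k => inl (s k) | inr c => inr c end | i < n]) //.
by apply: eq_from_tnth => i; rewrite !tnth_mktuple; case: (rho i).
Qed.

Lemma Def_ex (P : T -> (nat -> T) -> Prop) :
  Def (fun v => P (v 0%N) (fun i => v i.+1)) -> Def (fun v => exists x, P x v).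
Proof.
move=> [n [phi [rho h]]].
(* All variables that read coordinate 0 are merged into the bound one; what is assigned to their
   former slots no longer matters. *)
pose f (i : 'I_n) : 'I_n.+1 := if rho i is inl 0%N then ord0 else lift ord0 i.
exists n, (Ex (ren phi f)), (fun i => if rho i is inl k.+1 then inl k else rho i) => v /=.
pose sc x i := if i is k.+1 then v k else x.
have E x : P x v <-> sat M phi [tuple look (sc x) (rho i) | i < n] := h (sc x).
split=> -[x Px]; exists x; move: Px.
all: rewrite E sat_ren.
all: set t1 := mktuple _; set t2 := mktuple _; suff -> : t1 = t2 by [].
all: apply: eq_from_tnth => i; rewrite !tnth_mktuple /f.
all: by case Ei: (rho i) => [[|k]|c]; rewrite ?tnth0 ?tnthS ?tnth_mktuple ?Ei.
Qed.

Lemma Def_imp P Q : Def P -> Def Q -> Def (fun v => P v -> Q v).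
Proof.
move=> hP hQ; apply: (@Def_ext (fun v => ~ (P v /\ ~ Q v))); last first.
  by apply: Def_not; apply: Def_and => //; apply: Def_not.
by move=> v; split=> [a p|h]; [apply: contrapT => n; apply: a|tauto].
Qed.

Lemma Def_or P Q : Def P -> Def Q -> Def (fun v => P v \/ Q v).
Proof.
move=> hP hQ; apply: (@Def_ext (fun v => ~ (~ P v /\ ~ Q v))); last first.
  by apply: Def_not; apply: Def_and => //; apply: Def_not.
by move=> v; split=> [a|h]; [apply: contrapT; tauto|tauto].
Qed.

Lemma Def_all (P : T -> (nat -> T) -> Prop) :
  Def (fun v => P (v 0%N) (fun i => v i.+1)) -> Def (fun v => forall x, P x v).
Proof.
move=> hP; apply: (@Def_ext (fun v => ~ exists x, ~ P x v)).
  by move=> v; split=> [h x|h [x nx]]; [apply: contrapT => n; apply: h; exists x|apply: nx].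
by apply: Def_not; apply: Def_ex; apply: Def_not.
Qed.

Lemma Def_to_definable n (x0 : T) (P : (nat -> T) -> Prop) (A : set (n.-tuple T)) :
  Def P -> (forall z, A z <-> P (fun i => nth x0 z i)) -> definable M A.
Proof.
move=> [m [phi [rho h]]] hA.
(* One parameter slot per variable of [phi]. A variable reading a coordinate beyond [n] gets the
   parameter [x0], the default value of [nth]. *)
pose f (i : 'I_m) : 'I_(n + m) := match rho i with
  | inl k => if insub k is Some j then lshift m j else rshift n i
  | inr c => rshift n i end.
pose c := [tuple match rho i with inl k => x0 | inr c => c end | i < m].
exists m, (ren phi f), c; apply/seteqP; split=> z /=; rewrite hA h sat_ren.
all: set t1 := mktuple _; set t2 := mktuple _; suff -> : t1 = t2 by [].
all: apply: eq_from_tnth => i; rewrite !tnth_mktuple /f.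
all: case Ei: (rho i) => [k|d] /=; last by rewrite tnth_rshift tnth_mktuple Ei.
all: case: insubP => [j jn jk|nk]; first by rewrite tnth_lshift (tnth_nth x0) jk.
all: by rewrite tnth_rshift tnth_mktuple Ei nth_default // size_tuple leqNgt.
Qed.

Lemma definable_to_Def n (A : set (n.-tuple T)) :
  definable M A -> Def (fun v => A [tuple v i | i < n]).
Proof.
move=> [p [phi [c ->]]].
exists (n + p)%N, phi, (fun i => match fintype.split i with
  inl j => inl (j : nat) | inr j => inr (tnth c j) end) => v /=.
set t1 := cat_tuple _ _; set t2 := mktuple _; suff -> : t1 = t2 by [].
apply: eq_from_tnth => i; rewrite !tnth_mktuple.
rewrite -[i]splitK; case: (fintype.split i) => j; rewrite unsplitK /=.
  by rewrite tnth_lshift tnth_mktuple.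
by rewrite tnth_rshift.
Qed.

End Renaming.

(** * Definable terms in the additive group and in a definable field *)

Section RealDefinability.
Variables (R : realType) (L : language) (M : fo_structure L R).
Hypothesis Mexp : expands_ordered_add_group M.

Definition Def1 (Q : R -> Prop) := Def M (fun v => Q (v 0%N)).
Definition Def2 (Q : R -> R -> Prop) := Def M (fun v => Q (v 0%N) (v 1%N)).
Definition Def3 (Q : R -> R -> R -> Prop) :=
  Def M (fun v => Q (v 0%N) (v 1%N) (v 2%N)).

Definition DefT (a : (nat -> R) -> R) : Prop :=
  Def M (fun v => v 0%N = a (fun i => v i.+1)).

Lemma DefT_ren a (s : nat -> nat) : DefT a -> DefT (fun v => a (fun i => v (s i))).
Proof. exact: (@Def_ren _ _ _ _ (fun i => if i is j.+1 then (s j).+1 else 0%N)). Qed.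

Lemma DefT_at a k (s : nat -> nat) :
  DefT a -> Def M (fun v => v k = a (fun i => v (s i))).
Proof. exact: (@Def_ren _ _ _ _ (fun i => if i is j.+1 then s j else k)). Qed.

Lemma DefT_var k : DefT (fun v => v k).
Proof.
exists 2%N, (Eq (Var L ord0) (Var L ord_max)),
  (fun i => inl (if i == ord0 then 0%N else k.+1)) => v /=.
by rewrite !tnth_mktuple.
Qed.

Lemma DefT_cst c : DefT (fun=> c).
Proof.
exists 2%N, (Eq (Var L ord0) (Var L ord_max)),
  (fun i => if i == ord0 then inl 0%N else inr c) => v /=.
by rewrite !tnth_mktuple.
Qed.

Lemma Def1_app Q a : Def1 Q -> DefT a -> Def M (fun v => Q (a v)).
Proof.
move=> hQ ha; apply: (@Def_ext _ _ _ (fun v => exists x, x = a v /\ Q x)).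
  by move=> v; split=> [[x [->]]//|]; exists (a v).
by apply: Def_ex; apply: Def_and => //; apply: (Def_ren _ (fun=> 0%N) hQ).
Qed.

Lemma Def2_app Q a b : Def2 Q -> DefT a -> DefT b -> Def M (fun v => Q (a v) (b v)).
Proof.
move=> hQ ha hb.
apply: (@Def_ext _ _ _ (fun v => exists x, exists y, x = a v /\ y = b v /\ Q x y)).
  by move=> v; split=> [[x [y [-> [->]]]]//|]; exists (a v), (b v).
apply: Def_ex; apply: Def_ex; apply: Def_and; first exact: (DefT_at 1 (fun i => i.+2) ha).
apply: Def_and; first exact: (DefT_at 0 (fun i => i.+2) hb).
exact: (@Def_ren _ _ M _ (fun i : nat => if i is 0%N then 1%N else 0%N) hQ).
Qed.

Lemma Def3_app Q a b c : Def3 Q -> DefT a -> DefT b -> DefT c ->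
  Def M (fun v => Q (a v) (b v) (c v)).
Proof.
move=> hQ ha hb hc.
apply: (@Def_ext _ _ _ (fun v => exists x, exists y, exists z,
   x = a v /\ y = b v /\ z = c v /\ Q x y z)).
  by move=> v; split=> [[x [y [z [-> [-> [->]]]]]]//|]; exists (a v), (b v), (c v).
apply: Def_ex; apply: Def_ex; apply: Def_ex; apply: Def_and.
  exact: (DefT_at 2 (fun i => i.+3) ha).
apply: Def_and; first exact: (DefT_at 1 (fun i => i.+3) hb).
apply: Def_and; first exact: (DefT_at 0 (fun i => i.+3) hc).
exact: (@Def_ren _ _ M _ (fun i : nat => match i with 0%N => 2%N | 1%N => 1%N | _ => 0%N end) hQ).
Qed.

Lemma Def_eq a b : DefT a -> DefT b -> Def M (fun v => a v = b v).
Proof.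
move=> ha hb; apply: (@Def2_app (fun x y => x = y)) => //.
exact: (DefT_at 0 (fun=> 1%N) (DefT_var 0)).
Qed.

Lemma Def_lt a b : DefT a -> DefT b -> Def M (fun v => (a v < b v)%R).
Proof.
move=> ha hb; apply: (@Def2_app (fun x y => (x < y)%R)) => //.
case: Mexp => -[lt hlt] _.
exists 2%N, (Rel lt (fun i => Var L i)), (fun i => inl (nat_of_ord i)) => v /=.
rewrite -hlt (_ : [tuple v 0%N; v 1%N] =
  [tuple tnth [tuple look v (inl (i0 : nat)) | i0 < 2] i | i < 2]) //.
by apply: eq_from_tnth => i; rewrite !tnth_mktuple; case: i => -[|[|//]] ?.
Qed.

Lemma Def_le a b : DefT a -> DefT b -> Def M (fun v => (a v <= b v)%R).
Proof.
move=> ha hb; apply: (@Def_ext _ _ _ (fun v => ~ (b v < a v)%R)).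
  by move=> v; rewrite (leNgt (a v)); split=> /negP.
by apply: Def_not; apply: Def_lt.
Qed.

Lemma DefT_add a b : DefT a -> DefT b -> DefT (fun v => a v + b v).
Proof.
move=> ha hb.
suff h : Def3 (fun x y z => z = x + y).
  apply: (@Def3_app _ (fun v => a (fun i => v i.+1)) (fun v => b (fun i => v i.+1)) _ h).
  - exact: (DefT_ren (fun i => i.+1) ha).
  - exact: (DefT_ren (fun i => i.+1) hb).
  - exact: DefT_var.
case: Mexp => _ [add hadd].
exists 3%N, (Eq (Var L ord_max) (App add (fun i : 'I_2 => Var L (widen_ord (leqnSn 2) i)))),
  (fun i => inl (nat_of_ord i)) => v /=.
rewrite !tnth_mktuple /= -hadd.
rewrite (_ : [tuple v 0%N; v 1%N] = [tuple tnth [tuple look v (inl (i0 : nat)) | i0 < 3]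
  (widen_ord (leqnSn 2) i) | i < 2]) //.
by apply: eq_from_tnth => i; rewrite !tnth_mktuple; case: i => -[|[|//]] ?.
Qed.

Lemma DefT_opp a : DefT a -> DefT (fun v => - a v).
Proof.
move=> ha; apply: (@Def_ext _ _ _ (fun v => v 0%N + a (fun i => v i.+1) = 0)).
  move=> v; split=> [/eqP|->]; last by rewrite addNr.
  by rewrite addr_eq0 => /eqP.
apply: Def_eq; last exact: DefT_cst.
by apply: DefT_add; [exact: DefT_var|exact: (DefT_ren (fun i => i.+1) ha)].
Qed.

Lemma DefT_fun g a : Def2 (fun x y => y = g x) -> DefT a -> DefT (fun v => g (a v)).
Proof.
move=> hg ha; apply: (@Def2_app _ (fun v => a (fun i => v i.+1)) _ hg).
  exact: (DefT_ren (fun i => i.+1) ha).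
exact: DefT_var.
Qed.

(** A definable copy of the real field: universe [cdom], isomorphism [cval]. Only the graphs of the
    operations, pulled back to [cdom], are definable. The value 0 off the domain lets [cval] be
    applied to any coordinate of an environment. The order of [R] on [cdom] may differ from that of
    the values. *)
Record chart := Chart {
  cdom : R -> Prop;
  cval : R -> R;
  cdom_def : Def1 cdom;
  cval_out : forall x, ~ cdom x -> cval x = 0;
  cval_inj : forall x y, cdom x -> cdom y -> cval x = cval y -> x = y;
  cval_surj : forall r, exists2 x, cdom x & cval x = r;
  cadd_def : Def3 (fun x y z => [/\ cdom x, cdom y, cdom z & cval x + cval y = cval z]);
  cmul_def : Def3 (fun x y z => [/\ cdom x, cdom y, cdom z & cval x * cval y = cval z])
}.

Variable C : chart.
Local Notation S := (cdom C).
Local Notation val := (cval C).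

(* A value is represented by its preimage under the chart. *)
Definition KT (a : (nat -> R) -> R) : Prop :=
  Def M (fun v => S (v 0%N) /\ val (v 0%N) = a (fun i => v i.+1)).

Lemma KT_at a k (s : nat -> nat) :
  KT a -> Def M (fun v => S (v k) /\ val (v k) = a (fun i => v (s i))).
Proof. exact: (@Def_ren _ _ _ _ (fun i => if i is j.+1 then s j else k)). Qed.

Lemma KT_ren a (s : nat -> nat) : KT a -> KT (fun v => a (fun i => v (s i))).
Proof. exact: (@Def_ren _ _ _ _ (fun i => if i is j.+1 then (s j).+1 else 0%N)). Qed.

Lemma Def2_appK Q a b : Def2 (fun x y => [/\ S x, S y & Q (val x) (val y)]) ->
  KT a -> KT b -> Def M (fun v => Q (a v) (b v)).
Proof.
move=> hQ ha hb.
apply: (@Def_ext _ _ _ (fun v => exists x, exists y, (S x /\ val x = a v) /\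
  (S y /\ val y = b v) /\ [/\ S x, S y & Q (val x) (val y)])).
  move=> v; split=> [[x [y [[_ <-] [[_ <-] []]]]]//|h].
  have [x Sx xa] := cval_surj C (a v); have [y Sy yb] := cval_surj C (b v).
  by exists x, y; rewrite xa yb.
apply: Def_ex; apply: Def_ex; apply: Def_and; first exact: (KT_at 1 (fun i => i.+2) ha).
apply: Def_and; first exact: (KT_at 0 (fun i => i.+2) hb).
exact: (@Def_ren _ _ M _ (fun i : nat => if i is 0%N then 1%N else 0%N) hQ).
Qed.

Lemma Def3_appK Q a b c : Def3 (fun x y z => [/\ S x, S y, S z & Q (val x) (val y) (val z)]) ->
  KT a -> KT b -> KT c -> Def M (fun v => Q (a v) (b v) (c v)).
Proof.
move=> hQ ha hb hc.
apply: (@Def_ext _ _ _ (fun v => exists x, exists y, exists z, (S x /\ val x = a v) /\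
  (S y /\ val y = b v) /\ (S z /\ val z = c v) /\ [/\ S x, S y, S z & Q (val x) (val y) (val z)])).
  move=> v; split=> [[x [y [z [[_ <-] [[_ <-] [[_ <-] []]]]]]]//|h].
  have [x Sx xa] := cval_surj C (a v); have [y Sy yb] := cval_surj C (b v).
  by have [z Sz zc] := cval_surj C (c v); exists x, y, z; rewrite xa yb zc.
apply: Def_ex; apply: Def_ex; apply: Def_ex; apply: Def_and.
  exact: (KT_at 2 (fun i => i.+3) ha).
apply: Def_and; first exact: (KT_at 1 (fun i => i.+3) hb).
apply: Def_and; first exact: (KT_at 0 (fun i => i.+3) hc).
exact: (@Def_ren _ _ M _ (fun i : nat => match i with 0%N => 2%N | 1%N => 1%N | _ => 0%N end) hQ).
Qed.

Lemma Def_dom a : DefT a -> Def M (fun v => S (a v)).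
Proof. exact: Def1_app (cdom_def C). Qed.

Lemma KT_cst c : KT (fun=> c).
Proof.
have [x Sx xc] := cval_surj C c.
apply: (@Def_ext _ _ _ (fun v => v 0%N = x)).
  by move=> v; split=> [->//|[Sv vc]]; apply: (cval_inj Sv Sx); rewrite vc.
by apply: Def_eq; [exact: DefT_var|exact: DefT_cst].
Qed.

Lemma Def_eqK a b : KT a -> KT b -> Def M (fun v => a v = b v).
Proof.
move=> ha hb; apply: (@Def2_appK (fun x y => x = y)) => //.
apply: (@Def_ext _ _ _ (fun v => [/\ S (v 0%N), S (v 1%N) & v 0%N = v 1%N])).
  move=> v; split=> -[Sx Sy h]; split=> //; first by rewrite h.
  exact: (cval_inj Sx Sy).
apply: (@Def_ext _ _ _ (fun v => S (v 0%N) /\ S (v 1%N) /\ v 0%N = v 1%N)).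
  by move=> v; split=> [[? []]|[]].
by do !apply: Def_and; try (apply: Def_dom); try (apply: Def_eq); exact: DefT_var.
Qed.

Lemma KT_in a : Def M (fun v => val (v 0%N) = a (fun i => v i.+1)) -> KT a.
Proof. by move=> ha; apply: Def_and => //; apply: Def_dom; exact: DefT_var. Qed.

Lemma KT_val a : DefT a -> KT (fun v => val (a v)).
Proof.
move=> ha.
have [z Sz z0] := cval_surj C 0.
apply: (@Def_ext _ _ _ (fun v => (S (a (fun i => v i.+1)) /\ v 0%N = a (fun i => v i.+1)) \/
  (~ S (a (fun i => v i.+1)) /\ v 0%N = z))).
  move=> v; split=> [[[Sa ->]//|[nSa ->]]|[Sv va]].
    by rewrite z0 cval_out.
  have [Sa|nSa] := pselect (S (a (fun i => v i.+1))); [left|right]; split=> //.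
    exact: (cval_inj Sv Sa).
  by apply: (cval_inj Sv Sz); rewrite va z0 cval_out.
have ha' : DefT (fun v => a (fun i => v i.+1)) by exact: (DefT_ren (fun i => i.+1) ha).
apply: Def_or; apply: Def_and.
- exact: Def_dom.
- by apply: Def_eq => //; exact: DefT_var.
- by apply: Def_not; exact: Def_dom.
- by apply: Def_eq; [exact: DefT_var|exact: DefT_cst].
Qed.

Lemma KT_add a b : KT a -> KT b -> KT (fun v => a v + b v).
Proof.
move=> ha hb; apply: KT_in.
apply: (@Def_ext _ _ _ (fun v => a (fun i => v i.+1) + b (fun i => v i.+1) = val (v 0%N))).
  by move=> v; split.
apply: (@Def3_appK (fun x y z => x + y = z)).
- exact: cadd_def.
- exact: (KT_ren (fun i => i.+1) ha).
- exact: (KT_ren (fun i => i.+1) hb).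
- by apply: KT_val; exact: DefT_var.
Qed.

Lemma KT_mul a b : KT a -> KT b -> KT (fun v => a v * b v).
Proof.
move=> ha hb; apply: KT_in.
apply: (@Def_ext _ _ _ (fun v => a (fun i => v i.+1) * b (fun i => v i.+1) = val (v 0%N))).
  by move=> v; split.
apply: (@Def3_appK (fun x y z => x * y = z)).
- exact: cmul_def.
- exact: (KT_ren (fun i => i.+1) ha).
- exact: (KT_ren (fun i => i.+1) hb).
- by apply: KT_val; exact: DefT_var.
Qed.

Lemma KT_opp a : KT a -> KT (fun v => - a v).
Proof.
move=> ha; apply: (@Def_ext _ _ _ (fun v => S (v 0%N) /\ val (v 0%N) = -1 * a (fun i => v i.+1))).
  by move=> v; rewrite mulN1r.
exact: (KT_mul (KT_cst (-1)) ha).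
Qed.

Lemma KT_inv a : KT a -> KT (fun v => (a v)^-1).
Proof.
move=> ha; have ha' := KT_ren (fun i => i.+1) ha; apply: KT_in.
have hv : KT (fun v => val (v 0%N)) by apply: KT_val; exact: DefT_var.
apply: (@Def_ext _ _ _ (fun v =>
  (a (fun i => v i.+1) = 0 /\ val (v 0%N) = 0) \/ a (fun i => v i.+1) * val (v 0%N) = 1)).
  move=> v; set x := a _; split=> [[[-> ->]|h]|->].
  - by rewrite invr0.
  - have x0 : x != 0 by apply/eqP => x0; move: h; rewrite x0 mul0r => /eqP; rewrite eq_sym oner_eq0.
    by rewrite -[LHS](mulKf x0) h mulr1.
  - have [->|x0] := eqVneq x 0; first by left; rewrite invr0.
    by right; rewrite divff.
apply: Def_or; first by apply: Def_and; apply: Def_eqK => //; exact: KT_cst.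
by apply: Def_eqK; [exact: (KT_mul ha' hv)|exact: KT_cst].
Qed.

(** The order of the field is recovered from its squares. *)
Lemma Def_leK a b : KT a -> KT b -> Def M (fun v => (a v <= b v)%R).
Proof.
move=> ha hb.
apply: (@Def_ext _ _ _ (fun v => exists x, a v + val x * val x = b v)).
  move=> v; split=> [[x <-]|h]; first by rewrite lerDl -expr2 sqr_ge0.
  have [x Sx xE] := cval_surj C (Num.sqrt (b v - a v)).
  by exists x; rewrite xE -expr2 sqr_sqrtr ?subr_ge0 // addrC subrK.
apply: Def_ex; apply: Def_eqK; last exact: (KT_ren (fun i => i.+1) hb).
apply: KT_add; first exact: (KT_ren (fun i => i.+1) ha).
by apply: KT_mul; apply: KT_val; exact: DefT_var.
Qed.

Lemma Def_ltK a b : KT a -> KT b -> Def M (fun v => (a v < b v)%R).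
Proof.
move=> ha hb; apply: (@Def_ext _ _ _ (fun v => ~ (b v <= a v)%R)).
  by move=> v; rewrite (ltNge (a v)); split=> /negP.
by apply: Def_not; apply: Def_leK.
Qed.

End RealDefinability.

Ltac dfn_step :=
  lazymatch goal with
  | |- Def _ (fun v => @?A v /\ @?B v) => apply: Def_and
  | |- Def _ (fun v => @?A v \/ @?B v) => apply: Def_or
  | |- Def _ (fun v => ~ @?A v) => apply: Def_not
  | |- Def _ (fun v => @?A v -> @?B v) => apply: Def_imp
  | |- Def _ (fun v => exists x, _) => apply: Def_ex; cbn beta
  | |- Def _ (fun v => forall x, _) => apply: Def_all; cbn beta
  | |- DefT _ (fun v => v _) => apply: DefT_var
  | |- DefT _ (fun v => @?a v + @?b v) => apply: DefT_add => //
  | |- DefT _ (fun v => - @?a v) => apply: DefT_opp => //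
  | |- KT _ (fun v => @?a v + @?b v) => apply: KT_add
  | |- KT _ (fun v => @?a v * @?b v) => apply: KT_mul
  | |- KT _ (fun v => - @?a v) => apply: KT_opp
  | |- KT _ (fun v => (@?a v)^-1) => apply: KT_inv
  | |- KT _ (fun v => cval _ (@?a v)) => apply: KT_val
  | |- Def _ (fun v => cdom _ (@?a v)) => apply: Def_dom
  | |- KT _ (fun v => ?c) => apply: KT_cst
  | |- DefT _ (fun v => ?c) => apply: DefT_cst
  end.

(** * Coding relations on a dense filtered set *)

Section FiniteSets.
Variable R : realType.
Implicit Types (F : set R) (s : seq R).

Lemma finite_gap F (r : R) : finite_set F ->
  exists2 g : R, 0 < g & forall e, F e -> e < r -> e <= r - g.
Proof.
move=> /finite_seqP[s ->]; elim: s => [|a s [g g0 IH]]; first by exists 1.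
have [ar|ra] := ltP a r.
  exists (Num.min g (r - a)); first by rewrite lt_min g0 subr_gt0.
  move=> e /=; rewrite inE => /orP[/eqP ->|/IH h] er.
    by rewrite lerBrDr -lerBrDl ge_min lexx orbT.
  by apply: (le_trans (h er)); rewrite lerD2l lerN2 ge_min lexx.
exists g => // e /=; rewrite inE => /orP[/eqP -> ar|/IH//].
by move: ra; rewrite leNgt ar.
Qed.

Lemma finite_argmax F (f : R -> R) : finite_set F -> F !=set0 ->
  exists2 x, F x & forall y, F y -> f y <= f x.
Proof.
move=> /finite_seqP[s ->]; elim: s => [[x]//|a s IH _].
case: s IH => [_|b s IH].
  by exists a => [/=|y /=]; rewrite ?inE // => /eqP ->.
have [|x xs xm] := IH; first by exists b => /=; rewrite inE eqxx.
have [ax|xa] := leP (f a) (f x).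
  by exists x => [/=|y /=]; rewrite inE ?xs ?orbT // => /orP[/eqP ->//|/xm].
exists a => [/=|y /=]; rewrite inE ?eqxx // => /orP[/eqP ->//|/xm h].
by apply: le_trans h (ltW xa).
Qed.

Lemma min_pos n (g : nat -> R) : (forall i, (i < n)%N -> 0 < g i) ->
  exists2 s, 0 < s & forall i, (i < n)%N -> s <= g i.
Proof.
elim: n => [|n IH] h; first by exists 1.
have [|s s0 sg] := IH; first by move=> i /ltnW; exact: h.
exists (Num.min s (g n)); first by rewrite lt_min s0 h.
move=> i; rewrite ltnS leq_eqVlt => /orP[/eqP ->|/sg h']; rewrite ge_min ?lexx ?orbT //.
by rewrite h'.
Qed.

Lemma nested_intervals (lo hi : nat -> R) :
  (forall k, lo k < lo k.+1) -> (forall k, hi k.+1 < hi k) -> (forall k, lo k < hi k) ->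
  exists x, forall k, lo k < x < hi k.
Proof.
move=> hl hh hlh.
have ml k j : (k <= j)%N -> lo k <= lo j.
  by move=> kj; apply: (@homo_leq _ lo <=%R) => // [? ? ? ab bc|i]; [exact: le_trans ab bc|exact: ltW].
have mh k j : (k <= j)%N -> hi j <= hi k.
  move=> kj; apply: (@homo_leq _ hi (fun a b => b <= a)) => // [? ? ? ab bc|i].
    exact: le_trans bc ab.
  exact: ltW.
have ub j : ubound (range lo) (hi j).
  move=> _ [k _ <-]; have [kj|jk] := leqP k j.
    exact: le_trans (ml _ _ kj) (ltW (hlh j)).
  exact: le_trans (ltW (hlh k)) (mh _ _ (ltnW jk)).
have hs : has_sup (range lo) by split; [exists (lo 0%N), 0%N|exists (hi 0%N)].
exists (sup (range lo)) => k; apply/andP; split.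
  by apply: lt_le_trans (hl k) _; apply: ub_le_sup; [case: hs|exists k.+1].
by apply: le_lt_trans (hh k); apply: ge_sup => //; exists (lo 0%N), 0%N.
Qed.

End FiniteSets.

Ltac drop_ineqs := repeat match goal with
  | H : is_true (_ < _) |- _ => clear H
  | H : is_true (_ <= _) |- _ => clear H
  end.

Section Coding.
Variables (R : realType) (E : R -> Prop) (lev : R -> R) (al be : R).
Hypothesis E_in : forall e, E e -> al < e < be.
Hypothesis lev_gt0 : forall e, E e -> 0 < lev e.
Hypothesis E_fin : forall eps : R, 0 < eps -> finite_set [set e | E e /\ eps <= lev e].
Hypothesis E_dense : forall r1 r2, al <= r1 -> r1 < r2 -> r2 <= be ->
  exists2 e, E e & r1 < e < r2.

(** This is how a real [r] names an element of [E]: given a threshold [eps], the name [e] is the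
    same for all [r] in a gap to the left of [e], so it survives small perturbations of [r]. *)
Definition isnext eps r e := (E e /\ eps <= lev e) /\ r < e /\
  forall e', (E e' /\ eps <= lev e') -> r < e' -> e <= e'.

Lemma isnext_inj eps r e e' : isnext eps r e -> isnext eps r e' -> e = e'.
Proof.
move=> [Ee [re h]] [Ee' [re' h']]; apply/eqP; rewrite eq_le.
by rewrite h // h'.
Qed.

Lemma isnext_gap eps r e g : E e -> eps <= lev e ->
  (forall e', E e' /\ eps <= lev e' -> e' < e -> e' <= e - g) ->
  e - g <= r -> r < e -> isnext eps r e.
Proof.
move=> Ee le h gr re; split => //; split=> // e' E' re'.
rewrite leNgt; apply/negP => e'e; have := h _ E' e'e.
by rewrite leNgt (le_lt_trans gr re').
Qed.

(* [x] selects a sparse sequence of levels, those of the elements [l] that are the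
   first of their level to the right of [x]; at a selected level, [e i] is read off
   from the ratio of the distances of [y i] and [z] to their next elements. *)
Definition coded n x z (y e : nat -> R) := exists l, isnext (lev l) x l /\
  exists z', isnext (lev l) z z' /\ forall i, (i < n)%N ->
  exists y', isnext (lev l) (y i) y' /\
    isnext (lev l) (al + (y' - y i) / (z' - z)) (e i).

(* Coordinate 0 of a box encloses x, coordinate 1 encloses z and coordinate
   i + 2 encloses y i. *)
Definition box_ok (b : (nat -> R) * (nat -> R)) :=
  forall i, [/\ al <= b.1 i, b.1 i < b.2 i & b.2 i <= be].

(** One stage, storing the tuple [a] at the level of [l = b'.2 0]. The second and third clauses make
    [l] selected by every [x] in the new box, and nothing between [l] and the old right end. The
    fourth drives the levels to 0, so that every element to the right of the limit point is
    eventually left outside. The last one decodes [a]. *)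
Definition box_step n (a : nat -> R) k (b b' : (nat -> R) * (nat -> R)) :=
  [/\ forall i, b.1 i < b'.1 i /\ b'.2 i < b.2 i,
      forall x, b'.1 0%N < x < b'.2 0%N -> isnext (lev (b'.2 0%N)) x (b'.2 0%N),
      forall x e, b'.1 0%N < x < b'.2 0%N -> E e -> b'.2 0%N < e < b.2 0%N ->
        ~ isnext (lev e) x e,
      forall e, E e -> b'.1 0%N < e < b'.2 0%N -> lev e < k.+1%:R^-1 &
      exists nu mu, forall z, b'.1 1%N < z < b'.2 1%N ->
        isnext (lev (b'.2 0%N)) z nu /\
        forall i y, (i < n)%N -> b'.1 i.+2 < y < b'.2 i.+2 ->
          isnext (lev (b'.2 0%N)) y (mu i) /\
          isnext (lev (b'.2 0%N)) (al + (mu i - y) / (nu - z)) (a i)].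

Lemma box_step_ex n a k b : (forall i, (i < n)%N -> E (a i)) -> box_ok b ->
  exists b', box_ok b' /\ box_step n a k b b'.
Proof.
case: b => lo hi Ea ok.
have pick i : {m | E m & lo i < m < hi i}.
  by apply/cid2; case: (ok i) => /= *; exact: E_dense.
pose nu := s2val (pick 1%N); have Enu : E nu := s2valP (pick 1%N).
have /andP[nul nuh] : lo 1%N < nu < hi 1%N := s2valP' (pick 1%N).
pose mu i := s2val (pick i.+2); have Emu i : E (mu i) := s2valP (pick i.+2).
have muP i : lo i.+2 < mu i < hi i.+2 := s2valP' (pick i.+2).
have [d d0 dP] : exists2 d : R, 0 < d & forall i, (i < n)%N ->
    d <= Num.min (lev (mu i)) (lev (a i)).
  by apply: min_pos => i ni; rewrite lt_min !lev_gt0 //; exact: Ea.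
(* Any element of level below [e1] gives a threshold at which [nu], the [mu i] and the [a i] all
   count. *)
pose e1 := Num.min d (Num.min (lev nu) k.+1%:R^-1).
have e10 : 0 < e1 by rewrite !lt_min d0 lev_gt0 //= invr_gt0 ltr0n.
(* Only finitely many elements have level at least [e1], so all levels are smaller just to the left
   of [hi 0]. *)
have [g g0 gP] := finite_gap (hi 0%N) (E_fin e10).
pose xl := Num.max (lo 0%N) (hi 0%N - g).
have [ok1 ok2 ok3] := ok 0%N.
have xlh : xl < hi 0%N by rewrite gt_max ok2 ltrBlDr ltrDl.
have xle e : E e -> xl < e < hi 0%N -> lev e < e1.
  move=> Ee /andP[xe eh]; rewrite ltNge; apply/negP => le.
  have := gP e (conj Ee le) eh; rewrite leNgt => /negP; apply.
  by apply: le_lt_trans xe; rewrite le_max lexx orbT.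
(* With [l] of maximal level, no element between [l] and [hi 0] is ever selected. *)
have [l El [/andP[xll llh] lmax]] : exists2 l, E l & xl < l < hi 0%N /\
    forall e, E e -> xl < e < hi 0%N -> lev e <= lev l.
  have alx : al <= xl by rewrite le_max ok1.
  have [e0 Ee0 e0P] := E_dense alx xlh ok3.
  have [] := @finite_argmax _ [set e | (E e /\ lev e0 <= lev e) /\ xl < e < hi 0%N] lev.
  - by apply: sub_finite_set (E_fin (lev_gt0 Ee0)) => e [].
  - by exists e0.
  move=> l [[El lel] lP] lm; exists l => //; split=> // e Ee eP.
  have [le|le] := leP (lev e0) (lev e); first exact: lm.
  by apply: le_trans (ltW le) lel.
have lP : xl < l < hi 0%N by rewrite xll.
have le1 := xle _ El lP.
set eps := lev l in le1 lmax.
have eps0 : 0 < eps by exact: lev_gt0.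
have [gx gx0 gxP] := finite_gap l (E_fin eps0).
have [gz gz0 gzP] := finite_gap nu (E_fin eps0).
have gap r : {g : R | 0 < g & forall e, E e /\ eps <= lev e -> e < r -> e <= r - g}.
  by apply/cid2; exact: finite_gap (E_fin eps0).
pose gy i := Num.min (s2val (gap (mu i))) (mu i - lo i.+2).
have gy0 i : 0 < gy i.
  by rewrite lt_min (s2valP (gap (mu i))) subr_gt0; case/andP: (muP i).
(* [m i] is the ratio to be stored; a ratio between [m i - th i] and [m i] is still decoded as
   [a i]. *)
pose m i := a i - al.
have m0 i : (i < n)%N -> 0 < m i by move=> /Ea/E_in/andP[h _]; rewrite subr_gt0.
pose th i := Num.min (s2val (gap (a i))) (m i / 2).
have th0 i : (i < n)%N -> 0 < th i.
  by move=> /m0 h; rewrite lt_min (s2valP (gap (a i))) divr_gt0.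
have thm i : (i < n)%N -> th i < m i.
  by move=> /m0 h; rewrite gt_min; apply/orP; right; lra.
have [s1 s10 s1P] : exists2 s : R, 0 < s & forall i, (i < n)%N -> s <= gy i / (2 * m i).
  by apply: min_pos => i /m0 h; rewrite divr_gt0 ?mulr_gt0.
pose s := Num.min s1 (Num.min gz (nu - lo 1%N) / 2).
have s0 : 0 < s by rewrite lt_min s10 divr_gt0 // lt_min gz0 subr_gt0.
have sgz : s < gz.
  have : s <= Num.min gz (nu - lo 1%N) / 2 by rewrite ge_min lexx orbT.
  have : Num.min gz (nu - lo 1%N) <= gz by rewrite ge_min lexx.
  by move: gz0; drop_ineqs; lra.
have snu : s < nu - lo 1%N.
  have : s <= Num.min gz (nu - lo 1%N) / 2 by rewrite ge_min lexx orbT.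
  have : Num.min gz (nu - lo 1%N) <= nu - lo 1%N by rewrite ge_min lexx orbT.
  by move: nul; drop_ineqs; lra.
have smg i : (i < n)%N -> s * m i < gy i.
  move=> ni; have mi := m0 _ ni.
  have h : s <= gy i / (2 * m i) by apply: le_trans (s1P _ ni); rewrite ge_min lexx.
  have : s * (2 * m i) <= gy i by rewrite -ler_pdivlMr // mulr_gt0.
  have := mulr_gt0 s0 mi; drop_ineqs; lra.
have [k1 k10 k1P] : exists2 c : R, 0 < c & forall i, (i < n)%N -> c <= th i / (2 * m i).
  by apply: min_pos => i ni; rewrite divr_gt0 ?mulr_gt0 ?m0 ?th0.
pose c := Num.min k1 2^-1.
have c0 : 0 < c by rewrite lt_min k10 invr_gt0 ltr0n.
have c1 : c < 1 by rewrite gt_min; apply/orP; right; lra.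
have cm i : (i < n)%N -> c * m i < th i.
  move=> ni; have mi := m0 _ ni.
  have h : c <= th i / (2 * m i) by apply: le_trans (k1P _ ni); rewrite ge_min lexx.
  have : c * (2 * m i) <= th i by rewrite -ler_pdivlMr // mulr_gt0.
  have := mulr_gt0 c0 mi; drop_ineqs; lra.
(* With [nu - z] between [s * (1 - c)] and [s], and [mu j - y] between [s * (m j - th j)] and
   [s * m j * (1 - c)], the quotient lies between [m j - th j] and [m j]. The choice
   [c * m j < th j] leaves room for [y], and a small [s] keeps [z] and [y] in the gaps before [nu]
   and [mu j]. Coordinates of index [j >= n] carry no data and shrink to their middle third. *)
pose lo' i := match i with
  | 0%N => Num.max ((xl + l) / 2) (l - gx)
  | 1%N => nu - s
  | j.+2 => if (j < n)%N then mu j - s * m j * (1 - c) else lo i + (hi i - lo i) / 3 end.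
pose hi' i := match i with
  | 0%N => l
  | 1%N => nu - s * (1 - c)
  | j.+2 => if (j < n)%N then mu j - s * (m j - th j) else lo i + 2 * (hi i - lo i) / 3 end.
have nest i : [/\ lo i < lo' i, lo' i < hi' i & hi' i < hi i].
  case: i => [|[|i]] /=.
  - split => //; last by rewrite gt_max ltrBlDr ltrDl gx0 andbT; move: xll; drop_ineqs; lra.
    rewrite lt_max; apply/orP; left; apply: le_lt_trans (_ : xl < _).
      by rewrite le_max lexx.
    by move: xll; drop_ineqs; lra.
  - have sc : 0 < s * c by rewrite mulr_gt0.
    have sc1 : s * c < s by rewrite -[ltRHS]mulr1 ltr_pM2l.
    split; first by rewrite ltrBrDl -ltrBrDr.
      by rewrite mulrBr mulr1; move: sc; drop_ineqs; lra.
    by rewrite mulrBr mulr1; move: sc1 nuh; drop_ineqs; lra.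
  - case: ifPn => ni; last first.
      by have [_ /= + _] := ok i.+2; drop_ineqs => uv; split; lra.
    have /andP[ml mh] := muP i.
    have sm0 := mulr_gt0 s0 (m0 _ ni).
    have h1 : s * m i * c > 0 by rewrite mulr_gt0.
    have h2 : gy i <= mu i - lo i.+2 by rewrite ge_min lexx orbT.
    have h3 : s * (m i - th i) > 0 by rewrite mulr_gt0 // subr_gt0 thm.
    have h4 : s * (c * m i) < s * th i by rewrite ltr_pM2l // cm.
    have := smg _ ni; move: h1 h2 h3 h4 ml mh.
    rewrite !mulrBr mulr1 (mulrC c) mulrA; drop_ineqs => *; split; lra.
exists (lo', hi'); split.
  move=> i /=; have [a1 a2 a3] := nest i; have [b1 b2 b3] := ok i; split => //.
    exact: le_trans b1 (ltW a1).
  exact: le_trans (ltW a3) b3.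
split=> /=.
- by move=> i; have [] := nest i.
- move=> x /andP[lx xl'].
  apply: (isnext_gap El _ gxP) => //; apply: ltW; apply: le_lt_trans lx.
  by rewrite le_max lexx orbT.
- move=> x e /andP[lx xl'] Ee /andP[le eh] [_ [_ h]].
  suff : e <= l by rewrite leNgt le.
  apply: h => //; split=> //; apply: lmax => //; rewrite eh andbT.
  exact: lt_trans xll le.
- move=> e Ee /andP[le el].
  have : lev e < e1.
    apply: xle => //; rewrite (lt_trans el llh) andbT.
    apply: lt_trans le; rewrite lt_max; apply/orP; left.
    by move: xll; drop_ineqs; lra.
  by rewrite !lt_min => /andP[_ /andP[]].
- exists nu, mu => z /andP[lz zh]; split.
    apply: (isnext_gap Enu _ gzP).
    + by move: le1; rewrite !lt_min => /andP[_ /andP[/ltW]].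
    + by apply: ltW; apply: le_lt_trans lz; rewrite lerD2l lerN2 ltW.
    + by apply: lt_le_trans zh _; rewrite gerBl mulr_ge0 ?ltW // subr_gt0.
  move=> i y ni; rewrite ni => /andP[ly yh].
  have ed : eps < Num.min (lev (mu i)) (lev (a i)).
    by apply: lt_le_trans (dP _ ni); move: le1; rewrite lt_min => /andP[].
  have sm0 := mulr_gt0 s0 (m0 _ ni).
  have smc : 0 < s * m i * c by rewrite mulr_gt0.
  have p0 : 0 < nu - z.
    rewrite subr_gt0; apply: lt_le_trans zh _; rewrite gerBl mulr_ge0 ?ltW //.
    by rewrite subr_gt0.
  split.
    apply: (isnext_gap (Emu i) _ (s2valP' (gap (mu i)))).
    + by move: ed; rewrite lt_min => /andP[/ltW].
    + have : gy i <= s2val (gap (mu i)) by rewrite ge_min lexx.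
      move: ly (smg _ ni) smc; rewrite mulrBr mulr1; move: (s2val _) => u; drop_ineqs; lra.
    + apply: lt_le_trans yh _; rewrite gerBl mulr_ge0 ?ltW // subr_gt0.
      exact: thm.
  have thg : th i <= s2val (gap (a i)) by rewrite ge_min lexx.
  apply: (isnext_gap (Ea _ ni) _ (s2valP' (gap (a i)))).
  + by move: ed; rewrite lt_min => /andP[_ /ltW].
  + move: thg; move: (s2val _) => G thg.
    have -> : a i = al + m i by rewrite /m addrC subrK.
    rewrite -addrA lerD2l; apply: (@le_trans _ _ (m i - th i)).
      by rewrite lerD2l lerN2.
    rewrite ler_pdivlMr //; have h : m i - th i > 0 by rewrite subr_gt0 thm.
    have : (m i - th i) * (nu - z) <= (m i - th i) * s.
      by rewrite ler_pM2l //; move: lz; drop_ineqs; lra.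
    by move: yh; rewrite (mulrC s); drop_ineqs; lra.
  + rewrite -ltrBrDl ltr_pdivrMr // -/(m i).
    have : m i * (s * (1 - c)) < m i * (nu - z).
      by rewrite ltr_pM2l ?m0 //; move: zh; drop_ineqs; lra.
    have -> : m i * (s * (1 - c)) = s * m i * (1 - c) by ring.
    by move: ly; drop_ineqs; lra.
Qed.

Hypothesis albe : al < be.

(** The sequence [A] of tuples is arbitrary. The [k]-th tuple is stored at the [k]-th selected
    level, and the parameters are the common points of the nested boxes. *)
Theorem coding n (A : nat -> nat -> R) : (forall k i, (i < n)%N -> E (A k i)) ->
  exists x z y, forall e, coded n x z y e <-> exists k, forall i, (i < n)%N -> e i = A k i.
Proof.
move=> EA.
have [F FP] : {F : (nat * ((nat -> R) * (nat -> R))) -> ((nat -> R) * (nat -> R)) &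
    forall kb, box_ok kb.2 -> box_ok (F kb) /\ box_step n (A kb.1) kb.1 kb.2 (F kb)}.
  apply: (choice (P := fun kb b' => box_ok kb.2 ->
    box_ok b' /\ box_step n (A kb.1) kb.1 kb.2 b')) => -[k b] /=.
  have [ok|] := pselect (box_ok b); last by exists b.
  by have [b' h] := @box_step_ex n (A k) k b (EA k) ok; exists b'.
pose B := fix B k := if k is j.+1 then F (j, B j) else (fun=> al, fun=> be).
have Bok k : box_ok (B k).
  elim: k => [|k IH]; first by move=> i.
  by have [] := FP (k, B k) IH.
have BS k : box_step n (A k) k (B k) (B k.+1) by have [] := FP (k, B k) (Bok k).
have pt i : {p : R | forall k, (B k).1 i < p < (B k).2 i}.
  apply/cid; apply: nested_intervals => k.
  - by case: (BS k) => /(_ i)[].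
  - by case: (BS k) => /(_ i)[].
  - by case: (Bok k i).
pose p i := sval (pt i); have pP i k : (B k).1 i < p i < (B k).2 i := svalP (pt i) k.
exists (p 0%N), (p 1%N), (fun i => p i.+2) => e; split; last first.
  move=> [k ek]; have [_ h1 _ _ [nu [mu h]]] := BS k.
  exists ((B k.+1).2 0%N); split; first exact: h1.
  exists nu; have [hz hy] := h _ (pP 1%N k.+1); split=> // i ni.
  by exists (mu i); rewrite ek //; exact: hy.
(* Conversely, a selected [l] has to be one of the right ends [(B k.+1).2 0], whose data are
   known. *)
move=> [l [sl [z' [hz hy]]]].
have El : E l by case: sl => [[]].
have xl : p 0%N < l by case: sl => [_ []].
have lb : l < (B 0%N).2 0%N by rewrite /=; case/andP: (E_in El).
(* Otherwise [l] stays inside every box and its level is below every [k.+1%:R^-1]. *)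
have [k [lk kl]] : exists k, l < (B k).2 0%N /\ (B k.+1).2 0%N <= l.
  apply: contrapT => /forallNP h.
  have hl k : l < (B k).2 0%N.
    by elim: k => [//|k IH]; rewrite ltNge; apply/negP => h'; apply: (h k).
  have l0 := lev_gt0 El.
  have [k] : exists k : nat, k.+1%:R^-1 < lev l.
    exists (Num.truncn (lev l)^-1); rewrite invf_plt ?posrE ?ltr0n //.
    by rewrite truncnS_gt // invr_ge0 ltW.
  have [_ _ _ h4 _] := BS k.
  rewrite ltNge => /negP; apply; apply: ltW; apply: h4 => //.
  by rewrite hl andbT; apply: lt_trans xl; case/andP: (pP 0%N k.+1).
have [_ h1 h2 _ [nu [mu h]]] := BS k.
move: kl; rewrite le_eqVlt => /orP[/eqP lE|kl]; last first.
  by case: (h2 _ _ (pP 0%N k.+1) El) => //; rewrite kl.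
exists k => i ni; have [hz2 hy2] := h _ (pP 1%N k.+1).
rewrite lE in hz2 hy2.
have [y' [yy ye]] := hy i ni; have [yy2 ye2] := hy2 _ _ ni (pP i.+2 k.+1).
rewrite (isnext_inj hz2 hz) (isnext_inj yy2 yy) in ye2.
exact: isnext_inj ye ye2.
Qed.

End Coding.

(** * Sets of natural numbers as points of a Cantor set *)

Section CantorScheme.
Variables (R : realType) (al be : R).
Hypothesis albe : al < be.

Let w := be - al.
(** With ratio 1/4 the terms after [n] add up to [ga n / 3], so two sums that first differ at [n]
    are at least [2 / 3 * ga n] apart. This leaves [ga n / 2] in [sep] and balls of radius
    [ga n / 4] around the points. *)
Let ga n : R := w * (4^-1) ^+ n.+1.

Let w0 : 0 < w. Proof. by rewrite subr_gt0. Qed.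

Let ga0 n : 0 < ga n. Proof. by rewrite mulr_gt0 // exprn_gt0 // invr_gt0 ltr0n. Qed.

Let gaS n : ga n.+1 = ga n / 4.
Proof. by rewrite /ga exprSr mulrA. Qed.

Let ga_le m n : (m <= n)%N -> ga n <= ga m.
Proof.
elim: n => [|n IH]; first by rewrite leqn0 => /eqP ->.
rewrite leq_eqVlt ltnS => /orP[/eqP ->//|/IH]; have := ga0 n; rewrite gaS; lra.
Qed.

Let ga_small (r : R) : 0 < r -> exists n, ga n < r.
Proof.
move=> r0; have wr : 0 <= w / r by rewrite divr_ge0 // ltW.
exists (Num.truncn (w / r)); set n := Num.truncn _.
have h : w / r < n.+1%:R by rewrite truncnS_gt.
have h4 k : (k%:R : R) < 4 ^+ k.
  elim: k => [|k IH]; first by rewrite ltr01.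
  by rewrite exprS -natr1; have : 1 <= (4 : R) ^+ k; [apply: exprn_ege1; lra|lra].
rewrite /ga exprVn ltr_pdivrMr ?exprn_gt0 // mulrC -ltr_pdivrMr //.
exact: lt_trans h (h4 _).
Qed.

Let s (A : set nat) n : R := \sum_(k < n) (if `[< A k >] then ga k else 0).

Let sS A n : s A n.+1 = s A n + (if `[< A n >] then ga n else 0).
Proof. by rewrite /s big_ord_recr. Qed.

(** All the sums lie in [[0, w / 3]]; the offset [w / 3] centres them, with room for the balls on
    both sides. *)
Let c (A : set nat) := al + w / 3 + sup (range (s A)).

Let s_homo A m n : (m <= n)%N -> s A m <= s A n.
Proof.
elim: n => [|n IH]; first by rewrite leqn0 => /eqP ->.
rewrite leq_eqVlt ltnS => /orP[/eqP ->//|/IH h]; rewrite sS.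
by have := ga0 n; case: ifP; lra.
Qed.

Let s_ub A n : ubound (range (s A)) (s A n + 4 / 3 * ga n).
Proof.
have T m : (n <= m)%N -> s A m + 4 / 3 * ga m <= s A n + 4 / 3 * ga n.
  elim: m => [|m IH]; first by rewrite leqn0 => /eqP ->.
  rewrite leq_eqVlt ltnS => /orP[/eqP ->//|/IH h]; rewrite sS gaS.
  by have := ga0 m; case: ifP; lra.
move=> _ [m _ <-]; have [mn|nm] := leqP m n.
  by have := s_homo A mn; have := ga0 n; lra.
by have := T _ (ltnW nm); have := ga0 m; lra.
Qed.

Let c_ge A n : al + w / 3 + s A n <= c A.
Proof.
rewrite /c lerD2l; apply: ub_le_sup; last by exists n.
by exists (s A 0 + 4 / 3 * ga 0); exact: s_ub.
Qed.

Let c_le A n : c A <= al + w / 3 + s A n + 4 / 3 * ga n.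
Proof.
rewrite /c -!addrA !lerD2l; apply: ge_sup; last by move=> r /s_ub.
by exists (s A 0), 0%N.
Qed.

Let agree A B n : (forall k, (k < n)%N -> (A k <-> B k)) -> s A n = s B n.
Proof.
move=> h; apply: eq_bigr => k _; congr (if _ then _ else _).
by apply/asboolP/asboolP => /h; apply.
Qed.

Let sep A B n : A n -> ~ B n -> ga n / 2 < `|c A - c B|.
Proof.
move=> An Bn.
have ex : exists m, ~~ (`[< A m >] == `[< B m >]).
  by exists n; rewrite (asboolT An) (asboolF Bn).
have [m + mn] := ex_minnP ex.
have ag : s A m = s B m.
  apply: agree => k km; have [] := boolP (`[< A k >] == `[< B k >]).
    by move=> /eqP e; split=> h; apply/asboolP; [rewrite -e|rewrite e]; apply/asboolP.
  by move/mn; rewrite leqNgt km.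
have gm : ga n <= ga m.
  by apply/ga_le/mn; rewrite (asboolT An) (asboolF Bn).
have := c_ge A m.+1; have := c_ge B m.+1; have := c_le A m.+1; have := c_le B m.+1.
have gm0 := ga0 m; have := ga0 n.
rewrite !sS ag gaS; case: `[< A m >]; case: `[< B m >] => //= *.
- by apply: lt_le_trans (ler_norm _); lra.
- by rewrite distrC; apply: lt_le_trans (ler_norm _); lra.
Qed.

(* The image of a Cantor set in (al, be): the n-th bit of a point x is read off
   from membership in two disjoint open sets. *)
Lemma cantor_scheme : exists U V : nat -> R -> Prop,
  [/\ forall n x, U n x \/ V n x -> al < x < be,
      forall n x, U n x -> exists2 r : R, 0 < r & forall y, `|y - x| < r -> U n y,
      forall n x, V n x -> exists2 r : R, 0 < r & forall y, `|y - x| < r -> V n y &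
      forall n x, U n x -> V n x -> False] /\
  (forall A : set nat, exists x, forall n, (A n -> U n x) /\ (~ A n -> V n x)) /\
  (forall x y, (forall n, (U n x /\ U n y) \/ (V n x /\ V n y)) -> x = y).
Proof.
pose W (b : bool) n x := exists2 A : set nat, `[< A n >] = b & `|x - c A| < ga n / 4.
exists (W true), (W false).
have op b n x : W b n x -> exists2 r : R, 0 < r & forall y, `|y - x| < r -> W b n y.
  move=> [A An xA]; exists (ga n / 4 - `|x - c A|); first by rewrite subr_gt0.
  move=> y yx; exists A => //; have := ler_distD x y (c A); lra.
have dis n x : W true n x -> W false n x -> False.
  move=> [A /asboolP An xA] [B /asboolPn Bn xB]; have := sep An Bn.
  have := ler_distD x (c A) (c B); rewrite (distrC (c A) x); lra.
split; first (split; [|exact: op|exact: op|exact: dis]).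
- move=> n x h.
  have [A xA] : exists A, `|x - c A| < ga n / 4 by case: h => -[A _]; exists A.
  have := c_ge A 0; have := c_le A 0; rewrite /s big_ord0 /=.
  have g0 : ga 0%N = w / 4 by rewrite /ga expr1.
  have : ga n <= w / 4 by rewrite -g0 ga_le.
  have := ga0 n; rewrite g0.
  by move: xA; rewrite ltr_norml => /andP[]; rewrite /w => *; apply/andP; split; lra.
split=> [A|x y xy].
  exists (c A) => n; split=> h; exists A; rewrite ?subrr ?normr0 ?divr_gt0 //.
    exact: asboolT.
  exact: asboolF.
pose A := [set n | W true n x].
suff key z : (forall n, (W true n x /\ W true n z) \/ (W false n x /\ W false n z)) -> z = c A.
  by rewrite (key y xy) (key x) // => n; case: (xy n) => -[]; [left|right].
move=> xz.
have zA n : (W true n z <-> A n) /\ (W true n z \/ W false n z).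
  case: (xz n) => -[xn zn]; split; [|by left| |by right]; split => //.
    by move=> /dis /(_ zn).
  by move=> /dis /(_ xn).
apply/eqP; rewrite -subr_eq0 -normr_le0 leNgt; apply/negP => /ga_small[n].
apply/negP; rewrite -leNgt.
(* The ball that decides bit [n] of [z] is around some [c B], and [z] forces [B] to agree with [A]
   up to [n]. Hence [c B] is within [ga n / 3] of [c A], and [z] within
   [ga n / 4 + ga n / 3 < ga n]. *)
have [B Bn zB] : exists2 B : set nat, (forall k, (k < n.+1)%N -> (B k <-> A k)) &
    `|z - c B| < ga n / 4.
  have hB B : `|z - c B| < ga n / 4 -> forall k, (k < n.+1)%N -> (B k <-> A k).
    move=> zB k kn; have gk : ga n <= ga k by rewrite ga_le.
    have [h1 h2] := zA k; rewrite -h1; split=> Bk.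
      by exists B; [exact: asboolT|lra].
    apply: contrapT => nBk; apply: (@dis k z) => //.
    by exists B; [exact: asboolF|lra].
  by case: (zA n) => _ [] [B _ zB]; exists B => //; exact: hB.
have := agree Bn; have := c_ge A n.+1; have := c_ge B n.+1.
have := c_le A n.+1; have := c_le B n.+1; rewrite gaS; have := ga0 n => g0 a1 a2 a3 a4 a5.
have : `|c B - c A| <= ga n / 3 by rewrite ler_norml; apply/andP; split; lra.
have := ler_distD (c B) z (c A); lra.
Qed.

End CantorScheme.

(** * From a definable dense filtered set to the power set of the natural numbers *)

Section PNCopy.
Variables (R : realType) (L : language) (M : fo_structure L R).
Hypothesis Mexp : expands_ordered_add_group M.
Variable C : chart M.
Local Notation S := (cdom C).
Local Notation val := (cval C).
Variables (Lev : R -> R -> Prop) (al be : R).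
Hypothesis Lev_def : Def2 M Lev.
Hypothesis albe : al < be.
Hypothesis Lev_fin : forall e, 0 < e ->
  finite_set [set u | [/\ S u, al < val u < be & Lev e u]].
Hypothesis Lev_anti : forall e e' u, 0 < e' -> e' <= e -> Lev e u -> Lev e' u.
Hypothesis Lev_dense : forall r1 r2, al <= r1 -> r1 < r2 -> r2 <= be ->
  exists u e, [/\ 0 < e, S u, Lev e u & r1 < val u < r2].

(** Its supremum turns the family [Lev] into one level function; the element 0 and the cap 1 make
    the supremum exist for every [u]. *)
Let lset u : set R := [set e | e = 0 \/ (0 < e /\ e <= 1 /\ Lev e u)].
Let dl u := sup (lset u).

Let lset_sup u : has_sup (lset u).
Proof.
split; first by exists 0; left.
by exists 1 => e [->|[_ []//]]; exact: ler01.
Qed.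

Let dl_ge e u : 0 < e -> e <= 1 -> Lev e u -> e <= dl u.
Proof. by move=> e0 e1 h; apply: ub_le_sup; [case: (lset_sup u)|right]. Qed.

(** The supremum need not be attained, whence the factor 2. *)
Let dl_lev e u : 0 < e -> e <= dl u -> Lev (e / 2) u.
Proof.
move=> e0 h; have : exists2 x, lset u x & e / 2 < x.
  have e20 : 0 < e / 2 by rewrite divr_gt0.
  have [x lx hx] := sup_adherent e20 (lset_sup u); exists x => //.
  by apply: le_lt_trans hx; rewrite -/(dl u); lra.
by case=> x [->|[x0 [x1 lx]]] ex; [lra|apply: Lev_anti lx => //; lra].
Qed.

Let dl_def : Def2 M (fun u e => e = dl u).
Proof.
apply: (@Def_ext _ _ _ (fun v =>
  (forall x, x = 0 \/ (0 < x /\ x <= 1 /\ Lev x (v 0%N)) -> x <= v 1%N) /\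
  (forall e', (forall x, x = 0 \/ (0 < x /\ x <= 1 /\ Lev x (v 0%N)) -> x <= e') ->
    v 1%N <= e'))).
  move=> v; split=> [[h1 h2]|->].
    apply/eqP; rewrite eq_le h2 ?ge_sup //; first by case: (lset_sup (v 0%N)).
    by move=> x hx; apply: ub_le_sup => //; case: (lset_sup (v 0%N)).
  split=> [x hx|e' h]; first by apply: ub_le_sup => //; case: (lset_sup (v 0%N)).
  by apply: ge_sup => //; case: (lset_sup (v 0%N)).
have hc a b : DefT M a -> DefT M b ->
    Def M (fun v => a v = 0 \/ (0 < a v /\ a v <= 1 /\ Lev (a v) (b v))).
  move=> ha hb; apply: Def_or; first by apply: Def_eq => //; exact: DefT_cst.
  apply: Def_and; first by apply: Def_lt => //; exact: DefT_cst.
  apply: Def_and; first by apply: Def_le => //; exact: DefT_cst.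
  exact: (Def2_app Lev_def).
apply: Def_and; apply: Def_all.
  by apply: Def_imp; [apply: hc|apply: Def_le => //]; exact: DefT_var.
apply: Def_imp; last by apply: Def_le => //; exact: DefT_var.
apply: Def_all; apply: Def_imp; first by apply: hc; exact: DefT_var.
by apply: Def_le => //; exact: DefT_var.
Qed.

Let vi r := s2val (cid2 (cval_surj C r)).

Let vi_dom r : S (vi r). Proof. exact: (s2valP (cid2 (cval_surj C r))). Qed.

Let viK r : val (vi r) = r. Proof. exact: (s2valP' (cid2 (cval_surj C r))). Qed.

Let valK u : S u -> vi (val u) = u.
Proof. by move=> Su; apply: (cval_inj (vi_dom _) Su); rewrite viK. Qed.

(** The decoding divides, so the coded set has to consist of field values; the levels stay lengths
    in the additive group. *)
Let E r := al < r < be /\ 0 < dl (vi r).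
Let lev r := dl (vi r).

Let E_in e : E e -> al < e < be. Proof. by case. Qed.

Let lev_gt0 e : E e -> 0 < lev e. Proof. by case. Qed.

Let E_fin eps : 0 < eps -> finite_set [set e | E e /\ eps <= lev e].
Proof.
move=> e0; have e20 : 0 < eps / 2 by rewrite divr_gt0.
apply: sub_finite_set (finite_image val (Lev_fin e20)) => e [[ein _] le] /=.
by exists (vi e); rewrite ?viK //; split; rewrite ?viK //; exact: dl_lev.
Qed.

Let E_dense r1 r2 : al <= r1 -> r1 < r2 -> r2 <= be -> exists2 e, E e & r1 < e < r2.
Proof.
move=> a1 a2 a3; have [u [e [e0 Su lu ur]]] := Lev_dense a1 a2 a3.
exists (val u) => //; split; first by move: ur => /andP[]; lra.
rewrite valK //; have m0 : 0 < Num.min e 1 by rewrite lt_min e0 ltr01.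
apply: lt_le_trans m0 _; apply: dl_ge; rewrite ?lt_min ?e0 ?ltr01 ?ge_min ?lexx ?orbT //.
by apply: Lev_anti lu; rewrite ?lt_min ?e0 ?ltr01 ?ge_min ?lexx.
Qed.

Let E_defK a : KT C a -> Def M (fun v => E (a v)).
Proof.
move=> ha; apply: (@Def_ext _ _ _ (fun v => (al < a v /\ a v < be) /\
   exists u, (S u /\ val u = a v) /\ 0 < dl u)).
  move=> v; split=> [[[h1 h2] [u [[Su ua] du]]]|[/andP[h1 h2] h]].
    by split; [rewrite h1|rewrite -ua valK].
  by split=> //; exists (vi (a v)); rewrite viK; split; [split|].
apply: Def_and; first by apply: Def_and; apply: (Def_ltK (C := C)) => //; exact: KT_cst.
apply: Def_ex; apply: Def_and; first exact: (KT_at 0 (fun i => i.+1) ha).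
by apply: Def_lt; [|exact: DefT_cst|exact: (DefT_fun dl_def (DefT_var M 0))].
Qed.

Let lev_leK a b : KT C a -> KT C b -> Def M (fun v => lev (a v) <= lev (b v)).
Proof.
move=> ha hb; apply: (@Def_ext _ _ _ (fun v => exists u, exists w,
   (S u /\ val u = a v) /\ (S w /\ val w = b v) /\ dl u <= dl w)).
  move=> v; split=> [[u [w [[Su <-] [[Sw <-] h]]]]|h]; first by rewrite /lev !valK.
  by exists (vi (a v)), (vi (b v)); rewrite !viK.
apply: Def_ex; apply: Def_ex; apply: Def_and; first exact: (KT_at 1 (fun i => i.+2) ha).
apply: Def_and; first exact: (KT_at 0 (fun i => i.+2) hb).
apply: Def_le => //; first exact: (DefT_fun dl_def (DefT_var M 1)).
exact: (DefT_fun dl_def (DefT_var M 0)).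
Qed.

Let KT_var k : KT C (fun v => val (v k)).
Proof. by apply: KT_val; exact: DefT_var. Qed.

Let Def_exK (P : R -> (nat -> R) -> Prop) :
  Def M (fun v => P (val (v 0%N)) (fun i => v i.+1)) -> Def M (fun v => exists r, P r v).
Proof.
move=> h; apply: (@Def_ext _ _ _ (fun v => exists x, P (val x) v)); last exact: Def_ex.
by move=> v; split=> [[x]|[r]]; [exists (val x)|exists (vi r); rewrite viK].
Qed.

Let Def_allK (P : R -> (nat -> R) -> Prop) :
  Def M (fun v => P (val (v 0%N)) (fun i => v i.+1)) -> Def M (fun v => forall r, P r v).
Proof.
move=> h; apply: (@Def_ext _ _ _ (fun v => forall x, P (val x) v)); last exact: Def_all.
by move=> v; split=> h' r //; rewrite -(viK r).
Qed.

(** Thresholds have the form [lev l]: levels are compared with levels only, never with field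
    values. *)
Let isnext_defK l r e : KT C l -> KT C r -> KT C e ->
  Def M (fun v => isnext E lev (lev (l v)) (r v) (e v)).
Proof.
move=> hl hr he; apply: Def_and.
  by apply: Def_and; [exact: E_defK|exact: lev_leK].
apply: Def_and; first exact: (Def_ltK (C := C)).
have sh a : KT C a -> KT C (fun v => a (fun i => v i.+1)) by exact: KT_ren.
apply: Def_allK; apply: Def_imp.
  by apply: Def_and; [exact: (E_defK (KT_var 0))|exact: (lev_leK (sh _ hl) (KT_var 0))].
apply: Def_imp; first exact: (Def_ltK (sh _ hr) (KT_var 0)).
exact: (Def_leK (sh _ he) (KT_var 0)).
Qed.

Let coded_def x z (y : nat -> R) (a : nat -> (nat -> R) -> R) n :
  (forall i, KT C (a i)) -> Def M (fun v => coded E lev al n x z y (fun i => a i v)).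
Proof.
move=> ha.
apply: Def_exK; apply: Def_and.
  by apply: isnext_defK => //; exact: KT_cst.
apply: Def_exK; apply: Def_and.
  by apply: isnext_defK => //; exact: KT_cst.
(* The bounded quantifier over [i] lives outside the structure; it is unrolled into a finite
   conjunction. *)
elim: n => [|n IH].
  apply: (@Def_ext _ _ _ (fun v => v 0%N = v 0%N)) => //.
  by apply: Def_eq; exact: DefT_var.
apply: (@Def_ext _ _ _ (fun v =>
  (exists y', isnext E lev (lev (val (v 1%N))) (y n) y' /\ isnext E lev (lev (val (v 1%N)))
    (al + (y' - y n) / (val (v 0%N) - z)) (a n (fun i => v i.+2))) /\
  (forall i, (i < n)%N -> exists y', isnext E lev (lev (val (v 1%N))) (y i) y' /\
   isnext E lev (lev (val (v 1%N))) (al + (y' - y i) / (val (v 0%N) - z)) (a i (fun i => v i.+2))))).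
  move=> v; split=> [[h1 h2] i|h]; last by split=> [|i ni]; apply: h => //; exact: ltnW.
  by rewrite ltnS leq_eqVlt => /orP[/eqP ->|/h2].
apply: Def_and IH; apply: Def_exK; apply: Def_and.
  by apply: isnext_defK => //; exact: KT_cst.
apply: isnext_defK => //; last exact: (KT_ren (fun i => i.+3) (ha n)).
apply: KT_add; first exact: KT_cst.
by apply: KT_mul; [|apply: KT_inv]; apply: KT_add => //; exact: KT_cst.
Qed.

Let E_count : (E #= [set: nat])%card.
Proof.
apply: eq_card_nat.
  apply: (@sub_countable _ _ _ (\bigcup_n [set e | E e /\ n.+1%:R^-1 <= lev e])).
    apply: subset_card_le => e Ee; have l0 := lev_gt0 Ee.
    exists (Num.truncn (lev e)^-1) => //; split=> //; apply: ltW.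
    rewrite invf_plt ?posrE ?ltr0n //.
    by rewrite truncnS_gt // invr_ge0 ltW.
  apply: bigcup_countable => // n _; apply: finite_set_countable; apply: E_fin.
  by rewrite invr_gt0 ltr0n.
move=> Ef; have [g g0 h] := finite_gap be Ef.
have [|||e Ee /andP[e1 e2]] := @E_dense (Num.max al (be - g)) be.
- by rewrite le_max lexx.
- by rewrite gt_max albe ltrBlDr ltrDl.
- by [].
have := h e Ee e2; rewrite leNgt => /negP; apply; apply: le_lt_trans e1.
by rewrite le_max lexx orbT.
Qed.

Let enum_E : exists (g : R -> nat) (en : nat -> R),
  [/\ forall n, E (en n), forall n, g (en n) = n & forall r, E r -> en (g r) = r].
Proof.
have /card_set_bijP[g [gE ginj gsurj]] := E_count.
have h n : {r | E r & g r = n} by apply/cid2; have [r] := gsurj n I; exists r.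
exists g, (fun n => s2val (h n)); split=> [n|n|r Er].
- exact: (s2valP (h n)).
- exact: (s2valP' (h n)).
- apply: ginj; rewrite ?inE //; first exact: (s2valP (h _)).
  exact: (s2valP' (h _)).
Qed.

(** Every ternary relation on the countable set [E] is definable: its triples are listed and coded.
    The list needs a default triple, so the empty relation is treated apart. Three arguments suffice
    for the graphs of the operations and for a sequence of open sets. *)
Let rel3_def (Q : R -> R -> R -> Prop) a b c :
  (forall x y z, Q x y z -> [/\ E x, E y & E z]) ->
  KT C a -> KT C b -> KT C c -> Def M (fun v => Q (a v) (b v) (c v)).
Proof.
move=> QE ha hb hc.
have [[x0 [y0 [z0 Q0]]]|nQ] := pselect (exists x y z, Q x y z); last first.
  apply: (@Def_ext _ _ _ (fun v => ~ (v 0%N = v 0%N))).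
    by move=> v; split=> [//|q]; case: nQ; exists (a v), (b v), (c v).
  by apply: Def_not; apply: Def_eq; exact: DefT_var.
have [g [en [enE genK engK]]] := enum_E.
pose t3 (x y z : R) (i : nat) := match i with 0%N => x | 1%N => y | _ => z end.
pose A k := if unpickle k is Some (i, (j, l)) then
   if pselect (Q (en i) (en j) (en l)) then t3 (en i) (en j) (en l) else t3 x0 y0 z0
   else t3 x0 y0 z0.
have t3E x y z : Q x y z -> forall i, E (t3 x y z i).
  by move=> /QE[? ? ?] [|[|]].
have AQ k : Q (A k 0%N) (A k 1%N) (A k 2%N).
  by rewrite /A; case: unpickle => [[i [j l]]|//]; case: pselect.
have AE k i : (i < 3)%N -> E (A k i).
  by move=> _; rewrite /A; case: unpickle => [[? [? ?]]|]; [case: pselect => ?|]; apply: t3E.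
have [x [z [y xyz]]] := coding E_in lev_gt0 E_fin E_dense albe AE.
pose f i v := t3 (a v) (b v) (c v) i.
apply: (@Def_ext _ _ _ (fun v => coded E lev al 3 x z y (fun i => f i v))).
  move=> v; rewrite xyz; split=> [[k hk]|q].
    by have := AQ k; rewrite -!hk.
  have [Ea Eb Ec] := QE _ _ _ q.
  exists (pickle (g (a v), (g (b v), g (c v)))) => i i3.
  by rewrite /A pickleK !engK //; case: pselect.
by apply: coded_def => -[|[|i]].
Qed.

Let tupE (t : 1.-tuple R) : t = [tuple thead t].
Proof. by apply: eq_from_tnth => i; rewrite ord1 [RHS](tnth_nth 0). Qed.

Theorem PN_copy : defines_PN_copy M.
Proof using All.
have [g [en [enE genK engK]]] := enum_E.
have [U [V [[UVin Uop Vop UVdis] [UVex UVinj]]]] := cantor_scheme albe.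
(* An open set is the union of the intervals with endpoints in the dense set [E] that it contains.
   So the whole sequence [W] is recorded by one ternary relation on [E], and membership of arbitrary
   reals becomes definable. *)
pose QW (W : nat -> R -> Prop) a b c := [/\ E a, E b, E c & forall x, b < x < c -> W (g a) x].
have WP (W : nat -> R -> Prop) : (forall n x, W n x -> al < x < be) ->
    (forall n x, W n x -> exists2 r : R, 0 < r & forall y, `|y - x| < r -> W n y) ->
    forall a x, (E a /\ W (g a) x) <-> exists b c, QW W a b c /\ b < x /\ x < c.
  move=> Win Wop a x; split=> [[Ea wx]|[b [c [[Ea _ _ h] [bx xc]]]]]; last first.
    by split=> //; apply: h; rewrite bx.
  have /andP[ax xb] := Win _ _ wx; have [r r0 rP] := Wop _ _ wx.
  have [|||b Eb /andP[b1 b2]] := @E_dense (Num.max al (x - r)) x.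
  - by rewrite le_max lexx.
  - by rewrite gt_max ax ltrBlDr ltrDl.
  - exact: ltW.
  have [|||c Ec /andP[c1 c2]] := @E_dense x (Num.min be (x + r)).
  - exact: ltW.
  - by rewrite lt_min xb ltrDl.
  - by rewrite ge_min lexx.
  exists b, c; split; [split=> // y /andP[y1 y2]|by []].
  apply: rP; rewrite ltr_norml; move: b1 c2; rewrite gt_max lt_min => /andP[_ h1] /andP[_ h2].
  by apply/andP; split; lra.
have W_def W a x : (forall n x, W n x -> al < x < be) ->
    (forall n x, W n x -> exists2 r : R, 0 < r & forall y, `|y - x| < r -> W n y) ->
    KT C a -> KT C x -> Def M (fun v => E (a v) /\ W (g (a v)) (x v)).
  move=> Win Wop ha hx.
  apply: (@Def_ext _ _ _ (fun v => exists b c, QW W (a v) b c /\ b < x v /\ x v < c)).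
    by move=> v; rewrite WP.
  have hx2 : KT C (fun v => x (fun i => v i.+2)) by exact: KT_ren.
  apply: Def_exK; apply: Def_exK; apply: Def_and.
    apply: rel3_def => //; last exact: (KT_ren (fun i => i.+2) ha).
    by move=> ? ? ? [].
  by apply: Def_and; apply: (Def_ltK (C := C)).
have Uin n x : U n x -> al < x < be by move=> h; apply: (UVin n); left.
have Vin n x : V n x -> al < x < be by move=> h; apply: (UVin n); right.
(* The codes of sets are the reals all of whose bits are decided. *)
pose PSr x := forall a, E a -> (E a /\ U (g a) x) \/ (E a /\ V (g a) x).
have PSr_def : Def M (fun v => PSr (val (v 0%N))).
  apply: Def_allK; apply: Def_imp; first exact: E_defK.
  by apply: Def_or; apply: W_def.
pose NS := [set t : 1.-tuple R | S (thead t) /\ E (val (thead t))].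
pose PS := [set t : 1.-tuple R | S (thead t) /\ PSr (val (thead t))].
pose mem (s t : 1.-tuple R) := U (g (val (thead s))) (val (thead t)).
pose gt (t : 1.-tuple R) := g (val (thead t)).
pose op (o : nat -> nat -> nat) (s t : 1.-tuple R) : 1.-tuple R :=
  [tuple vi (en (o (gt s) (gt t)))].
have th (x : R) : thead [tuple x] = x by [].
have nth_th (z : 1.-tuple R) : nth 0 z 0 = thead z by rewrite /thead (tnth_nth 0).
have NSt u : S u -> E (val u) -> NS [tuple u] by split.
have NSop o s t : NS (op o s t) by apply: NSt; [exact: vi_dom|rewrite viK].
have gop o s t : gt (op o s t) = o (gt s) (gt t) by rewrite /gt /op th viK genK.
have op_def o : definable_tuple_op M NS (op o).
  pose Q a b c := [/\ E a, E b, E c & g c = o (g a) (g b)].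
  apply: (@Def_to_definable _ _ _ _ 0 (fun v => S (v 0%N) /\ S (v 1%N) /\ S (v 2%N) /\
    Q (val (v 0%N)) (val (v 1%N)) (val (v 2%N)))).
    do 3! (apply: Def_and; first by apply: Def_dom; exact: DefT_var).
    by apply: rel3_def => // ? ? ? [].
  move=> z; split.
    move=> [s [Ss Es] [t [St Et] <-]].
    move: Ss Es St Et; rewrite (tupE s) (tupE t); move: (thead s) (thead t) => u w.
    rewrite !th => Su Eu Sw Ew.
    change (S u /\ S w /\ S (vi (en (o (g (val u)) (g (val w))))) /\
      Q (val u) (val w) (val (vi (en (o (g (val u)) (g (val w))))))).
    by rewrite /Q viK genK; split=> //; split=> //; split.
  move=> [S0 [S1 [S2 [E0 E1 E2 gE]]]].
  exists [tuple nth 0 z 0]; first by split.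
  exists [tuple nth 0 z 1]; first by split.
  apply: eq_from_tnth => i; rewrite !(tnth_nth 0).
  case: i => -[|[|[|//]]] ? //=.
  by rewrite /gt !th -gE engK // valK.
exists 1%N, 1%N, NS, PS, mem, (op addn), (op muln); split; first split.
- apply: (@Def_to_definable _ _ _ _ 0 (fun v => S (v 0%N) /\ E (val (v 0%N)))).
    by apply: Def_and; [apply: Def_dom; exact: DefT_var|exact: E_defK].
  by move=> z /=; rewrite nth_th.
- apply: (@Def_to_definable _ _ _ _ 0 (fun v => S (v 0%N) /\ PSr (val (v 0%N)))).
    by apply: Def_and => //; apply: Def_dom; exact: DefT_var.
  by move=> z /=; rewrite nth_th.
- apply: (@Def_to_definable _ _ _ _ 0 (fun v => S (v 0%N) /\ (S (v 1%N) /\ PSr (val (v 1%N))) /\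
    (E (val (v 0%N)) /\ U (g (val (v 0%N))) (val (v 1%N))))).
    apply: Def_and; first by apply: Def_dom; exact: DefT_var.
    apply: Def_and; last exact: W_def.
    apply: Def_and; first by apply: Def_dom; exact: DefT_var.
    exact: (@Def_ren _ _ _ _ (fun=> 1%N) PSr_def).
  move=> z; split.
    move=> [s [t [[Ss Es] [St Et] m ->]]].
    move: Ss Es St Et m; rewrite /mem (tupE s) (tupE t); move: (thead s) (thead t) => u w.
    rewrite !th => Su Eu Sw Ew m.
    by change (S u /\ (S w /\ PSr (val w)) /\ (E (val u) /\ U (g (val u)) (val w))).
  move=> [S0 [[S1 P1] [E0 m]]].
  exists [tuple nth 0 z 0], [tuple nth 0 z 1]; split=> //.
  apply: eq_from_tnth => i; rewrite !(tnth_nth 0).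
  by case: i => -[|[|//]] ?.
- exact: op_def.
- exact: op_def.
split; first by split=> x y _ _; exact: NSop.
exists (fun t => [set n | U n (val (thead t))]), gt; split.
- split=> // [s t|A _].
    rewrite !inE => -[Ss Es] [St Et] e; rewrite (tupE s) (tupE t).
    suff : val (thead s) = val (thead t) by move/(cval_inj Ss St) => ->.
    apply: UVinj => n.
    have eU : U n (val (thead s)) <-> U n (val (thead t)).
      by have : [set n | U n (val (thead s))] n <-> [set n | U n (val (thead t))] n by rewrite e.
    have [[_ h1]|[_ h1]] := Es _ (enE n); have [[_ h2]|[_ h2]] := Et _ (enE n);
      rewrite genK in h1 h2.
    + by left.
    + by left; split=> //; apply/eU.
    + by left; split=> //; apply/eU.
    + by right.
  have [x xA] := UVex A; exists [tuple vi x].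
    split; first exact: vi_dom.
    rewrite th viK => a Ea; have [h1 h2] := xA (g a).
    by have [/h1|/h2] := pselect (A (g a)); [left|right].
  rewrite th viK; apply/seteqP; split=> n /= h; have [h1 h2] := xA n; last exact: h1.
  by apply: contrapT => /h2 /(UVdis _ _ h).
- split=> // [s t|n _].
    rewrite !inE => -[Ss Es] [St Et] e; rewrite (tupE s) (tupE t).
    have : val (thead s) = val (thead t) by rewrite -(engK _ Es) -(engK _ Et); congr en.
    by move/(cval_inj Ss St) => ->.
  exists [tuple vi (en n)]; first by apply: NSt; [exact: vi_dom|rewrite viK].
  by rewrite /gt th viK genK.
- by [].
- by move=> x y _ _; exact: gop.
- by move=> x y _ _; exact: gop.
Qed.

End PNCopy.

(** * The field of slopes of a C^1 function *)

Section OrderEstimates.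
Variable R : realFieldType.
Implicit Types x y z k : R.

Lemma min_half x y : 0 < x -> 0 < y ->
  [/\ 0 < Num.min x y / 2, Num.min x y / 2 < x & Num.min x y / 2 < y].
Proof.
move=> x0 y0; have m0 : 0 < Num.min x y by rewrite lt_min x0.
have mx : Num.min x y <= x by rewrite ge_min lexx.
have my : Num.min x y <= y by rewrite ge_min lexx orbT.
by split; lra.
Qed.

Lemma in_window x y k (u w : R) : x - k < y -> y < x + k -> k <= x - u -> k <= w - x ->
  u <= y <= w.
Proof. by move=> *; apply/andP; split; lra. Qed.

Lemma window_trans x y z k : `|y - x| < k / 2 -> y - k / 2 < z -> z < y + k / 2 ->
  x - k < z /\ z < x + k.
Proof. by rewrite ltr_norml => /andP[? ?] *; split; lra. Qed.

End OrderEstimates.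

Section RealLemmas.
Variable R : realType.
Implicit Types (f g : R -> R) (a b c d r s x y : R).

Lemma contP g x : {for x, continuous g} <->
  forall e, 0 < e -> exists2 d, 0 < d & forall y, `|y - x| < d -> `|g y - g x| < e.
Proof.
split=> [/cvgrPdist_lt h e e0|h].
  have /nbhs_ballP[d d0 dP] := h e e0; exists d => // y yx.
  by rewrite distrC; apply: dP; rewrite /ball /= distrC.
apply/cvgrPdist_lt => e e0; have [d d0 dP] := h e e0.
apply/nbhs_ballP; exists d => //= y; rewrite /ball /= => yx.
by rewrite distrC; apply: dP; rewrite distrC.
Qed.

Lemma first_hit g c d r : c <= d ->
  (forall x, c <= x <= d -> {for x, continuous g}) -> g c < r -> r <= g d ->
  exists t, [/\ c < t, t <= d, g t = r & forall u, c <= u -> u < t -> g u < r].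
Proof.
move=> cd cg gc gd.
pose A := [set t | c <= t <= d /\ r <= g t].
have hA : has_inf A by split; [exists d; split; rewrite ?cd ?lexx|exists c => t [/andP[]]].
pose t := inf A.
have ct : c <= t by apply: lb_le_inf; [case: hA|move=> u [/andP[]]].
have td : t <= d by apply: ge_inf; [case: hA|split; rewrite ?cd ?lexx].
have lt_t u : c <= u -> u < t -> g u < r.
  move=> cu ut; rewrite ltNge; apply/negP => ru.
  have : t <= u by apply: ge_inf; [case: hA|split; rewrite ?cu //= (le_trans (ltW ut))].
  by rewrite leNgt ut.
have /contP ctt : {for t, continuous g} by apply: cg; rewrite ct.
have gt_ge : r <= g t.
  rewrite leNgt; apply/negP => gr.
  have [|e e0 eP] := ctt (r - g t); first by rewrite subr_gt0.
  have [u [/andP[cu ud] ru] ue] := inf_adherent e0 hA.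
  have tu : t <= u by apply: ge_inf; [case: hA|split; rewrite ?cu].
  have := eP u; rewrite ger0_norm ?subr_ge0 // ltrBlDl ue => /(_ isT).
  by rewrite ltr_norml => /andP[]; lra.
have ct' : c < t.
  by rewrite lt_neqAle ct andbT; apply/eqP => e; move: gt_ge; rewrite -e leNgt gc.
exists t; split=> //.
apply/eqP; rewrite eq_le gt_ge andbT leNgt; apply/negP => rg.
have [|e e0 eP] := ctt (g t - r); first by rewrite subr_gt0.
pose u := Num.max c (t - e / 2).
have ut : u < t by rewrite gt_max ct' /=; lra.
have ute : t - e / 2 <= u by rewrite le_max lexx orbT.
have := eP u; rewrite ltr0_norm ?subr_lt0 //.
have -> : - (u - t) < e by lra.
move=> /(_ isT); rewrite ltr_norml => /andP[h _].
have := lt_t u; rewrite le_max lexx ut => /(_ isT isT); lra.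
Qed.

Lemma last_hit g c d r : c <= d ->
  (forall x, c <= x <= d -> {for x, continuous g}) -> g c <= r -> r < g d ->
  exists t, [/\ c <= t, t < d, g t = r & forall u, t < u -> u <= d -> r < g u].
Proof.
move=> cd cg gc gd.
have [||||t [t1 t2 t3 t4]] := @first_hit (fun x => - g (c + d - x)) c d (- r).
- by [].
- move=> x /andP[x1 x2]; apply/contP => e e0.
  have /contP/(_ e e0)[k k0 kP] : {for (c + d - x), continuous g}.
    by apply: cg; apply/andP; split; lra.
  exists k => // y yx; rewrite -opprD normrN; apply: kP.
  by rewrite (_ : c + d - y - _ = - (y - x)) ?normrN //; ring.
- by rewrite addrAC subrr add0r ltrN2.
- by rewrite addrK lerN2.
exists (c + d - t); split; [lra|lra|by apply: oppr_inj|].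
move=> u u1 u2; have := t4 (c + d - u); rewrite (_ : c + d - (c + d - u) = u); last by ring.
by rewrite ltrN2; apply; lra.
Qed.

Lemma separated_finite (A : set R) c d e : 0 < e ->
  (forall x, A x -> c <= x <= d) -> (forall x y, A x -> A y -> x < y -> x + e <= y) ->
  finite_set A.
Proof.
move=> e0 Acd sep.
pose h x := Num.truncn ((x - c) / e).
have hP x : A x -> (h x)%:R <= (x - c) / e < (h x).+1%:R.
  by move=> /Acd/andP[cx _]; apply: truncn_itv; rewrite divr_ge0 ?subr_ge0 // ltW.
have key x y : A x -> A y -> h x = h y -> ~ x < y.
  move=> Ax Ay hxy xy; have := sep x y Ax Ay xy.
  have /andP[_] := hP y Ay; have /andP[+ _] := hP x Ax.
  rewrite hxy ler_pdivlMr // ltr_pdivrMr // -natr1 mulrDl mul1r; lra.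
pose k n := xget 0 [set x | A x /\ h x = n].
apply: (@sub_finite_set _ _ (k @` `I_(Num.truncn ((d - c) / e)).+1)).
  move=> x Ax; exists (h x).
    rewrite /= ltnS /h; apply: le_truncn.
    by rewrite ler_pM2r ?invr_gt0 //; have /andP[_] := Acd x Ax; lra.
  have [Ak hk] : [set y | A y /\ h y = h x] (k (h x)) by apply: (xgetPex 0); exists x.
  by have [/(key _ _ Ak Ax hk)//|/(key _ _ Ax Ak (esym hk))//|//] := ltgtP (k (h x)) x.
exact/finite_image/finite_II.
Qed.

(** A germ at 0 with value 0 and derivative [s]. Sums and composites of such germs add and multiply
    the slopes. *)
Definition slope0 g s := forall e, 0 < e ->
  exists2 d, 0 < d & forall x, `|x| < d -> `|g x - s * x| <= e * `|x|.

Lemma slope0D f g s r : slope0 f s -> slope0 g r -> slope0 (fun x => f x + g x) (s + r).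
Proof.
move=> hf hg e e0; have e2 : 0 < e / 2 by rewrite divr_gt0.
have [d1 d10 h1] := hf _ e2; have [d2 d20 h2] := hg _ e2.
exists (Num.min d1 d2); first by rewrite lt_min d10.
move=> x; rewrite lt_min => /andP[x1 x2].
have -> : f x + g x - (s + r) * x = (f x - s * x) + (g x - r * x) by ring.
by apply: le_trans (ler_normD _ _) _; have := h1 _ x1; have := h2 _ x2; lra.
Qed.

Lemma slope0N f s : slope0 f s -> slope0 (fun x => - f x) (- s).
Proof.
move=> hf e e0; have [d d0 h] := hf _ e0; exists d => // x xd.
by rewrite mulNr -opprD normrN; exact: h.
Qed.

Lemma slope0_comp f g s r : slope0 f s -> slope0 g r -> slope0 (fun x => f (g x)) (s * r).
Proof.
move=> hf hg e e0.
pose k := `|s| + `|r| + 1; have k0 : 0 < k by rewrite /k; have := normr_ge0 s; have := normr_ge0 r; lra.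
pose e' := Num.min 1 (e / k); have e'0 : 0 < e' by rewrite lt_min ltr01 divr_gt0.
have e'1 : e' <= 1 by rewrite ge_min lexx.
have e'k : e' * k <= e by rewrite -ler_pdivlMr // ge_min lexx orbT.
have [d1 d10 h1] := hf _ e'0; have [d2 d20 h2] := hg _ e'0.
pose m := `|r| + 1; have m0 : 0 < m by rewrite /m; have := normr_ge0 r; lra.
exists (Num.min d2 (d1 / m)); first by rewrite lt_min d20 divr_gt0.
move=> x; rewrite lt_min ltr_pdivlMr // => /andP[x2 x1].
have gx := h2 _ x2.
have x0 := normr_ge0 x.
have gm : `|g x| <= `|r| * `|x| + e' * `|x|.
  have -> : g x = r * x + (g x - r * x) by ring.
  by apply: le_trans (ler_normD _ _) _; rewrite normrM lerD2l.
have ex : e' * `|x| <= `|x| by rewrite ler_piMl.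
have gd : `|g x| < d1 by move: x1; rewrite /m; lra.
have fg := h1 _ gd.
have -> : f (g x) - s * r * x = (f (g x) - s * g x) + s * (g x - r * x) by ring.
apply: le_trans (ler_normD _ _) _; rewrite normrM.
have a1 : `|s| * `|g x - r * x| <= `|s| * (e' * `|x|) by rewrite ler_wpM2l.
have a2 : e' * `|g x| <= e' * (`|r| * `|x| + `|x|) by rewrite ler_pM2l //; lra.
have a3 : e' * k * `|x| <= e * `|x| by rewrite ler_wpM2r.
move: a3; rewrite /k => a3.
apply: le_trans a3; apply: le_trans (lerD fg a1) _; apply: le_trans (lerD a2 (lexx _)) _.
lra.
Qed.

Lemma derivable_slope0 f x : derivable f x 1 -> slope0 (fun h => f (x + h) - f x) (derive1 f x).
Proof.
move=> df e e0; rewrite derive1E.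
have /cvgrPdist_le/(_ e e0) := df; rewrite -/(derive f x 1).
move=> /nbhs_ballP[d d0 dP]; exists d => // h hd.
have [->|h0] := eqVneq h 0; first by rewrite addr0 subrr mulr0 subrr !normr0 mulr0.
have := dP h; rewrite /ball /= sub0r normrN => /(_ hd h0).
rewrite /GRing.scale /= mulr1 (addrC h x) => H.
have -> : f (x + h) - f x - 'D_1 f x * h = - (('D_1 f x - h^-1 * (f (x + h) - f x)) * h).
  by rewrite mulrBl mulrAC mulVf // mul1r opprB.
by rewrite normrN normrM ler_wpM2r.
Qed.

End RealLemmas.

(** Germs provide only the ring operations on slopes, so relations between quotients have to be
    cleared of denominators. *)
Lemma sum_ratio_eq0 (F : realFieldType) (q2 q1 q0 p2 p1 p0 B : F) :
  q2 != 0 -> q1 != 0 -> q0 != 0 -> B != 0 ->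
  (B * (p2 / q2) + B * (p1 / q1) = B * (p0 / q0) <->
   p2 * (q1 * q0) + p1 * (q2 * q0) + - (p0 * (q2 * q1)) = 0).
Proof.
move=> n2 n1 n0 nB.
have -> : B * (p2 / q2) + B * (p1 / q1) =
    B * (p0 / q0) + B * (p2 * (q1 * q0) + p1 * (q2 * q0) + - (p0 * (q2 * q1))) / (q2 * q1 * q0).
  by field; rewrite n0 n1 n2.
split=> [/eqP|->]; last by rewrite mulr0 mul0r addr0.
rewrite -subr_eq0 addrAC subrr add0r !mulf_eq0 !invr_eq0 !mulf_eq0.
by rewrite (negbTE nB) (negbTE n2) (negbTE n1) (negbTE n0) !orbF => /eqP.
Qed.

Lemma prod_ratio_eq0 (F : realFieldType) (q2 q1 q0 p2 p1 p0 B : F) :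
  q2 != 0 -> q1 != 0 -> q0 != 0 -> B != 0 ->
  (B * (p2 / q2) * (B * (p1 / q1)) = B * (p0 / q0) <->
   B * (p2 * (p1 * q0)) + - (p0 * (q2 * q1)) = 0).
Proof.
move=> n2 n1 n0 nB.
have -> : B * (p2 / q2) * (B * (p1 / q1)) =
    B * (p0 / q0) + B * (B * (p2 * (p1 * q0)) + - (p0 * (q2 * q1))) / (q2 * q1 * q0).
  by field; rewrite n0 n1 n2.
split=> [/eqP|->]; last by rewrite mulr0 mul0r addr0.
rewrite -subr_eq0 addrAC subrr add0r !mulf_eq0 !invr_eq0 !mulf_eq0.
by rewrite (negbTE nB) (negbTE n2) (negbTE n1) (negbTE n0) !orbF => /eqP.
Qed.

(** * Definable relations between slopes, and the chart on the record points *)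

Section Slopes.
Variables (R : realType) (L : language) (M : fo_structure L R).
Hypothesis Mexp : expands_ordered_add_group M.
Variables (a b c d : R) (f sg : R -> R).
Hypothesis fdef : Def2 M (fun x y => (a < x /\ x < b) /\ y = f x).
Hypothesis fsg : forall x, a < x < b -> slope0 (fun h => f (x + h) - f x) (sg x).
Hypothesis sg_cont : forall x, a < x < b -> {for x, continuous sg}.
Hypotheses (ac : a < c) (cd : c < d) (db : d < b) (sgcd : sg c < sg d).

Let inI x := a < x /\ x < b.

(** Off the interval this is the zero germ and [sl] is 0, so that [germ_slope] holds for every
    [t]. *)
Let germ t x := if `[< inI t /\ inI (t + x) >] then f (t + x) - f t else 0.

Let sl t := if `[< inI t >] then sg t else 0.

Let slE t : a < t -> t < b -> sl t = sg t.
Proof. by move=> at' tb; rewrite /sl asboolT. Qed.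

Let germ_slope t : slope0 (germ t) (sl t).
Proof.
move=> e e0; rewrite /sl; have [[at' tb]|nt] := pselect (inI t); last first.
  rewrite (asboolF nt); exists 1 => // x _; rewrite /germ asboolF; last by case.
  by rewrite mul0r subrr normr0 mulr_ge0 // ltW.
have tI : a < t < b by rewrite at'.
have [k k0 kP] := fsg tI e0; rewrite asboolT //.
exists (Num.min k (Num.min (t - a) (b - t))).
  by rewrite !lt_min k0 !subr_gt0 at'.
move=> x; rewrite !lt_min => /andP[xk /andP[]]; rewrite !ltr_norml => /andP[x1 x2] /andP[x3 x4].
rewrite /germ asboolT; first exact: kP.
by split=> //; split; lra.
Qed.

Let inI_def u : DefT M u -> Def M (fun v => inI (u v)).
Proof. by move=> hu; apply: Def_and; apply: Def_lt => //; exact: DefT_cst. Qed.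

Let germ_def : Def3 M (fun t x y => y = germ t x).
Proof.
apply: (@Def_ext _ _ _ (fun v => (inI (v 0%N) /\ inI (v 0%N + v 1%N) /\
   exists y, exists z, (inI (v 0%N + v 1%N) /\ y = f (v 0%N + v 1%N)) /\
     (inI (v 0%N) /\ z = f (v 0%N)) /\ v 2%N = y - z) \/
   (~ (inI (v 0%N) /\ inI (v 0%N + v 1%N)) /\ v 2%N = 0))).
  move=> v; rewrite /germ; case: asboolP => h; split.
  - by move=> [[_ [_ [y [z [[_ ->] [[_ ->]]]]]]]|[]].
  - by move=> e; left; case: h => h1 h2; do 2!split=> //; exists (f (v 0%N + v 1%N)), (f (v 0%N)).
  - by move=> [[? [? _]]|[_]] //; case: h.
  - by right.
have hD : DefT M (fun v => v 0%N + v 1%N) by apply: DefT_add => //; exact: DefT_var.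
apply: Def_or; last first.
  apply: Def_and; last by apply: Def_eq; [exact: DefT_var|exact: DefT_cst].
  by apply: Def_not; apply: Def_and; apply: inI_def => //; exact: DefT_var.
apply: Def_and; first by apply: inI_def; exact: DefT_var.
apply: Def_and; first exact: inI_def.
apply: Def_ex; apply: Def_ex; apply: Def_and.
  apply: (Def2_app (a := fun v => v 2%N + v 3%N) (b := fun v => v 1%N) fdef).
    by apply: DefT_add => //; exact: DefT_var.
  exact: DefT_var.
apply: Def_and.
  by apply: (Def2_app (a := fun v => v 2%N) (b := fun v => v 0%N) fdef); exact: DefT_var.
apply: Def_eq; first exact: DefT_var.
by apply: DefT_add => //; [|apply: DefT_opp => //]; exact: DefT_var.
Qed.

(** [SL s] represents the number [s v] by a germ definable uniformly in [v]. All access to slopes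
    goes through it: ring operations on germs, and the sign test [SL_ge0]. *)
Let GD (G : (nat -> R) -> R -> R) := DefT M (fun v => G (fun i => v i.+1) (v 0%N)).
Let SL (s : (nat -> R) -> R) := exists2 G, GD G & forall v, slope0 (G v) (s v).

Let SL_add s r : SL s -> SL r -> SL (fun v => s v + r v).
Proof.
move=> [G hG Gs] [H hH Hr]; exists (fun v x => G v x + H v x).
  exact: (DefT_add Mexp hG hH).
by move=> v; exact: slope0D.
Qed.

Let SL_opp s : SL s -> SL (fun v => - s v).
Proof.
move=> [G hG Gs]; exists (fun v x => - G v x); first exact: (DefT_opp Mexp hG).
by move=> v; exact: slope0N.
Qed.

Let SL_mul s r : SL s -> SL r -> SL (fun v => s v * r v).
Proof.
move=> [G hG Gs] [H hH Hr]; exists (fun v x => G v (H v x)); last by move=> v; exact: slope0_comp.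
apply: (@Def_ext _ _ _ (fun v => exists y, y = H (fun i => v i.+2) (v 1%N) /\
   v 0%N = G (fun i => v i.+2) y)); first by move=> v; split=> [[y [-> ->]]|->]; last by eexists.
apply: Def_ex; apply: Def_and.
  exact: (@Def_ren _ _ _ _ (fun i => if i is j.+1 then j.+2 else 0%N) hH).
exact: (@Def_ren _ _ _ _ (fun i => match i with 0%N => 1%N | 1%N => 0%N | j.+2 => j.+3 end) hG).
Qed.

Let SL_sl u : DefT M u -> SL (fun v => sl (u v)).
Proof.
move=> hu; exists (fun v => germ (u v)); last by move=> v; exact: germ_slope.
apply: (@Def3_app _ _ _ _ (fun v => u (fun i => v i.+2)) (fun v => v 1%N) _ germ_def).
- exact: (DefT_ren (fun i => i.+2) hu).
- exact: DefT_var.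
- exact: DefT_var.
Qed.

Let cdI x : c <= x <= d -> a < x < b.
Proof. by move=> /andP[h1 h2]; rewrite (lt_le_trans ac h1) (le_lt_trans h2 db). Qed.

Let cont_cd x : c <= x <= d -> {for x, continuous sg}.
Proof. by move=> /cdI; exact: sg_cont. Qed.

(** Cutting at the last visit to [sg c] and then at the first visit to [sg d] keeps [sg] strictly
    between these values inside [(t0, t1)], with the extremes taken at the ends. *)
Let last_c : {t | [/\ c <= t, t < d, sg t = sg c & forall u, t < u -> u <= d -> sg c < sg u]}.
Proof. by apply/cid; apply: last_hit => //; exact: ltW. Qed.

Let t0 := sval last_c.

Let first_d : {t | [/\ t0 < t, t <= d, sg t = sg d & forall u, t0 <= u -> u < t -> sg u < sg d]}.
Proof.
apply/cid; rewrite /t0; case: last_c => t /= [t1 t2 t3 t4].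
apply: first_hit => //; [exact: ltW| |by rewrite t3].
by move=> x /andP[x1 x2]; apply: cont_cd; rewrite (le_trans t1).
Qed.

Let t1 := sval first_d.

Let ct0 : c <= t0. Proof. by rewrite /t0; case: last_c => t []. Qed.
Let t0E : sg t0 = sg c. Proof. by rewrite /t0; case: last_c => t []. Qed.
Let t01 : t0 < t1. Proof. by rewrite /t1; case: first_d => t []. Qed.
Let t1d : t1 <= d. Proof. by rewrite /t1; case: first_d => t []. Qed.
Let t1E : sg t1 = sg d. Proof. by rewrite /t1; case: first_d => t []. Qed.

Let sg_in t : t0 < t < t1 -> sg c < sg t < sg d.
Proof.
move=> /andP[h0 h1]; apply/andP; split.
  have [_ _ _] := svalP last_c; apply => //; exact: ltW (lt_le_trans h1 t1d).
by have [_ _ _] := svalP first_d; apply => //; exact: ltW.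
Qed.

Let tI t : t0 <= t <= t1 -> a < t < b.
Proof. by move=> /andP[h0 h1]; apply: cdI; rewrite (le_trans ct0 h0) (le_trans h1 t1d). Qed.

(* The germs at the points [w] to the right of [t0] provide arbitrarily small
   positive slopes, against which the sign of a slope is tested. *)
Let SL_ge0 s : SL s -> Def M (fun v => 0 <= s v).
Proof.
move=> [G hG Gs].
apply: (@Def_ext _ _ _ (fun v => forall w, t0 < w /\ w < t1 -> exists e, 0 < e /\
   forall x, 0 < x /\ x < e -> 0 <= G v x + (germ w x - germ t0 x))).
  move=> v; split=> [h|s0 w [w0 w1]]; last first.
    have wI : a < w < b by apply: tI; rewrite !ltW.
    have t0I : a < t0 < b by apply: tI; rewrite lexx ltW.
    have := slope0D (Gs v) (slope0D (germ_slope w) (slope0N (germ_slope t0))).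
    case/andP: wI => ? ?; case/andP: t0I => ? ?; rewrite !slE // t0E => hs.
    have /andP[sw _] : sg c < sg w < sg d by apply: sg_in; rewrite w0.
    have s1 : 0 < s v + (sg w - sg c) by lra.
    have [e e0 eP] := hs _ s1; exists e; split=> // x [x0 xe].
    have := eP x; rewrite (gtr0_norm x0) => /(_ xe).
    rewrite ler_norml => /andP[+ _]; lra.
  rewrite leNgt; apply/negP => s0.
  have t0I : a < t0 < b by apply: tI; rewrite lexx ltW.
  have /contP hc : {for t0, continuous sg} by exact: sg_cont.
  have [|e e0 eP] := hc (- s v / 2); first by rewrite divr_gt0 // oppr_gt0.
  have h01 := t01.
  pose w := Num.min (t0 + e / 2) ((t0 + t1) / 2).
  have w0 : t0 < w by rewrite lt_min; apply/andP; split; lra.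
  have w1 : w < t1 by rewrite gt_min; apply/orP; right; lra.
  have we : w <= t0 + e / 2 by rewrite ge_min lexx.
  have wI : a < w < b by apply: tI; rewrite !ltW.
  have := eP w; rewrite gtr0_norm ?subr_gt0 //.
  have -> : w - t0 < e by lra.
  move=> /(_ isT); rewrite ltr_norml t0E => /andP[_ sw].
  have [e' [e'0 e'P]] := h w (conj w0 w1).
  have := slope0D (Gs v) (slope0D (germ_slope w) (slope0N (germ_slope t0))).
  case/andP: wI => ? ?; case/andP: t0I => ? ?; rewrite !slE // t0E => hs.
  have s1 : 0 < - (s v + (sg w - sg c)) / 2 by lra.
  have [k k0 kP] := hs _ s1.
  pose x := Num.min (k / 2) (e' / 2).
  have x0 : 0 < x by rewrite lt_min !divr_gt0.
  have xk : x < k by rewrite gt_min; apply/orP; left; lra.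
  have xe : x < e' by rewrite gt_min; apply/orP; right; lra.
  have := e'P x (conj x0 xe); have := kP x; rewrite (gtr0_norm x0) => /(_ xk).
  rewrite ler_norml => /andP[_ +]; move: (G v x) (germ w x) (germ t0 x) => g1 g2 g3.
  have := mulr_gt0 s1 x0; lra.
apply: Def_all; apply: Def_imp.
  by apply: Def_and; apply: Def_lt => //; (exact: DefT_cst || exact: DefT_var).
apply: Def_ex; apply: Def_and.
  by apply: Def_lt => //; (exact: DefT_cst || exact: DefT_var).
apply: Def_all; apply: Def_imp.
  by apply: Def_and; apply: Def_lt => //; (exact: DefT_cst || exact: DefT_var).
apply: Def_le => //; first exact: DefT_cst.
apply: (DefT_add (a := fun v => G (fun i => v i.+3) (v 0%N)) Mexp).
  exact: (DefT_ren (fun i => if i is j.+1 then j.+3 else 0%N) hG).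
have hg u : DefT M u -> DefT M (fun v => germ (u v) (v 0%N)).
  move=> hu; apply: (@Def3_app _ _ _ _ (fun v => u (fun i => v i.+1)) (fun v => v 1%N) _ germ_def).
  - exact: (DefT_ren (fun i => i.+1) hu).
  - exact: DefT_var.
  - exact: DefT_var.
apply: DefT_add => //; first by apply: hg; exact: DefT_var.
by apply: DefT_opp => //; apply: hg; exact: DefT_cst.
Qed.

Let SL_eq0 s : SL s -> Def M (fun v => s v = 0).
Proof.
move=> hs; apply: (@Def_ext _ _ _ (fun v => 0 <= s v /\ 0 <= - s v)).
  move=> v; split=> [[h1 h2]|->]; last by rewrite oppr0 lexx.
  by apply/eqP; rewrite eq_le h1 -oppr_ge0 h2.
by apply: Def_and; apply: SL_ge0 => //; exact: SL_opp.
Qed.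

Let rec t := (t0 < t /\ t < t1) /\ forall u, t0 < u /\ u < t -> sg u < sg t.

Let rec_def : Def1 M rec.
Proof.
apply: (@Def_ext _ _ _ (fun v => (t0 < v 0%N /\ v 0%N < t1) /\
   forall u, t0 < u /\ u < v 0%N -> ~ (0 <= sl u - sl (v 0%N)))).
  move=> v; have E u : t0 < v 0%N < t1 -> t0 < u -> u < v 0%N ->
      (~ (0 <= sl u - sl (v 0%N)) <-> sg u < sg (v 0%N)).
    move=> /andP[v0 v1] u0 uv.
    have /andP[? ?] : a < u < b by apply: tI; rewrite !ltW // (lt_trans uv).
    have /andP[? ?] : a < v 0%N < b by apply: tI; rewrite !ltW.
    by rewrite !slE // subr_ge0 (ltNge (sg u)); split=> /negP.
  split=> -[[v0 v1] h]; (split; first by []) => u [u0 uv].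
    by apply/E => //; [rewrite v0|apply: h].
  by apply/E => //; [rewrite v0|apply: h].
apply: Def_and.
  by apply: Def_and; apply: Def_lt => //; (exact: DefT_cst || exact: DefT_var).
apply: Def_all; apply: Def_imp.
  by apply: Def_and; apply: Def_lt => //; (exact: DefT_cst || exact: DefT_var).
apply: Def_not; apply: SL_ge0; apply: SL_add; last apply: SL_opp.
all: by apply: SL_sl; exact: DefT_var.
Qed.

Let B := sg d - sg c.
Let B0 : 0 < B. Proof. by rewrite subr_gt0. Qed.
Let ta t := sl t - sl c.
(** With [x = ta t] in [(0, B)], the value is [B / (B - x) - B / x], an increasing bijection of
    [(0, B)] onto the reals. It is rational in slopes, and the factor [B] makes it depend on [x / B]
    only. *)
Let p t := ta t + ta t - B.
Let q t := ta t * (B - ta t).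
Let v t := if `[< rec t >] then B * (p t / q t) else 0.

Let ta_in t : t0 < t < t1 -> [/\ ta t = sg t - sg c, 0 < ta t & ta t < B].
Proof.
move=> h; have /andP[h1 h2] := sg_in h; case/andP: h => h3 h4.
have /andP[? ?] : a < t < b by apply: tI; rewrite !ltW.
have cb := lt_trans cd db.
by rewrite /ta /B !slE //; split=> //; lra.
Qed.

Let q0 t : t0 < t < t1 -> 0 < q t.
Proof. by move=> /ta_in[_ h1 h2]; rewrite mulr_gt0 // subr_gt0. Qed.

Let rec_in t : rec t -> t0 < t < t1. Proof. by case=> -[-> ->]. Qed.

Let vE t : rec t -> v t = B / (B - ta t) - B / ta t.
Proof.
move=> h; rewrite /v (asboolT h); have [_ h1 h2] := ta_in (rec_in h).
have ? : ta t != 0 by rewrite gt_eqF.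
have ? : B - ta t != 0 by rewrite gt_eqF // subr_gt0.
by rewrite /p /q; field; apply/andP.
Qed.

Let v_lt x y : rec x -> rec y -> x < y -> v x < v y.
Proof.
move=> rx ry xy; rewrite !vE //.
have [e1 h1 h2] := ta_in (rec_in rx); have [e2 h3 h4] := ta_in (rec_in ry).
have lt : ta x < ta y.
  by rewrite e1 e2 ltrD2r; case: ry => _; apply; case/andP: (rec_in rx).
have i1 : B / (B - ta x) < B / (B - ta y).
  by rewrite ltr_pM2l // ltf_pV2 ?posrE ?subr_gt0 //; lra.
have i2 : B / ta y < B / ta x by rewrite ltr_pM2l // ltf_pV2 ?posrE.
lra.
Qed.

(** The first point where [sg] reaches a given value is a record, and by continuity all values
    between [sg c] and [sg d] are reached. *)
Let v_surj r : exists2 x, rec x & v x = r.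
Proof.
pose s := Num.sqrt (r ^+ 2 + 4).
have s2 : s ^+ 2 = r ^+ 2 + 4 by rewrite sqr_sqrtr // addr_ge0 ?sqr_ge0.
have s0 : 0 <= s by exact: sqrtr_ge0.
have [sr sr'] : r < s /\ - r < s by split; nra.
(* [y = 2 / D] is the root in [(0, 1)] of [r * y ^ 2 + (2 - r) * y - 1 = 0], that is of
   [(2 * y - 1) / (y * (1 - y)) = r], written so that [r = 0] is no exception. *)
pose D := s + 2 - r; have D2 : 2 < D by rewrite /D; lra.
pose y := 2 / D.
have y0 : 0 < y by rewrite divr_gt0 //; lra.
have y1 : y < 1 by rewrite ltr_pdivrMr; lra.
have [||||t [h1 h2 h3 h4]] := @first_hit _ sg t0 t1 (sg c + B * y).
- exact: ltW.
- by move=> x /tI; exact: sg_cont.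
- by rewrite t0E ltrDl mulr_gt0.
- by rewrite t1E; have : B * y < B * 1 by [rewrite ltr_pM2l|]; rewrite /B; lra.
have tt1 : t < t1.
  rewrite lt_neqAle h2 andbT; apply/eqP => e; move: h3; rewrite e t1E.
  by have : B * y < B * 1 by [rewrite ltr_pM2l|]; rewrite /B; lra.
have rt : rec t by split=> // u [u0 ut]; rewrite h3; apply: h4 => //; exact: ltW.
exists t => //; rewrite vE //; have [-> _ _] := ta_in (rec_in rt).
have -> : sg t - sg c = B * y by rewrite h3; ring.
have D0 : D != 0 by rewrite gt_eqF //; lra.
have Bn0 : B != 0 by rewrite gt_eqF.
have s0' : s - r != 0 by rewrite gt_eqF // subr_gt0.
have DE : D - 2 = s - r by rewrite /D; ring.
have -> : B / (B - B * y) - B / (B * y) = D / (D - 2) - D / 2.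
  by rewrite /y; field; rewrite -mulrBr mulf_neq0 ?DE ?s0' ?D0 ?Bn0.
rewrite DE; apply: (mulIf s0'); rewrite mulrBl divfK // /D.
have -> : s + 2 - r - (s + 2 - r) / 2 * (s - r) = r * (s - r) + (4 + r ^+ 2 - s ^+ 2) / 2 by field.
by rewrite s2; field.
Qed.

Let v_inj x y : rec x -> rec y -> v x = v y -> x = y.
Proof.
move=> rx ry e; have [xy|yx|//] := ltgtP x y.
  by have := v_lt rx ry xy; rewrite e ltxx.
by have := v_lt ry rx yx; rewrite e ltxx.
Qed.

Let ta_SL k : SL (fun v => ta (v k)).
Proof.
apply: SL_add; first by apply: SL_sl; exact: DefT_var.
by apply: SL_opp; apply: SL_sl; exact: DefT_cst.
Qed.

Let B_SL : SL (fun=> B).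
Proof.
have [G hG Gs] : SL (fun=> sl d - sl c).
  apply: SL_add; first by apply: SL_sl; exact: DefT_cst.
  by apply: SL_opp; apply: SL_sl; exact: DefT_cst.
by exists G => // w; have := Gs w; rewrite !slE ?(lt_trans cd db) ?(lt_trans ac cd).
Qed.

Let p_SL k : SL (fun v => p (v k)).
Proof. exact: (SL_add (SL_add (ta_SL k) (ta_SL k)) (SL_opp B_SL)). Qed.

Let q_SL k : SL (fun v => q (v k)).
Proof. exact: (SL_mul (ta_SL k) (SL_add B_SL (SL_opp (ta_SL k)))). Qed.

Let rec3_def s (Q : R -> R -> R -> Prop) : SL s ->
  (forall w, rec (w 0%N) -> rec (w 1%N) -> rec (w 2%N) ->
     (Q (w 0%N) (w 1%N) (w 2%N) <-> s w = 0)) ->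
  Def3 M (fun x y z => [/\ rec x, rec y, rec z & Q x y z]).
Proof.
move=> hs h; apply: (@Def_ext _ _ _ (fun w => rec (w 0%N) /\ rec (w 1%N) /\ rec (w 2%N) /\ s w = 0)).
  by move=> w; split=> [[h0 [h1 [h2 h3]]]|[h0 h1 h2 h3]]; [split=> //; apply/h|do 3!split=> //; apply/h].
do 3! (apply: Def_and; first by apply: (Def1_app rec_def); exact: DefT_var).
exact: SL_eq0.
Qed.

Lemma slope_chart : exists (x0 x1 : R) (C : chart M),
  [/\ c <= x0, x0 < x1, x1 <= d,
      forall t, cdom C t <-> (x0 < t /\ t < x1) /\ forall u, x0 < u /\ u < t -> sg u < sg t &
      forall x y, cdom C x -> cdom C y -> x < y -> cval C x < cval C y].
Proof.
have qn0 t : rec t -> q t != 0 by move=> /rec_in/q0; rewrite lt0r => /andP[].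
have vq t : rec t -> v t = B * (p t / q t) by move=> h; rewrite /v asboolT.
have Bn0 : B != 0 by rewrite gt_eqF.
have add_def : Def3 M (fun x y z => [/\ rec x, rec y, rec z & v x + v y = v z]).
  apply: (@rec3_def (fun w => p (w 0%N) * (q (w 1%N) * q (w 2%N)) + p (w 1%N) * (q (w 0%N) * q (w 2%N))
     + - (p (w 2%N) * (q (w 0%N) * q (w 1%N))))).
    exact: (SL_add (SL_add (SL_mul (p_SL 0) (SL_mul (q_SL 1) (q_SL 2)))
      (SL_mul (p_SL 1) (SL_mul (q_SL 0) (q_SL 2))))
      (SL_opp (SL_mul (p_SL 2) (SL_mul (q_SL 0) (q_SL 1))))).
  move=> w /[dup] /qn0 n0 /vq -> /[dup] /qn0 n1 /vq -> /[dup] /qn0 n2 /vq ->.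
  exact: sum_ratio_eq0.
have mul_def : Def3 M (fun x y z => [/\ rec x, rec y, rec z & v x * v y = v z]).
  apply: (@rec3_def (fun w => B * (p (w 0%N) * (p (w 1%N) * q (w 2%N)))
     + - (p (w 2%N) * (q (w 0%N) * q (w 1%N))))).
    exact: (SL_add (SL_mul B_SL (SL_mul (p_SL 0) (SL_mul (p_SL 1) (q_SL 2))))
      (SL_opp (SL_mul (p_SL 2) (SL_mul (q_SL 0) (q_SL 1))))).
  move=> w /[dup] /qn0 n0 /vq -> /[dup] /qn0 n1 /vq -> /[dup] /qn0 n2 /vq ->.
  exact: prod_ratio_eq0.
exists t0, t1, (@Chart _ _ _ rec v rec_def (fun x h => (ltac:(by rewrite /v asboolF)))
  v_inj v_surj add_def mul_def).
by split.
Qed.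

End Slopes.

(** * From a non-affine function to a field on an interval *)

Section NonaffineToField.
Variables (R : realType) (L : language) (M : fo_structure L R).
Hypothesis Mexp : expands_ordered_add_group M.
Hypothesis MPN : ~ defines_PN_copy M.

Lemma definable_fun_Def a b (f : R -> R) : definable_fun M `]a, b[ f ->
  Def2 M (fun x y => (a < x /\ x < b) /\ y = f x).
Proof.
move=> /definable_to_Def; apply: Def_ext => v; split.
  move=> [x]; rewrite /= in_itv /= => /andP[ax xb] e.
  have e0 : x = v 0%N by have := congr1 (fun t => tnth t ord0) e; rewrite tnth_mktuple.
  have e1 : f x = v 1%N by have := congr1 (fun t => tnth t ord_max) e; rewrite tnth_mktuple.
  by rewrite -e0 -e1.
move=> [[av vb] e]; exists (v 0%N); first by rewrite /= in_itv /= av.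
by apply: eq_from_tnth => i; rewrite tnth_mktuple -e; case: i => -[|[|//]] ?.
Qed.

Lemma chart_op_def (C : chart M) a b (op : R -> R -> R) (o : R -> R -> R) :
  (forall t, cdom C t <-> a < t < b) ->
  Def3 M (fun x y z => [/\ cdom C x, cdom C y, cdom C z & o (cval C x) (cval C y) = cval C z]) ->
  (forall x y, cdom C x -> cdom C y -> cdom C (op x y) /\ cval C (op x y) = o (cval C x) (cval C y)) ->
  definable_op M `]a, b[ op.
Proof.
move=> domE odef opP; apply: (@Def_to_definable _ _ M 3 0 _ _ odef) => z; split.
  move=> [x xI [y yI <-]].
  move: xI yI; rewrite /= !in_itv /= -!domE => Sx Sy.
  by have [So vo] := opP x y Sx Sy; rewrite vo.
move=> [S0 S1 S2 e]; exists (nth 0 z 0); first by rewrite /= in_itv /= -domE.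
exists (nth 0 z 1); first by rewrite /= in_itv /= -domE.
have [So vo] := opP _ _ S0 S1.
have e2 : op (nth 0 z 0) (nth 0 z 1) = nth 0 z 2.
  by apply: (cval_inj So S2); rewrite vo.
apply: eq_from_tnth => i; rewrite !(tnth_nth 0).
by case: i => -[|[|[|//]]] ? //=.
Qed.

Lemma chart_field_type (C : chart M) a b : a < b ->
  (forall t, cdom C t <-> a < t < b) ->
  (forall x y, cdom C x -> cdom C y -> x < y -> cval C x < cval C y) -> field_type M.
Proof.
move=> ab domE vlt.
pose vi r := s2val (cid2 (cval_surj C r)).
have viD r : cdom C (vi r) by exact: (s2valP (cid2 (cval_surj C r))).
have viK r : cval C (vi r) = r by exact: (s2valP' (cid2 (cval_surj C r))).
exists a, b, (fun x y => vi (cval C x + cval C y)), (fun x y => vi (cval C x * cval C y)).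
split; first split=> //.
- by move=> x y _ _; rewrite in_itv /= -domE.
- by move=> x y _ _; rewrite in_itv /= -domE.
- by apply: (chart_op_def domE (cadd_def C)) => x y _ _; rewrite viK.
- by apply: (chart_op_def domE (cmul_def C)) => x y _ _; rewrite viK.
exists (cval C); split.
- split=> // [x y|r _].
    by rewrite !inE /= !in_itv /= -!domE; exact: cval_inj.
  by have [x Sx <-] := cval_surj C r; exists x => //=; rewrite in_itv /= -domE.
- move=> x y; rewrite !in_itv /= -!domE => Sx Sy.
  have [xy|yx|->] := ltgtP x y; last by rewrite ltxx.
    by rewrite vlt.
  by apply/esym/negbTE; rewrite -leNgt; apply/ltW/vlt.
- by move=> x y _ _; rewrite viK.
- by move=> x y _ _; rewrite viK.
Qed.

Lemma slope_increase_field a b c d (f sg : R -> R) :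
  Def2 M (fun x y => (a < x /\ x < b) /\ y = f x) ->
  (forall x, a < x < b -> slope0 (fun h => f (x + h) - f x) (sg x)) ->
  (forall x, a < x < b -> {for x, continuous sg}) ->
  a < c -> c < d -> d < b -> sg c < sg d -> field_type M.
Proof.
move=> fdef fsg sgc ac cd db scd.
have [[j1 [j2 [aj1 j12 j2b sinc]]]|nA] := pselect (exists j1 j2, [/\ a <= j1, j1 < j2, j2 <= b &
    forall x y, j1 < x -> x < y -> y < j2 -> sg x < sg y]).
  (* After restriction to [(j1, j2)] every point is a record, so the chart is a full interval. *)
  pose c' := (2 * j1 + j2) / 3; pose d' := (j1 + 2 * j2) / 3.
  have [h1 h2 h3] : [/\ j1 < c', c' < d' & d' < j2] by rewrite /c' /d'; split; lra.
  have sub x : j1 < x < j2 -> a < x < b.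
    by move=> /andP[x1 x2]; rewrite (le_lt_trans aj1) //= (lt_le_trans x2).
  have fdef' : Def2 M (fun x y => (j1 < x /\ x < j2) /\ y = f x).
    apply: (@Def_ext _ _ _ (fun v => (j1 < v 0%N /\ v 0%N < j2) /\
      (a < v 0%N /\ v 0%N < b) /\ v 1%N = f (v 0%N))).
      move=> v; split=> [[h [_ e]]//|[[v1 v2] e]]; split=> //; split=> //.
      have h : j1 < v 0%N < j2 by rewrite v1.
      by case/andP: (sub _ h).
    apply: Def_and fdef.
    by apply: Def_and; apply: Def_lt => //; (exact: DefT_cst || exact: DefT_var).
  have [x0 [x1 [C [cx0 x01 x1d domE vlt]]]] := @slope_chart _ _ _ Mexp j1 j2 c' d' f sg fdef'
    (fun x h => fsg x (sub x h)) (fun x h => sgc x (sub x h)) h1 h2 h3 (sinc _ _ h1 h2 h3).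
  apply: (chart_field_type x01 _ vlt) => t; rewrite domE; split=> [[[-> ->]]//|/andP[t0 t1]].
  split=> // u [u0 ut]; apply: sinc => //; first exact: lt_trans (lt_le_trans h1 cx0) u0.
  exact: lt_trans (le_lt_trans x1d h3).
have [x0 [x1 [C [cx0 x01 x1d domE vlt]]]] := slope_chart Mexp fdef fsg sgc ac cd db scd.
exfalso; apply: MPN.
pose S := cdom C; pose val := cval C.
have vle x y : S x -> S y -> x <= y -> val x <= val y.
  by move=> Sx Sy; rewrite le_eqVlt => /orP[/eqP ->//|/(vlt _ _ Sx Sy)/ltW].
(* The level of a record is the length of the gap of [S] that follows it; points followed by gaps of
   length [e] are [e]-separated, hence finitely many. *)
pose Lev e u := S u /\ forall s, S s -> u < s -> u + e <= s.
have x0I x : x0 < x < x1 -> a < x < b by move=> /andP[? ?]; apply/andP; split; lra.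
apply: (@PN_copy _ _ _ Mexp C Lev 0 1) => //.
- apply: Def_and; first by apply: Def_dom; exact: DefT_var.
  apply: Def_all; apply: Def_imp; first by apply: Def_dom; exact: DefT_var.
  apply: Def_imp; first by apply: Def_lt => //; exact: DefT_var.
  by apply: Def_le => //; [apply: DefT_add => //|]; exact: DefT_var.
- move=> e e0; apply: (separated_finite (c := x0) (d := x1) e0).
    by move=> x [/domE[[h1 h2] _] _ _]; rewrite !ltW.
  by move=> x y [_ _ [_ h]] [Sy _ _]; exact: h.
- move=> e e' u e'0 ee' [Su h]; split=> // s Ss us.
  by apply: le_trans (h s Ss us); rewrite lerD2l.
move=> r1 r2 _ r12 _.
pose p1 := (2 * r1 + r2) / 3; pose p2 := (r1 + 2 * r2) / 3.
have [h1 h2 h3] : [/\ r1 < p1, p1 < p2 & p2 < r2] by rewrite /p1 /p2; split; lra.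
have [x Sx vx] := cval_surj C p1; have [y Sy vy] := cval_surj C p2.
have xy : x < y.
  rewrite ltNge; apply/negP => yx; have := vle _ _ Sy Sx yx.
  by rewrite /val vx vy leNgt h2.
have [[x0x xx1] xrec] := (domE x).1 Sx; have [[x0y yx1] yrec] := (domE y).1 Sy.
(* If all points between [x] and [y] were records, [sg] would be strictly increasing there. *)
have [m [xm my nSm]] : exists m, [/\ x < m, m < y & ~ S m].
  apply: contrapT => nm; apply: nA; exists x, y; split=> //; [lra|lra|].
  move=> u w xu uw wy; have Sw : S w.
    by apply: contrapT => nSw; apply: nm; exists w; split=> //; exact: lt_trans uw.
  by have [_] := (domE w).1 Sw; apply; split=> //; exact: lt_trans xu.
have cont_xm t : x <= t <= m -> {for t, continuous sg}.
  by move=> /andP[t1 t2]; apply/sgc/x0I; apply/andP; split; lra.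
have cw : {within `[x, m], continuous sg}.
  apply: continuous_in_subspaceT => t; rewrite inE /= in_itv /=; exact: cont_xm.
have [w wI wmax] := EVT_max (ltW xm) cw.
move: wI; rewrite in_itv /= => /andP[xw wm].
have maxP t : x <= t -> t <= m -> sg t <= sg w.
  by move=> t1 t2; apply: wmax; rewrite in_itv /= t1.
(* The leftmost maximum [u] of [sg] on [[x, m]] is a record, and no point of [(u, m]] can be one: a
   gap of length at least [m - u] starts at [u]. *)
have [u [xu um suw ulow]] : exists u, [/\ x <= u, u <= m, sg u = sg w &
    forall t, x <= t -> t < u -> sg t < sg w].
  have := maxP x (lexx _) (ltW xm); rewrite le_eqVlt => /orP[/eqP e|lt].
    by exists x; split=> //; [exact: ltW|move=> t t1 t2; move: t1; rewrite leNgt t2].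
  have [|u [u1 u2 u3 u4]] := @first_hit _ sg x w (sg w) xw _ lt (lexx _).
    by move=> t /andP[t1 t2]; apply: cont_xm; rewrite t1 (le_trans t2).
  by exists u; split=> //; [exact: ltW|exact: le_trans wm].
have Su : S u.
  apply/domE; split; first by split; lra.
  move=> t [t0 tu]; rewrite suw; have [xt|tx] := leP x t; first exact: ulow.
  by apply: lt_le_trans (xrec t (conj t0 tx)) _; exact: maxP (lexx _) (ltW xm).
have um' : u < m by rewrite lt_neqAle um andbT; apply/eqP => e; apply: nSm; rewrite -e.
exists u, (m - u); split; rewrite ?subr_gt0 //; last first.
  apply/andP; split; first by apply: lt_le_trans h1 _; rewrite -vx; exact: vle.
  by apply: le_lt_trans h3; rewrite -vy; apply: vle => //; lra.
split=> // s Ss us; rewrite addrC subrK leNgt; apply/negP => sm.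
have [_ /(_ u)] := (domE s).1 Ss.
have -> : (x0 < u /\ u < s) = True by apply/propext; split=> // _; split=> //; lra.
move=> /(_ I); rewrite suw ltNge maxP //; lra.
Qed.

Lemma nonaffine_to_field : defines_nonaffine_C1 M -> field_type M.
Proof.
move=> [a [b [f [ab fdef [fdrv fcont] nf]]]].
have {}fdef := definable_fun_Def fdef.
have ds x : a < x < b -> derivable f x 1 by move=> h; apply: fdrv; rewrite in_itv.
have cs x : a < x < b -> {for x, continuous (derive1 f)} by move=> h; apply: fcont; rewrite in_itv.
have [c [d [ac cd db ne]]] : exists c d, [/\ a < c, c < d, d < b & derive1 f c != derive1 f d].
  apply: contrapT => h; apply: nf.
  pose m := (a + b) / 2; have mI : a < m < b by apply/andP; rewrite /m; split; lra.
  exists (derive1 f m), (f m - derive1 f m * m).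
  have deq x : a < x < b -> derive1 f x = derive1 f m.
    move=> /andP[x1 x2]; case/andP: mI => m1 m2.
    have [xm|mx|->//] := ltgtP x m.
      by apply/eqP; rewrite -[_ == _]negbK; apply/negP => n; apply: h; exists x, m.
    by apply/esym/eqP; rewrite -[_ == _]negbK; apply/negP => n; apply: h; exists m, x.
  have key x y : a < x -> y < b -> x < y -> f y - f x = derive1 f m * (y - x).
    move=> ax yb xy.
    have sub t : x <= t <= y -> a < t < b by move=> /andP[? ?]; apply/andP; split; lra.
    have [||t tI ->] := @MVT R f (derive1 f) x y xy.
    - move=> t; rewrite in_itv /= => /andP[t1 t2].
      rewrite derive1E; apply: derivableP; apply: ds; apply: sub; rewrite !ltW //.
    - apply: derivable_within_continuous => t; rewrite in_itv /= => tI.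
      exact/ds/sub.
    - by rewrite deq //; apply: sub; move: tI; rewrite in_itv /= => /andP[/ltW -> /ltW ->].
  move=> x; rewrite in_itv /= => /andP[x1 x2]; case/andP: mI => m1 m2.
  have [xm|mx|->] := ltgtP x m; last by ring.
    by have := key _ _ x1 m2 xm; lra.
  by have := key _ _ m1 x2 mx; lra.
have fs x : a < x < b -> slope0 (fun h => f (x + h) - f x) (derive1 f x).
  by move=> /ds; exact: derivable_slope0.
move: ne; rewrite neq_lt => /orP[lt|lt]; first exact: slope_increase_field fdef fs cs ac cd db lt.
apply: (@slope_increase_field a b c d (fun x => - f x) (fun x => - derive1 f x)) => //.
- apply: (@Def_ext _ _ _ (fun v => (a < v 0%N /\ v 0%N < b) /\ - v 1%N = f (v 0%N))).
    by move=> v; split=> -[? e]; split=> //; [rewrite -e opprK|rewrite e opprK].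
  apply: (Def2_app (a := fun v => v 0%N) (b := fun v => - v 1%N) fdef); first exact: DefT_var.
  by apply: DefT_opp => //; exact: DefT_var.
- move=> x xI; have := slope0N (fs x xI).
  by congr slope0; apply/funext => h; rewrite opprB opprK addrC.
- by move=> x xI; apply: continuousN; exact: cs.
- by rewrite ltrN2.
Qed.

End NonaffineToField.

(** * A definable Baire category theorem *)

Section DefinableBaire.
Variables (R : realType) (L : language) (M : fo_structure L R).
Hypothesis Mexp : expands_ordered_add_group M.
Hypothesis MPN : ~ defines_PN_copy M.
Variables (C : chart M) (a b : R).
Hypothesis domE : forall t, cdom C t <-> a < t < b.
Local Notation h := (cval C).
Hypothesis h_lt : forall x y, a < x -> x < y -> y < b -> h x < h y.

Lemma chart_ltE x y : a < x < b -> a < y < b -> (h x < h y) = (x < y).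
Proof.
move=> /andP[ax xb] /andP[ay yb]; have [xy|yx|->] := ltgtP x y.
- by rewrite h_lt.
- by apply/negbTE; rewrite -leNgt; apply/ltW/h_lt.
- by rewrite ltxx.
Qed.

Lemma chart_leE x y : a < x < b -> a < y < b -> (h x <= h y) = (x <= y).
Proof. by move=> xI yI; rewrite !leNgt chart_ltE. Qed.

Lemma chart_cont x : a < x < b -> {for x, continuous h}.
Proof.
move=> xI; apply/contP => e e0.
have [u Su uE] := cval_surj C (h x - e / 2).
have [w Sw wE] := cval_surj C (h x + e / 2).
have uI := (domE u).1 Su; have wI := (domE w).1 Sw.
have ux : u < x by rewrite -chart_ltE // uE; lra.
have xw : x < w by rewrite -chart_ltE // wE; lra.
exists (Num.min (x - u) (w - x)); first by rewrite lt_min !subr_gt0 ux.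
move=> y; rewrite lt_min !ltr_norml => /andP[/andP[y1 y2] /andP[y3 y4]].
have uy : u < y by lra.
have yw : y < w by lra.
have yI : a < y < b.
  by case/andP: uI => au _; case/andP: wI => _ wb; rewrite (lt_trans au) //= (lt_trans yw).
have : h u < h y by rewrite chart_ltE.
have : h y < h w by rewrite chart_ltE.
by rewrite uE wE => *; apply/andP; split; lra.
Qed.

Section Family.
Variables (c d : R) (X : R -> R -> Prop).
Hypotheses (ac : a < c) (cd : c < d) (db : d < b).
Hypothesis X_def : Def2 M X.
Hypothesis X_closed : forall e x, 0 < e -> c <= x <= d ->
  (forall r, 0 < r -> exists y, [/\ c <= y <= d, `|y - x| < r & X e y]) -> X e x.
Hypothesis X_anti : forall e e' x, 0 < e' -> e' <= e -> c <= x <= d -> X e x -> X e' x.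
Hypothesis X_dense : forall u w, c <= u -> u < w -> w <= d ->
  exists x e, [/\ 0 < e, u < x < w & X e x].

Let Y e x := X e x /\ (c <= x /\ x <= d).

Let Y_sup e (A : set R) : 0 < e -> A `<=` Y e -> A !=set0 -> Y e (sup A).
Proof.
move=> e0 AY A0.
have hA : has_sup A by split=> //; exists d => x /AY[_ []].
have [x Ax] := A0; have [_ [cx xd]] := AY x Ax.
have cs : c <= sup A by apply: le_trans cx _; apply: ub_le_sup => //; case: hA.
have sd : sup A <= d by apply: ge_sup => // y /AY[_ []].
split=> //; apply: X_closed; rewrite ?cs // => r r0.
have [y Ay yr] := sup_adherent r0 hA; have [Xy [cy yd]] := AY y Ay.
exists y; rewrite cy yd; split=> //.
have ys : y <= sup A by apply: ub_le_sup => //; case: hA.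
by rewrite ler0_norm ?subr_le0 //; lra.
Qed.

Let Y_inf e (A : set R) : 0 < e -> A `<=` Y e -> A !=set0 -> Y e (inf A).
Proof.
move=> e0 AY A0.
have hA : has_inf A by split=> //; exists c => x /AY[_ []].
have [x Ax] := A0; have [_ [cx xd]] := AY x Ax.
have sd : inf A <= d by apply: le_trans xd; apply: ge_inf => //; case: hA.
have cs : c <= inf A by apply: lb_le_inf => // y /AY[_ []].
split=> //; apply: X_closed; rewrite ?cs // => r r0.
have [y Ay yr] := inf_adherent r0 hA; have [Xy [cy yd]] := AY y Ay.
exists y; rewrite cy yd; split=> //.
have ys : inf A <= y by apply: ge_inf => //; case: hA.
by rewrite ger0_norm ?subr_ge0 //; lra.
Qed.

(** If no [X e] contains an interval, then each one is closed and nowhere dense although their union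
    is dense. A dense set filtered by finite sets is built from this, contradicting [MPN]. *)
Lemma definable_baire : exists e u w, [/\ 0 < e, c <= u, u < w, w <= d &
  forall x, u <= x <= w -> X e x].
Proof.
apply: contrapT => nX.
have hole e u w : 0 < e -> c <= u -> u < w -> w <= d -> exists m, u < m < w /\ ~ X e m.
  move=> e0 cu uw wd; apply: contrapT => nm; apply: nX.
  exists e, ((2 * u + w) / 3), ((u + 2 * w) / 3); split; [by []|lra|lra|lra|].
  move=> x /andP[x1 x2]; apply: contrapT => nXx; apply: nm; exists x; split=> //.
  by apply/andP; split; lra.
have gap_in e x y : 0 < e -> Y e x -> Y e y -> x < y ->
    exists u w, [/\ x <= u, u < w, w <= y & [/\ Y e u, Y e w & forall s, Y e s -> u < s -> w <= s]].
  move=> e0 Yx Yy xy.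
  have [_ [cx xd]] := Yx; have [_ [cy yd]] := Yy.
  have [m [/andP[xm my] nXm]] := hole e x y e0 cx xy yd.
  (* As [Y e] is closed, both ends of the gap around the missing point [m] belong to it. *)
  pose A := [set z | Y e z /\ z <= m]; pose B := [set z | Y e z /\ m <= z].
  have YA : Y e (sup A) by apply: Y_sup => //; [move=> z []|exists x; split=> //; exact: ltW].
  have YB : Y e (inf B) by apply: Y_inf => //; [move=> z []|exists y; split=> //; exact: ltW].
  have hA : has_ubound A by exists m => z [].
  have hB : has_lbound B by exists m => z [].
  have Am : sup A <= m by apply: ge_sup; [exists x; split=> //; exact: ltW|move=> z []].
  have Bm : m <= inf B by apply: lb_le_inf; [exists y; split=> //; exact: ltW|move=> z []].
  exists (sup A), (inf B); split.
  - by apply: ub_le_sup => //; split=> //; exact: ltW.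
  - rewrite lt_neqAle (le_trans Am Bm) andbT; apply/eqP => e'.
    have : sup A = m by apply/eqP; rewrite eq_le Am e' Bm.
    by move=> Em; apply: nXm; rewrite -Em; case: YA.
  - by apply: ge_inf => //; split=> //; exact: ltW.
  - split=> // s Ys As; apply: ge_inf => //; split=> //.
    by rewrite leNgt; apply/negP => sm; move: As; rewrite ltNge ub_le_sup //; split=> //; exact: ltW.
have hI x : c <= x <= d -> a < x < b.
  by move=> /andP[x1 x2]; rewrite (lt_le_trans ac x1) (le_lt_trans x2 db).
have cI : a < c < b by apply: hI; rewrite lexx ltW.
have dI : a < d < b by apply: hI; rewrite lexx ltW.
have hcd : h c < h d by rewrite chart_ltE.
have pull r1 r2 : h c <= r1 -> r1 < r2 -> r2 <= h d ->
    exists x1 x2, [/\ h x1 = r1, h x2 = r2, c <= x1, x1 < x2 & x2 <= d].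
  move=> r1c r12 r2d; have [x1 S1 e1] := cval_surj C r1; have [x2 S2 e2] := cval_surj C r2.
  have I1 := (domE _).1 S1; have I2 := (domE _).1 S2.
  by exists x1, x2; split=> //; [rewrite -chart_leE ?e1|rewrite -chart_ltE ?e1 ?e2|rewrite -chart_leE ?e2].
have Y_def u v' : DefT M u -> DefT M v' -> Def M (fun v => Y (u v) (v' v)).
  move=> hu hv; apply: Def_and; first exact: Def2_app X_def hu hv.
  by apply: Def_and; apply: Def_le => //; exact: DefT_cst.
have PN (Lev : R -> R -> Prop) : Def2 M Lev ->
  (forall e, 0 < e -> finite_set [set u | Lev e u]) ->
  (forall e e' u, 0 < e' -> e' <= e -> Lev e u -> Lev e' u) ->
  (forall u w, c <= u -> u < w -> w <= d -> exists x e, [/\ 0 < e, u < x < w & Lev e x]) -> False.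
  move=> ldef lfin lanti ldense; apply: MPN; apply: (PN_copy Mexp (C := C) ldef hcd) => //.
    by move=> e /lfin; apply: sub_finite_set => u [].
  move=> r1 r2 r1c r12 r2d; have [x1 [x2 [e1 e2 cx1 x12 x2d]]] := pull r1 r2 r1c r12 r2d.
  have [x [e [e0 /andP[xx1 xx2] lx]]] := ldense x1 x2 cx1 x12 x2d.
  have xI : a < x < b by apply: hI; apply/andP; split; lra.
  have I1 : a < x1 < b by apply: hI; apply/andP; split; lra.
  have I2 : a < x2 < b by apply: hI; apply/andP; split; lra.
  exists x, e; split=> //; first exact/domE.
  by rewrite -e1 -e2 !chart_ltE // xx1.
(* If all [Y e] are finite, the family is itself the required filtration. *)
have [fin|] := pselect (forall e, 0 < e -> finite_set [set x | Y e x]).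
  apply: (PN Y) => //.
  - by apply: Y_def; exact: DefT_var.
  - by move=> e e' u e'0 ee' [Xu [cu ud]]; split=> //; apply: X_anti Xu; rewrite ?cu.
  - move=> u w cu uw wd; have [x [e [e0 xI Xx]]] := X_dense cu uw wd.
    exists x, e; split=> //; split=> //; case/andP: xI => *; split; lra.
move=> /existsNP[e0 /not_implyP[e00 infY]].
have fin_sep e l : 0 < l -> finite_set [set u | Y e u /\ forall s, Y e s -> u < s -> u + l <= s].
  move=> l0; apply: (separated_finite (c := c) (d := d) l0).
    by move=> x [[_ [-> ->]]].
  by move=> x y [_ hx] [Yy _]; exact: hx.
(* The lengths of the gaps of the infinite nowhere dense set X e0 form a definable
   discrete set accumulating only at 0. *)
pose G l := exists u, 0 < l /\ Y e0 u /\ Y e0 (u + l) /\ forall s, Y e0 s -> u < s -> u + l <= s.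
have G_fin e : 0 < e -> finite_set [set l | G l /\ e <= l].
  move=> e1; pose F := [set u | Y e0 u /\ forall s, Y e0 s -> u < s -> u + e <= s].
  pose len u := xget 0 [set l | 0 < l /\ Y e0 (u + l) /\ forall s, Y e0 s -> u < s -> u + l <= s].
  apply: (sub_finite_set (B := len @` F)); last by apply: finite_image; exact: fin_sep.
  move=> l [[u [l0 [Yu [Yul ul]]]] el]; exists u.
    by split=> // s Ys us; apply: le_trans (ul s Ys us); rewrite lerD2l.
  rewrite /len; case: xgetP => [k _ [k0 [Yk uk]]|/(_ l)/=]; last by case.
  have := ul _ Yk; have := uk _ Yul; rewrite !ltrDl !lerD2l => /(_ l0) h1 /(_ k0) h2.
  by apply/eqP; rewrite eq_le h1.
have G_small e : 0 < e -> exists2 l, G l & l < e.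
  move=> e1; apply: contrapT => nl; apply: infY.
  apply: (separated_finite (c := c) (d := d) e1); first by move=> x [_ [-> ->]].
  move=> x y Yx Yy xy; have [u [w [xu uw wy [Yu Yw us]]]] := gap_in _ _ _ e00 Yx Yy xy.
  have : ~ w - u < e.
    move=> lt; apply: nl; exists (w - u) => //; exists u; rewrite subr_gt0.
    by have -> : u + (w - u) = w by ring.
  by move=> /negP; rewrite -leNgt; lra.
have G0 l : G l -> 0 < l by case=> u [].
(* The points are left ends of gaps of the sets [Y l]. Indices restricted to [G] leave finitely many
   [l >= e], each contributing finitely many gaps of length at least [e]; over all real [l] the
   union could be infinite. *)
apply: (PN (fun e u => exists l, exists l', G l /\ G l' /\ e <= l /\ e <= l' /\
  Y l u /\ forall s, Y l s -> u < s -> u + l' <= s)).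
- have G_def k : Def M (fun v => G (v k)).
    apply: Def_ex; apply: Def_and; first by apply: Def_lt => //; [exact: DefT_cst|exact: DefT_var].
    apply: Def_and; first by apply: Y_def; [exact: DefT_cst|exact: DefT_var].
    apply: Def_and.
      by apply: Y_def; [exact: DefT_cst|apply: DefT_add => //; exact: DefT_var].
    apply: Def_all; apply: Def_imp; first by apply: Y_def; [exact: DefT_cst|exact: DefT_var].
    apply: Def_imp; first by apply: Def_lt => //; exact: DefT_var.
    by apply: Def_le => //; [apply: DefT_add => //|]; exact: DefT_var.
  apply: Def_ex; apply: Def_ex; apply: Def_and; first exact: G_def.
  apply: Def_and; first exact: G_def.
  apply: Def_and; first by apply: Def_le => //; exact: DefT_var.
  apply: Def_and; first by apply: Def_le => //; exact: DefT_var.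
  apply: Def_and; first by apply: Y_def; exact: DefT_var.
  apply: Def_all; apply: Def_imp; first by apply: Y_def; exact: DefT_var.
  apply: Def_imp; first by apply: Def_lt => //; exact: DefT_var.
  by apply: Def_le => //; [apply: DefT_add => //|]; exact: DefT_var.
- move=> e e1; apply: (sub_finite_set (B := \bigcup_(l in [set l | G l /\ e <= l])
    [set u | Y l u /\ forall s, Y l s -> u < s -> u + e <= s])).
    move=> u [l [l' [Gl [Gl' [el [el' [Yu us]]]]]]]; exists l => //; split=> // s Ys lt.
    by apply: le_trans (us s Ys lt); rewrite lerD2l.
  by apply: bigcup_finite; [exact: G_fin|move=> l _; exact: fin_sep].
- move=> e e' u _ ee' [l [l' [Gl [Gl' [el [el' Yu]]]]]]; exists l, l'.
  do 2!split=> //; split; first exact: le_trans ee' el.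
  by split=> //; exact: le_trans ee' el'.
move=> u w cu uw wd.
have [p [e1 [e10 /andP[up pm] Xp]]] : exists p e, [/\ 0 < e, u < p < (u + w) / 2 & X e p].
  by apply: X_dense => //; lra.
have [q [e2 [e20 /andP[mq qw] Xq]]] : exists p e, [/\ 0 < e, (u + w) / 2 < p < w & X e p].
  by apply: X_dense => //; lra.
have [l Gl] : exists2 l, G l & l < Num.min e1 e2 by apply: G_small; rewrite lt_min e10.
rewrite lt_min => /andP[l1 l2].
have l0 := G0 _ Gl.
have Yp : Y l p.
  by split; [apply: X_anti l0 (ltW l1) _ Xp; apply/andP; split; lra|split; lra].
have Yq : Y l q.
  by split; [apply: X_anti l0 (ltW l2) _ Xq; apply/andP; split; lra|split; lra].
have pq : p < q by lra.
have [x [y [px xy yq [Yx Yy xs]]]] := gap_in _ _ _ l0 Yp Yq pq.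
have [l' Gl' l'xy] : exists2 l, G l & l < y - x by apply: G_small; rewrite subr_gt0.
exists x, (Num.min l l'); split; first by rewrite lt_min l0 G0.
  by apply/andP; split; lra.
exists l, l'; rewrite !ge_min !lexx orbT; do 5!split=> //.
by move=> s Ys xs'; apply: le_trans (xs s Ys xs'); lra.
Qed.

End Family.
End DefinableBaire.

(** An inequality may compare lengths or field values; both readings are tried. *)
Ltac dfn C := cbn beta;
  lazymatch goal with
  | |- Def _ (fun v => is_true (_ < _)) =>
      first [solve [apply: Def_lt => //; dfn C] | solve [apply: (Def_ltK (C := C)); dfn C]]
  | |- Def _ (fun v => is_true (_ <= _)) =>
      first [solve [apply: Def_le => //; dfn C] | solve [apply: (Def_leK (C := C)); dfn C]]
  | _ => dfn_step; dfn C
  end.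

Section ContinuousLe.
Variable R : realType.
Implicit Types (f g : R -> R).

(** A weak inequality between continuous functions is a closed condition; this provides the
    closedness demanded by [definable_baire]. *)
Lemma cont_le f g x : {for x, continuous f} -> {for x, continuous g} ->
  (forall r, 0 < r -> exists2 y, `|y - x| < r & f y <= g y) -> f x <= g x.
Proof.
move=> /contP hf /contP hg hy; rewrite leNgt; apply/negP => lt.
have e0 : 0 < (f x - g x) / 2 by rewrite divr_gt0 // subr_gt0.
have [d1 d10 h1] := hf _ e0; have [d2 d20 h2] := hg _ e0.
have [|y] := hy (Num.min d1 d2); first by rewrite lt_min d10.
rewrite lt_min => /andP[/h1 + /h2]; rewrite !ltr_norml => /andP[? ?] /andP[? ?]; lra.
Qed.

Lemma cont_shift f s x : {for (x + s), continuous f} -> {for x, continuous (fun y => f (y + s))}.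
Proof.
move=> /contP hf; apply/contP => e e0; have [d d0 dP] := hf e e0; exists d => // y yd.
by apply: dP; rewrite opprD addrACA subrr addr0.
Qed.

Lemma cont_sub f g x : {for x, continuous f} -> {for x, continuous g} ->
  {for x, continuous (fun y => f y - g y)}.
Proof. exact: continuousB. Qed.

Lemma cont_div f g x : g x != 0 -> {for x, continuous f} -> {for x, continuous g} ->
  {for x, continuous (fun y => f y / g y)}.
Proof.
move=> g0 hf hg.
exact: (@continuousM R R f (fun y => (g y)^-1) x hf (continuousV g0 hg)).
Qed.

Lemma cont_scale c f x : {for x, continuous f} -> {for x, continuous (fun y => c * f y)}.
Proof. by move=> hf; apply: (@continuousM R R (fun=> c) f x) => //; exact: cvg_cst. Qed.

Lemma cont_addc f c x : {for x, continuous f} -> {for x, continuous (fun y => f y + c)}.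
Proof. by move=> hf; apply: (@continuousD R R R f (fun=> c) x) => //; exact: cvg_cst. Qed.

Lemma cont_itv f c d : (forall x, c <= x <= d -> {for x, continuous f}) ->
  {within `[c, d], continuous f}.
Proof. by move=> hf; apply: continuous_in_subspaceT => t; rewrite inE /= in_itv /=; exact: hf. Qed.

End ContinuousLe.

(** * Increments of the isomorphism of a field on an interval *)

Section Increments.
Variables (R : realType) (L : language) (M : fo_structure L R).
Hypothesis Mexp : expands_ordered_add_group M.
Hypothesis MPN : ~ defines_PN_copy M.
Variables (C : chart M) (a b : R).
Hypothesis domE : forall t, cdom C t <-> a < t < b.
Local Notation h := (cval C).
Hypothesis h_lt : forall x y, a < x -> x < y -> y < b -> h x < h y.

Definition incr t x := h (x + t) - h x.
Local Notation H := incr.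

Lemma incr_gt0 t x : a < x -> 0 < t -> x + t < b -> 0 < H t x.
Proof. by move=> ax t0 xb; rewrite subr_gt0; apply: h_lt => //; rewrite ltrDl. Qed.

Lemma incr_cont t x : a < x < b -> a < x + t < b -> {for x, continuous (H t)}.
Proof.
move=> xI xtI; apply: cont_sub; last exact: (chart_cont domE h_lt xI).
exact: cont_shift (chart_cont domE h_lt xtI).
Qed.

(** The values [h (b - e)] exceed any bound as [e] tends to 0. Hence one length [e] can control both
    a range of increments and a bound in the field. *)
Lemma chart_large r : exists2 e0, 0 < e0 &
  forall e, 0 < e -> e <= e0 -> e < b - a /\ r <= h (b - e).
Proof.
have [y Sy yr] := cval_surj C r; have /andP[ay yb] := (domE y).1 Sy.
exists (b - y); first by rewrite subr_gt0.
move=> e e0 eb; split; first lra.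
by rewrite -yr (chart_leE h_lt) ?ay //; [lra|apply/andP; split; lra].
Qed.

Lemma chart_large_le e e' : 0 < e' -> e' <= e -> e < b - a -> h (b - e) <= h (b - e').
Proof.
move=> e'0 ee' eb; rewrite (chart_leE h_lt); [lra|apply/andP; split; lra|apply/andP; split; lra].
Qed.

Let margin u w s : a < u -> u < w -> w < b -> a < u + s -> w + s < b ->
  exists2 m, 0 < m & forall x t, u <= x -> x <= w -> 0 < t -> t < m ->
    [/\ a < x < b, a < x + t < b, a < x + s < b & a < x + s + t < b].
Proof.
move=> au uw wb aus wsb; exists (Num.min (b - w) (b - (w + s))).
  by rewrite lt_min !subr_gt0 wb.
move=> x t ux xw t0; rewrite lt_min => /andP[h1 h2].
by split; apply/andP; split; lra.
Qed.

Lemma incr_shift_bounded u w s : a < u -> u < w -> w < b -> a < u + s -> w + s < b ->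
  exists u' w' e r, [/\ u <= u', u' < w', w' <= w, 0 < e &
    forall x t, u' <= x <= w' -> 0 < t -> t < e -> H t (x + s) <= r * H t x].
Proof.
move=> au uw wb aus wsb; have [m m0 mP] := margin au uw wb aus wsb.
pose X e x := e < b - a /\ forall t, (0 < t /\ t < e) /\ t < m ->
  h (x + s + t) - h (x + s) <= h (b - e) * (h (x + t) - h x).
have [||||e [u' [w' [e0 uu' uw' ww' XP]]]] := definable_baire Mexp MPN domE h_lt au uw wb (X := X).
- by rewrite /X /Def2; dfn C.
- move=> e x e0 /andP[ux xw] hX; have [|y [_ _ [eb _]]] := hX 1; first exact: ltr01.
  split=> // t [[t0 te] tm]; have [I1 I2 I3 I4] := mP x t ux xw t0 tm.
  apply: (@cont_le _ (fun x => h (x + s + t) - h (x + s)) (fun x => h (b - e) * (h (x + t) - h x))).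
  + by apply: (@cont_shift _ (H t)); apply: incr_cont.
  + by apply: cont_scale; exact: incr_cont.
  + by move=> r /hX[z [_ zr [_ Xz]]]; exists z => //; exact: Xz.
- move=> e e' x e'0 ee' /andP[ux xw] [eb hX]; split; first exact: le_lt_trans ee' eb.
  move=> t [[t0 te] tm]; apply: le_trans (hX t _) _; first by do 2!split=> //; exact: lt_le_trans te ee'.
  have [/andP[ax _] /andP[_ xb] _ _] := mP x t ux xw t0 tm.
  by rewrite ler_pM2r ?chart_large_le //; exact: incr_gt0.
- move=> p0 q0 up pq qw.
  pose p := (2 * p0 + q0) / 3; pose q := (p0 + 2 * q0) / 3.
  have [pp pq' qq] : [/\ p0 < p, p < q & q < q0] by rewrite /p /q; split; lra.
  have [ap qb aps qsb] : [/\ a < p, q < b, a < p + s & q + s < b] by split; lra.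
  clear up pq qw au uw wb aus wsb.
  have hpq : 0 < h q - h p by rewrite subr_gt0; exact: h_lt.
  (* The summand 1 puts [r] above the mean relative slope over [[p, q]], so that the minimum below
     is not at [q] and leaves room on its right. *)
  pose r := `|h (q + s) - h (p + s)| / (h q - h p) + 1.
  have rpq : h (q + s) - h (p + s) < r * (h q - h p).
    rewrite mulrDl mul1r divfK ?gt_eqF //.
    by apply: le_lt_trans (ler_norm _) _; rewrite ltrDl.
  have cphi x : p <= x <= q -> {for x, continuous (fun x => r * h x - h (x + s))}.
    move=> /andP[px xq]; apply: cont_sub.
      by apply: cont_scale; apply: (chart_cont domE h_lt); apply/andP; split; lra.
    by apply: cont_shift; apply: (chart_cont domE h_lt); apply/andP; split; lra.
  (* To the right of a minimum of [r * h - h (_ + s)] the relative slope of the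
     shifted function is at most [r]. *)
  have [x + xmin] := EVT_min (ltW pq') (cont_itv cphi).
  rewrite in_itv /= => /andP[px xq].
  have xq' : x < q.
    rewrite lt_neqAle xq andbT; apply/eqP => e; have := xmin p.
    by rewrite in_itv /= lexx (ltW pq') e => /(_ isT); lra.
  have [e0 e00 eP] := chart_large r.
  pose e := Num.min e0 (q - x); have e1 : 0 < e by rewrite lt_min e00 subr_gt0.
  have [eb re] : e < b - a /\ r <= h (b - e) by apply: eP => //; rewrite ge_min lexx.
  exists x, e; split=> //; first by apply/andP; split; lra.
  split=> // t [[t0 te] tm].
  have tq : t < q - x by apply: lt_le_trans te _; rewrite ge_min lexx orbT.
  have := xmin (x + t); rewrite in_itv /=.
  have -> : p <= x + t <= q by apply/andP; split; lra.
  move=> /(_ isT) hx; apply: (@le_trans _ _ (r * (h (x + t) - h x))).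
    by move: hx; rewrite (addrAC x t s); lra.
  by rewrite ler_pM2r // subr_gt0; apply: h_lt; lra.
exists u', w', (Num.min e m), (h (b - e)); split; rewrite ?lt_min ?e0 //.
move=> x t xI t0; rewrite lt_min => /andP[te tm].
by have [_] := XP x xI; apply.
Qed.


(** Boundedness gives the relative slopes of [h (_ + s)] against [h] a finite supremum on a small
    interval. A chord within [eta / 2] of it leads to a point from which all short chords have
    nearly this slope; the Baire theorem spreads this over an interval. *)
Lemma incr_shift_osc0 u w s eta : 0 < eta ->
  a < u -> u < w -> w < b -> a < u + s -> w + s < b ->
  exists u' w' e, [/\ u <= u', u' < w', w' <= w, 0 < e &
    forall x t t', u' <= x <= w' -> 0 < t < e -> 0 < t' < e ->
      H t (x + s) / H t x <= H t' (x + s) / H t' x + eta].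
Proof.
move=> eta0 au uw wb aus wsb; have [m m0 mP] := margin au uw wb aus wsb.
pose X e x := forall t, (0 < t /\ t < e) /\ t < m -> forall t', (0 < t' /\ t' < e) /\ t' < m ->
  (h (x + s + t) - h (x + s)) * (h (x + t) - h x)^-1 <=
  (h (x + s + t') - h (x + s)) * (h (x + t') - h x)^-1 + eta.
have cR x t : u <= x -> x <= w -> 0 < t -> t < m ->
    {for x, continuous (fun x => (h (x + s + t) - h (x + s)) * (h (x + t) - h x)^-1)}.
  move=> ux xw t0 tm; have [I1 I2 I3 I4] := mP x t ux xw t0 tm.
  apply: cont_div; last exact: incr_cont.
    rewrite gt_eqF //; apply: incr_gt0 => //; first by case/andP: I1.
    by case/andP: I2.
  by apply: (@cont_shift _ (H t)); apply: incr_cont.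
have [||||e [u' [w' [e0 uu' uw' ww' XP]]]] := definable_baire Mexp MPN domE h_lt au uw wb (X := X).
- by rewrite /X /Def2; dfn C.
- move=> e x e0 /andP[ux xw] hX t [[t0 te] tm] t' [[t'0 t'e] t'm].
  apply: (@cont_le _ (fun x => (h (x + s + t) - h (x + s)) * (h (x + t) - h x)^-1)
    (fun x => (h (x + s + t') - h (x + s)) * (h (x + t') - h x)^-1 + eta)).
  + exact: cR.
  + by apply: cont_addc; exact: cR.
  + by move=> r /hX[z [_ zr Xz]]; exists z => //; exact: Xz.
- move=> e e' x e'0 ee' _ hX t [[t0 te] tm] t' [[t'0 t'e] t'm].
  by apply: hX; do 2!split=> //; [exact: lt_le_trans te ee'|exact: lt_le_trans t'e ee'].
- move=> p0 q0 up pq qw.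
  pose p := (2 * p0 + q0) / 3; pose q := (p0 + 2 * q0) / 3.
  have [pp pq' qq] : [/\ p0 < p, p < q & q < q0] by rewrite /p /q; split; lra.
  have [|||||u1 [w1 [e1 [r [u1p uw1 w1q e10 rP]]]]] := @incr_shift_bounded p q s; [lra..|].
  (* On [[u1, w2]] every chord is shorter than [e1], so the bound [r] applies to it. *)
  pose w2 := Num.min w1 (u1 + e1 / 2).
  have uw2 : u1 < w2 by rewrite lt_min uw1; lra.
  have w21 : w2 <= w1 by rewrite ge_min lexx.
  have w2e : w2 <= u1 + e1 / 2 by rewrite ge_min lexx orbT.
  have [au1 w2b p0u1 w2q0] : [/\ a < u1, w2 < b, p0 < u1 & w2 < q0] by split; lra.
  have [au1s w2sb w2e1] : [/\ a < u1 + s, w2 + s < b & w2 < u1 + e1] by split; lra.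
  clear up pq qw pp pq' qq u1p uw1 w1q au uw wb aus wsb w2e.
  pose dq x y := (h (y + s) - h (x + s)) / (h y - h x).
  have dqH x y : dq x y = H (y - x) (x + s) / H (y - x) x.
    have e2 : x + s + (y - x) = y + s by ring.
    have e3 : x + (y - x) = y by ring.
    by rewrite /dq /incr e2 e3.
  have hxy x y : u1 <= x -> x < y -> y <= w2 -> 0 < h y - h x.
    move=> ux xy yw; rewrite subr_gt0.
    by apply: h_lt; [exact: lt_le_trans au1 ux| |exact: le_lt_trans yw w2b].
  pose A := [set k | exists x y, [/\ u1 <= x, x < y, y <= w2 & k = dq x y]].
  have A_le k : A k -> k <= r.
    move=> [x [y [ux xy yw ->]]]; rewrite dqH ler_pdivrMr.
      apply: rP; [|by rewrite subr_gt0|by move: ux yw w2e1; drop_ineqs; lra].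
      by rewrite ux (le_trans (ltW (lt_le_trans xy yw)) w21).
    by rewrite /incr (_ : x + (y - x) = y); [exact: hxy|ring].
  have hA : has_sup A by split; [exists (dq u1 w2), u1, w2|exists r].
  have eta2 : 0 < eta / 2 by rewrite divr_gt0.
  have [_ [x [y [ux xy yw ->]]] dxy] := sup_adherent eta2 hA.
  pose mu := sup A - eta / 2.
  have cphi z : x <= z <= y -> {for z, continuous (fun z => h (z + s) - mu * h z)}.
    move=> /andP[xz zy]; apply: cont_sub; last first.
      apply: cont_scale; apply: (chart_cont domE h_lt).
      by rewrite (lt_le_trans au1 (le_trans ux xz)) (le_lt_trans (le_trans zy yw) w2b).
    apply: cont_shift; apply: (chart_cont domE h_lt).
    by move: ux xz zy yw au1s w2sb; drop_ineqs => *; apply/andP; split; lra.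
  (* From the minimum [z], all slopes lie between [mu] and their supremum. *)
  have [z + zmin] := EVT_min (ltW xy) (cont_itv cphi).
  rewrite in_itv /= => /andP[xz zy].
  have zy' : z < y.
    rewrite lt_neqAle zy andbT; apply/eqP => e; have := zmin x.
    rewrite in_itv /= lexx (ltW xy) e => /(_ isT).
    by move: dxy; rewrite -/mu /dq ltr_pdivlMr ?hxy //; lra.
  exists z, (y - z); split; rewrite ?subr_gt0 //.
    by rewrite (lt_le_trans p0u1 (le_trans ux xz)) (lt_trans zy' (le_lt_trans yw w2q0)).
  have step t : 0 < t -> t < y - z -> [/\ u1 <= z, z < z + t & z + t <= w2].
    move=> t0 tz; rewrite ltrDl (le_trans ux xz); split=> //.
    by apply: le_trans yw; rewrite -lerBrDl ltW.
  have low t : 0 < t -> t < y - z -> mu <= (h (z + s + t) - h (z + s)) * (h (z + t) - h z)^-1.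
    move=> t0 tz; rewrite ler_pdivlMr; last by have [? ? ?] := step t t0 tz; exact: hxy.
    have := zmin (z + t); rewrite in_itv /=.
    have -> : x <= z + t <= y.
      by move: xz t0 tz; drop_ineqs => *; apply/andP; split; lra.
    by move=> /(_ isT); rewrite (addrAC z t s); drop_ineqs; lra.
  have up' t : 0 < t -> t < y - z -> (h (z + s + t) - h (z + s)) * (h (z + t) - h z)^-1 <= sup A.
    move=> t0 tz; apply: ub_le_sup; first by case: hA.
    have [? ? ?] := step t t0 tz; exists z, (z + t); split=> //.
    by rewrite /dq (addrAC z t s).
  move=> t [[t0 te] _] t' [[t'0 t'e] _].
  by have := up' t t0 te; have := low t' t'0 t'e; rewrite /mu; move: eta0; drop_ineqs; lra.
exists u', w', (Num.min e m); split; rewrite ?lt_min ?e0 //.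
move=> x t t' xI; rewrite !lt_min => /andP[t0 /andP[te tm]] /andP[t'0 /andP[t'e t'm]].
by apply: XP.
Qed.

(** The reverse bound is [incr_shift_bounded] for the shift [- s], started from the translated
    interval; it will make the limit [om] positive. *)
Lemma incr_shift_osc u w s eta : 0 < eta ->
  a < u -> u < w -> w < b -> a < u + s -> w + s < b ->
  exists u' w' e r, [/\ u <= u', u' < w', w' <= w, 0 < e &
    forall x, u' <= x <= w' ->
      (forall t, 0 < t < e -> H t x <= r * H t (x + s)) /\
      forall t t', 0 < t < e -> 0 < t' < e ->
      H t (x + s) / H t x <= H t' (x + s) / H t' x + eta].
Proof.
move=> eta0 au uw wb aus wsb.
have [|||||u1 [w1 [e1 [r [u1p uw1 w1q e10 rP]]]]] := @incr_shift_bounded (u + s) (w + s) (- s); [lra..|].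
have [|||||u' [w' [e [uu' uw' ww' e0 eP]]]] := @incr_shift_osc0 (u1 - s) (w1 - s) s _ eta0; [lra..|].
exists u', w', (Num.min e e1), r; split; [lra|by []|lra|by rewrite lt_min e0|].
move=> x /andP[ux xw]; split.
  move=> t; rewrite lt_min => /andP[t0 /andP[_ te]].
  by have := rP (x + s) t; rewrite addrK; apply=> //; apply/andP; split; lra.
move=> t t'; rewrite !lt_min => /andP[t0 /andP[te _]] /andP[t'0 /andP[t'e _]].
by apply: eP; rewrite ?ux // ?t0 ?t'0.
Qed.

Section GenericPoint.
Variables c d r0 : R.
Hypotheses (ac : a < c - r0) (cd : c < d) (db : d + r0 < b).

Let good s n x u w e r := [/\ u < x, x < w, 0 < e &
  forall y, u < y < w -> (forall t, 0 < t < e -> H t y <= r * H t (y + s)) /\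
    forall t t', 0 < t < e -> 0 < t' < e ->
      H t (y + s) / H t y <= H t' (y + s) / H t' y + n.+1%:R^-1].

(** The intervals found so far depend on the shift and on the tolerance. Countably many rational
    shifts and tolerances [n.+1%:R^-1] are handled together by the classical Baire theorem. *)
Lemma generic_point : exists2 x0, c < x0 < d &
  forall q : rat, `|ratr q : R| < r0 ->
    (exists r e, 0 < e /\ forall t, 0 < t < e -> H t x0 <= r * H t (x0 + ratr q)) /\
    forall eta, 0 < eta -> exists2 e, 0 < e & forall t t', 0 < t < e -> 0 < t' < e ->
      H t (x0 + ratr q) / H t x0 <= H t' (x0 + ratr q) / H t' x0 + eta.
Proof.
(* Points outside [[c, d]] are included to make the set dense in the whole line; indices that give
   no admissible shift impose nothing. *)
pose U (k : nat) : set R := if unpickle k is Some (q, n) then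
  if `|ratr (q : rat) : R| < r0 then
    [set x | x < c \/ d < x \/ exists u w e r, good (ratr q) n x u w e r]
  else setT else setT.
have UP k : open (U k) /\ dense (U k).
  rewrite /U; case: unpickle => [[q n]|]; last by split; [exact: openT|move=> O O0 _; rewrite setIT].
  case: ifPn => qr; last by split; [exact: openT|move=> O O0 _; rewrite setIT].
  split.
    rewrite openE => x hx; rewrite /interior; apply/nbhs_ballP.
    case: hx => [xc|[dx|[u [w [e [r [ux xw e0 gP]]]]]]].
    - exists (c - x); first by rewrite /= subr_gt0.
      move=> y; rewrite /ball /= ltr_norml => /andP[? ?]; left; lra.
    - exists (x - d); first by rewrite /= subr_gt0.
      move=> y; rewrite /ball /= ltr_norml => /andP[? ?]; right; left; lra.
    - exists (Num.min (x - u) (w - x)); first by rewrite /= lt_min !subr_gt0 ux.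
      move=> y; rewrite /ball /= lt_min !ltr_norml => /andP[/andP[? ?] /andP[? ?]].
      by right; right; exists u, w, e, r; split=> //; lra.
  move=> O [x Ox]; rewrite openE => /(_ x Ox); rewrite /interior => /nbhs_ballP[r /= rp rO].
  have [xc|cx] := ltP x c; first by exists x; split=> //; left.
  have [dx|xd] := ltP d x; first by exists x; split=> //; right; left.
  pose u := Num.max c (x - r / 2); pose w := Num.min d (x + r / 2).
  have cu : c <= u by rewrite le_max lexx.
  have wd : w <= d by rewrite ge_min lexx.
  have ru : x - r / 2 <= u by rewrite le_max lexx orbT.
  have rw : w <= x + r / 2 by rewrite ge_min lexx orbT.
  have uw : u < w.
    rewrite lt_min !gt_max cd /=; apply/andP; split; first lra.
    by apply/andP; split; lra.
  have n0 : 0 < n.+1%:R^-1 :> R by rewrite invr_gt0 ltr0n.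
  move: qr; rewrite ltr_norml => /andP[q1 q2].
  have ac' := ac; have db' := db.
  have [|||||u' [w' [e [k' [uu' uw' ww' e0 eP]]]]] := @incr_shift_osc u w (ratr q) _ n0; [lra..|].
  exists ((u' + w') / 2); split; first by apply: rO; rewrite /ball /= ltr_norml; apply/andP; split; lra.
  right; right; exists u', w', e, k'; split=> //; [lra|lra|].
  by move=> y /andP[uy yw]; apply: eP; rewrite !ltW.
have [||x0 [x0I x0U]] := Baire UP (O := [set x | c < x < d]).
- by have cd' := cd; exists ((c + d) / 2); apply/andP; split; lra.
- have -> : [set x | c < x < d] = `]c, d[%classic by apply/seteqP; split=> x /=; rewrite in_itv.
  exact: interval_open.
exists x0 => // q qr.
have key n : exists u w e r, good (ratr q) n x0 u w e r.
  have := x0U (pickle (q, n)) I; rewrite /U pickleK qr => -[x0c|[dx0|//]].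
    by case/andP: x0I => cx _; move: x0c; rewrite ltNge ltW.
  by case/andP: x0I => _ cx; move: dx0; rewrite ltNge ltW.
split.
  have [u [w [e [r [ux xw e0 gP]]]]] := key 0%N; exists r, e; split=> //.
  by have [] := gP x0; rewrite ?ux.
move=> eta eta0.
have [u [w [e [r [ux xw e0 gP]]]]] := key (Num.truncn eta^-1); exists e => // t t' tI t'I.
have [_ /(_ t t' tI t'I) hh] := gP x0 (introT andP (conj ux xw)).
apply: le_trans hh _; rewrite lerD2l; apply: ltW.
rewrite invf_plt ?posrE ?ltr0n //.
by rewrite truncnS_gt // invr_ge0 ltW.
Qed.

End GenericPoint.

End Increments.

(** * Locally uniform asymptotics of the increments *)

Section RegularIncrements.
Variables (R : realType) (L : language) (M : fo_structure L R).
Hypothesis Mexp : expands_ordered_add_group M.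
Hypothesis MPN : ~ defines_PN_copy M.
Variables (C : chart M) (a b : R).
Hypothesis ab : a < b.
Hypothesis domE : forall t, cdom C t <-> a < t < b.
Local Notation h := (cval C).
Hypothesis h_lt : forall x y, a < x -> x < y -> y < b -> h x < h y.
Local Notation H := (incr C).

Section BasePoint.
Variables x0 r1 : R.
Hypotheses (r10 : 0 < r1) (ar : a < x0 - r1) (rb : x0 + r1 < b).
Hypothesis gen : forall q : rat, `|ratr q : R| < r1 ->
  (exists r e, 0 < e /\ forall t, 0 < t < e -> H t x0 <= r * H t (x0 + ratr q)) /\
  forall eta, 0 < eta -> exists2 e, 0 < e & forall t t', 0 < t < e -> 0 < t' < e ->
    H t (x0 + ratr q) / H t x0 <= H t' (x0 + ratr q) / H t' x0 + eta.

Let m := b - (x0 + r1).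
Let m0 : 0 < m. Proof. by rewrite subr_gt0. Qed.
Let lo := x0 - r1.
Let hi := x0 + r1.
Let lohi : lo < hi. Proof. by have r10' := r10; rewrite /lo /hi; lra. Qed.

Let mP x t : lo <= x -> x <= hi -> 0 < t -> t < m -> a < x < b /\ a < x + t < b.
Proof.
have ar' := ar; have rb' := rb; rewrite /lo /hi /m => *.
by split; apply/andP; split; lra.
Qed.

Let rho t y := (h (y + t) - h y) * (h (x0 + t) - h x0)^-1.

Let base_gt0 t : 0 < t -> t < m -> 0 < h (x0 + t) - h x0.
Proof.
move=> t0 tm; have [] := @mP x0 t; rewrite /lo /hi; have r10' := r10; [lra|lra|by []|by []|].
by move=> /andP[? ?] /andP[? ?]; apply: (incr_gt0 h_lt).
Qed.

Let rho_cont t y : lo <= y -> y <= hi -> 0 < t -> t < m -> {for y, continuous (rho t)}.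
Proof.
move=> ly yh t0 tm; have [I1 I2] := mP ly yh t0 tm.
apply: cont_div; last by move=> ? ?; apply: cvg_cst.
  by rewrite gt_eqF // base_gt0.
exact: (incr_cont domE h_lt).
Qed.

(** The base point is now fixed and [y] varies. The points [x0 + ratr q] provide the density
    hypothesis of [definable_baire]. *)
Let rho_osc u w eta : 0 < eta -> lo <= u -> u < w -> w <= hi ->
  exists u' w' e, [/\ u <= u', u' < w', w' <= w, 0 < e & e <= m /\
    forall y t t', u' <= y <= w' -> 0 < t < e -> 0 < t' < e -> rho t y <= rho t' y + eta].
Proof.
move=> eta0 lu uw wh.
have ar' := ar; have rb' := rb.
pose X e y := forall t, (0 < t /\ t < e) /\ t < m -> forall t', (0 < t' /\ t' < e) /\ t' < m ->
  (h (y + t) - h y) * (h (x0 + t) - h x0)^-1 <=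
  (h (y + t') - h y) * (h (x0 + t') - h x0)^-1 + eta.
have au : a < u by move: lu; rewrite /lo; lra.
have wb : w < b by move: wh; rewrite /hi; lra.
have [||||e [u' [w' [e0 uu' uw' ww' XP]]]] := definable_baire Mexp MPN domE h_lt au uw wb (X := X).
- by rewrite /X /Def2; dfn C.
- move=> e x e0 /andP[ux xw] hX t [[t0 te] tm] t' [[t'0 t'e] t'm].
  apply: (@cont_le _ (rho t) (fun x => rho t' x + eta)).
  + by apply: rho_cont => //; lra.
  + by apply: cont_addc; apply: rho_cont => //; lra.
  + by move=> r /hX[z [_ zr Xz]]; exists z => //; exact: Xz.
- move=> e e' x e'0 ee' _ hX t [[t0 te] tm] t' [[t'0 t'e] t'm].
  by apply: hX; do 2!split=> //; [exact: lt_le_trans te ee'|exact: lt_le_trans t'e ee'].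
- move=> p q up pq qw.
  have [|s] := @rat_in_itvoo R (p - x0) (q - x0); first by rewrite ltrD2r.
  rewrite in_itv /= => /andP[s1 s2].
  have [|_ gs] := gen (q := s).
    by move: lu wh; rewrite /lo /hi => *; rewrite ltr_norml; apply/andP; split; lra.
  have [e e0 eP] := gs _ eta0; exists (x0 + ratr s), e; split=> //.
    by apply/andP; split; lra.
  by move=> t [[t0 te] _] t' [[t'0 t'e] _]; apply: eP; rewrite ?t0 ?t'0.
exists u', w', (Num.min e m); split; rewrite ?lt_min ?e0 //; split.
  by rewrite ge_min lexx orbT.
move=> y t t' yI; rewrite !lt_min => /andP[t0 /andP[te tm]] /andP[t'0 /andP[t'e t'm]].
by apply: XP.
Qed.

(** For positive [n]: the ratio oscillates by at most [1 / n] as the point tends to [y] and the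
    increment to 0, jointly. The condition is open in [y], so its failures form closed sets. *)
Let good n y := exists e, 0 < e /\ forall y', (y - e < y' /\ y' < y + e) /\ (lo <= y' /\ y' <= hi) ->
  forall y'', (y - e < y'' /\ y'' < y + e) /\ (lo <= y'' /\ y'' <= hi) ->
  forall t, (0 < t /\ t < e) /\ t < m -> forall t', (0 < t' /\ t' < e) /\ t' < m ->
  n * ((h (y' + t) - h y') * (h (x0 + t) - h x0)^-1 -
       (h (y'' + t') - h y'') * (h (x0 + t') - h x0)^-1) <= 1.

Let good_le n n' y : 0 < n -> n <= n' -> good n' y -> good n y.
Proof.
move=> n0 nn' [k [k0 kP]]; exists k; split=> // y' hy' y'' hy'' t ht t' ht'.
have := kP y' hy' y'' hy'' t ht t' ht'; set D := _ - _.
have [D0|D0] := leP 0 D; first by apply: le_trans; rewrite ler_wpM2r.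
by move=> _; apply: (@le_trans _ _ 0); rewrite ?ler01 // mulr_ge0_le0 // ltW.
Qed.

Let all_good : exists u w, [/\ lo <= u, u < w, w <= hi &
  forall y n, 0 < n -> u < y < w -> good n y].
Proof.
have ar' := ar; have rb' := rb.
pose Z e y := (e < b - a /\ 0 < h (b - e)) /\ ~ good (h (b - e)) y.
have alo : a < lo by [].
have hib : hi < b by [].
(* Either the bad points avoid some interval, which is the claim, or they are dense; then one bound
   [h (b - e)] fails on a whole interval, against [rho_osc]. *)
have [dense|ndense] := pselect (forall u w, lo <= u -> u < w -> w <= hi ->
    exists x e, [/\ 0 < e, u < x < w & Z e x]); last first.
  have [u [w [lu uw wh nZ]]] : exists u w, [/\ lo <= u, u < w, w <= hi &
      forall x e, 0 < e -> u < x < w -> ~ Z e x].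
    apply: contrapT => nn; apply: ndense => u w lu uw wh; apply: contrapT => nx; apply: nn.
    by exists u, w; split=> // x e e0 xI Zx; apply: nx; exists x, e.
  exists u, w; split=> // y n n0 yI.
  have [e e0 eP] := chart_large domE h_lt n; have [eb ne] := eP e e0 (lexx _).
  apply: (good_le n0 ne); apply: contrapT => ng; apply: (nZ y e e0 yI); split=> //.
  by split=> //; exact: lt_le_trans ne.
have [||||e [u [w [e0 lu uw wh ZP]]]] := definable_baire Mexp MPN domE h_lt alo lohi hib (X := Z).
- by rewrite /Z /good /Def2; dfn C.
- move=> e x e0 xI hX; have [|y0 [_ _ [[eb N0] _]]] := hX 1; first exact: ltr01.
  split=> // -[k [k0 kP]]; have [|y [_ yk [_ ng]]] := hX (k / 2); first by rewrite divr_gt0.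
  apply: ng; exists (k / 2); split; first by rewrite divr_gt0.
  have kk : k / 2 < k by rewrite gtr_pMr // invf_lt1 // ltr1n.
  move=> y' [[h1 h2] h3] y'' [[h4 h5] h6] t [[t0 te] tm] t' [[t'0 t'e] t'm].
  apply: kP; split=> //; first exact: window_trans yk h1 h2.
  - exact: window_trans yk h4 h5.
  - by split=> //; exact: lt_trans te kk.
  - by split=> //; exact: lt_trans t'e kk.
- move=> e e' x e'0 ee' _ [[eb N0] ng]; have NN := chart_large_le h_lt e'0 ee' eb.
  split; first by split; [exact: le_lt_trans ee' eb|exact: lt_le_trans NN].
  by move=> /(good_le N0 NN).
- exact: dense.
exfalso.
have [[_ n0] _] : Z e u by apply: ZP; rewrite lexx ltW.
(* A third of [1 / n] for each comparison: from [t] to [t0] at [y'], from [y'] to [y''] at [t0] by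
   continuity, and from [t0] to [t'] at [y'']. *)
pose n := h (b - e); pose eta := (3 * n)^-1.
have eta0 : 0 < eta by rewrite invr_gt0 mulr_gt0 //; lra.
have [u' [w' [e2 [uu' uw' ww' e20 [e2m oscP]]]]] := rho_osc eta0 lu uw wh.
pose y0 := (u' + w') / 2; pose t0 := e2 / 2.
have t00 : 0 < t0 by rewrite divr_gt0.
have t0e : t0 < e2 by rewrite /t0; lra.
have /contP hc : {for y0, continuous (rho t0)} by apply: rho_cont => //; rewrite /y0; lra.
have [|d d0 dP] := hc (eta / 2); first by rewrite divr_gt0.
have [_ []] : Z e y0 by apply: ZP; rewrite /y0; apply/andP; split; lra.
pose k := Num.min (Num.min d e2) (Num.min (y0 - u') (w' - y0)).
have [kd ke ku kw] : [/\ k <= d, k <= e2, k <= y0 - u' & k <= w' - y0].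
  by rewrite /k !ge_min !lexx ?orbT.
exists k; split.
  by rewrite !lt_min d0 e20 /y0; apply/andP; split; lra.
move=> y' [[h1 h2] _] y'' [[h4 h5] _] t [[t1 te] _] t' [[t'1 t'e] _].
have near z : y0 - k < z -> z < y0 + k -> `|rho t0 z - rho t0 y0| < eta / 2.
  by move=> *; apply: dP; rewrite ltr_norml; apply/andP; split; lra.
have a1 : rho t y' <= rho t0 y' + eta.
  by apply: oscP; rewrite ?t00 ?t1 ?(lt_le_trans te ke) //; exact: in_window h1 h2 ku kw.
have a2 : rho t0 y'' <= rho t' y'' + eta.
  by apply: oscP; rewrite ?t00 ?t'1 ?(lt_le_trans t'e ke) //; exact: in_window h4 h5 ku kw.
have := near y' h1 h2; have := near y'' h4 h5; rewrite !ltr_norml => /andP[a3 a4] /andP[a5 a6].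
have DE : rho t y' - rho t' y'' <= 3 * eta by lra.
have <- : n * (3 * eta) = 1 by rewrite /eta; field; rewrite gt_eqF.
by rewrite ler_pM2l.
Qed.

Lemma regular_at_base : exists p1 p2 (om : R -> R), [/\ a < p1, p1 < p2, p2 < b &
  forall y, p1 < y < p2 -> 0 < om y /\ forall eta, 0 < eta -> exists2 e, 0 < e &
    forall y' t, `|y' - y| < e -> 0 < t < e -> `|H t y' / H t x0 - om y| <= eta].
Proof.
have ar' := ar; have rb' := rb.
have [u [w [lu uw wh gP]]] := all_good.
(* The supremum of the eventual lower bounds is the lower limit as [t] tends to 0; vanishing
   oscillation makes it the limit. *)
pose A y := [set r | exists e, [/\ 0 < e, e <= m & forall t, 0 < t < e -> r <= rho t y]].
pose om y := sup (A y).
have conv y : u < y < w -> forall eta, 0 < eta -> exists2 e, 0 < e &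
    forall y' t, `|y' - y| < e -> 0 < t < e -> `|rho t y' - om y| <= eta.
  move=> yI eta eta0; have i0 : 0 < eta^-1 by rewrite invr_gt0.
  have [k [k0 kP]] := gP y _ i0 yI; case/andP: yI => uy yw.
  pose e := Num.min (Num.min k m) (Num.min (y - u) (w - y)).
  have [ek em eu ew] : [/\ e <= k, e <= m, e <= y - u & e <= w - y].
    by rewrite /e !ge_min !lexx ?orbT.
  have e0 : 0 < e by rewrite !lt_min k0 m0 !subr_gt0 uy.
  have osc y' y'' t t' : `|y' - y| < e -> `|y'' - y| < e -> 0 < t < e -> 0 < t' < e ->
      rho t y' <= rho t' y'' + eta.
    have side z : `|z - y| < e -> (y - k < z /\ z < y + k) /\ (lo <= z /\ z <= hi).
      rewrite ltr_norml => /andP[? ?]; have [z1 z2] : y - e < z /\ z < y + e by split; lra.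
      have /andP[? ?] := in_window z1 z2 eu ew.
      by split; split=> //; lra.
    have tside r : 0 < r < e -> (0 < r /\ r < k) /\ r < m.
      by move=> /andP[? re]; split; [split=> //; exact: lt_le_trans re ek|exact: lt_le_trans re em].
    move=> /side y'P /side y''P /tside tP /tside t'P.
    have : eta^-1 * (rho t y' - rho t' y'') <= 1 by apply: kP.
    by rewrite -[X in X <= _](mulrC) ler_pdivrMr // mul1r lerBlDr addrC.
  exists e => // y' t y'e tI.
  have yy : `|y - y| < e by rewrite subrr normr0.
  have inA : A y (rho t y' - eta).
    by exists e; split=> // t' t'I; rewrite lerBlDr; exact: osc.
  have ubA : ubound (A y) (rho t y' + eta).
    move=> r [e' [e'0 e'm rP]].
    pose t' := Num.min e e' / 2.
    have [t'0 t'e t'e'] := min_half e0 e'0; rewrite -/t' in t'0 t'e t'e'.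
    apply: le_trans (rP t' _) _; first by rewrite t'0.
    by apply: osc => //; rewrite t'0.
  have h1 : om y <= rho t y' + eta by apply: ge_sup => //; exists (rho t y' - eta).
  have h2 : rho t y' - eta <= om y by apply: ub_le_sup => //; exists (rho t y' + eta).
  by rewrite ler_norml; apply/andP; split; lra.
have [s sI] : exists s : rat, u < x0 + ratr s < w.
  have [|s] := @rat_in_itvoo R (u - x0) (w - x0); first by rewrite ltrD2r.
  by rewrite in_itv /= => /andP[s1 s2]; exists s; apply/andP; split; lra.
pose y0 := x0 + ratr s.
(* At a rational shift of [x0] the reverse bound gives ratios at least [1 / r'], and [om y0] differs
   from them by at most half of that. *)
have om0 : 0 < om y0.
  have [|[r [e [e0 eP]]] _] := gen (q := s).
    by move: sI lu wh; rewrite /lo /hi => /andP[? ?] *; rewrite ltr_norml; apply/andP; split; lra.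
  pose r' := `|r| + 1; have r'0 : 0 < r' by rewrite /r'; have := normr_ge0 r; lra.
  have i0 : 0 < r'^-1 / 2 by rewrite divr_gt0 // invr_gt0.
  have [e1 e10 e1P] := conv y0 sI _ i0.
  have mn : 0 < Num.min e e1 by rewrite lt_min e0 e10.
  pose t := Num.min (Num.min e e1) m / 2.
  have [t0 + tm] := min_half mn m0; rewrite -/t lt_min in t0 tm * => /andP[te te1].
  have := e1P y0 t; rewrite subrr normr0 t0 te1 => /(_ e10 isT).
  rewrite ler_norml => /andP[_ h1].
  have b0 := base_gt0 t0 tm.
  have h2 : r'^-1 <= rho t y0.
    rewrite ler_pdivlMr // mulrC ler_pdivrMr // -/(H t y0) mulrC.
    have hy : 0 < H t y0.
      have [] := @mP y0 t; rewrite /y0; [case/andP: sI; lra|case/andP: sI; lra|by []|by []|].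
      by move=> /andP[? ?] /andP[? ?]; apply: (incr_gt0 h_lt).
    have := eP t; rewrite t0 te => /(_ isT) h3; apply: le_trans h3 _.
    by rewrite ler_pM2r // /r'; have := ler_norm r; lra.
  have : 0 < r'^-1 by rewrite invr_gt0.
  by move: h1 h2; lra.
(* Two errors of this size leave [om y >= om y0 / 2] near [y0]. *)
have om02 : 0 < om y0 / 4 by rewrite divr_gt0.
have [e e0 eP] := conv y0 sI _ om02.
pose p1 := Num.max u (y0 - e); pose p2 := Num.min w (y0 + e).
have [up ep wp ep2] : [/\ u <= p1, y0 - e <= p1, p2 <= w & p2 <= y0 + e].
  by rewrite /p1 /p2 !le_max !ge_min !lexx !orbT.
have /andP[uy0 y0w] := sI.
have py : p1 < y0 < p2 by rewrite gt_max lt_min uy0 y0w; apply/andP; split; lra.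
exists p1, p2, om; split.
- by move: lu; rewrite /lo; lra.
- by case/andP: py; exact: lt_trans.
- by move: wh; rewrite /hi; lra.
move=> y /andP[y1 y2].
have yI : u < y < w by apply/andP; split; lra.
split; last exact: conv.
have [e1 e10 e1P] := conv y yI _ om02.
pose t := Num.min e e1 / 2.
have [t0 te te1] := min_half e0 e10; rewrite -/t in t0 te te1.
have := e1P y t; rewrite subrr normr0 t0 te1 => /(_ e10 isT).
have := eP y t; rewrite t0 te ltr_norml.
have -> : - e < y - y0 < e by apply/andP; split; lra.
move=> /(_ isT isT); rewrite !ler_norml => /andP[? ?] /andP[? ?]; lra.
Qed.

End BasePoint.

Lemma regular_increments : exists x0 p1 p2 (om : R -> R),
  [/\ a < x0 < b, a < p1, p1 < p2, p2 < b &
  forall y, p1 < y < p2 -> 0 < om y /\ forall eta, 0 < eta -> exists2 e, 0 < e &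
    forall y' t, `|y' - y| < e -> 0 < t < e -> `|H t y' / H t x0 - om y| <= eta].
Proof.
have ab' := ab.
pose r0 := (b - a) / 8; pose c := a + 2 * r0; pose d := b - 2 * r0.
have r00 : 0 < r0 by rewrite divr_gt0 // subr_gt0.
have [h1 h2 h3] : [/\ a < c - r0, c < d & d + r0 < b] by rewrite /c /d; split; rewrite /r0; lra.
have [x0 /andP[cx xd] gen] := generic_point Mexp MPN domE h_lt h1 h2 h3.
have [||p1 [p2 [om [ap pp pb P]]]] := @regular_at_base x0 r0 r00 _ _ gen; [lra|lra|].
by exists x0, p1, p2, om; split=> //; apply/andP; split; lra.
Qed.

End RegularIncrements.

Section RealEstimates.
Variable R : realFieldType.
Implicit Types (x y t e k d s u v : R).

Lemma near_shift x y t e (j1 j2 : R) : `|y - x| < e / 2 -> 0 < t < e / 2 ->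
  e <= x - j1 -> e <= j2 - x ->
  [/\ `|y - x| < e, `|y + t - x| < e, j1 < y < j2, j1 < y + t < j2 & t < e].
Proof.
rewrite !ltr_norml => /andP[h1 h2] /andP[h3 h4] h5 h6.
by split; try (apply/andP; split); lra.
Qed.

Lemma one_plus_small u v : `|u| < 4^-1 -> `|v| < 4^-1 -> 0 < 1 + (v + u) <= 2.
Proof. by rewrite !ltr_norml => /andP[? ?] /andP[? ?]; apply/andP; split; lra. Qed.

Lemma sub_near x y z d e : `|y - x| < d -> `|z - x| < d -> 2 * d <= e ->
  z - y < e /\ `|y - x| < e.
Proof.
rewrite !ltr_norml => /andP[? ?] /andP[? ?] ?.
by split; [|apply/andP; split]; lra.
Qed.

Lemma slope_near s u v w k : `|v - u| < k / 2 -> `|w - u| < k / 2 ->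
  `|1 + ((w - s) + (v - s)) - (1 + 2 * (u - s))| <= k.
Proof.
by rewrite !ltr_norml ler_norml => /andP[? ?] /andP[? ?]; apply/andP; split; lra.
Qed.

(** The chain rule in approximate form: [z] is about [A * w], and its image [z * p'] is about
    [B * W], so [W / w] is about [A * p / B]. *)
Lemma ratio_estimate A B p p' k d (w W z : R) : 0 < A -> 0 < B -> 0 < p -> p < 2 ->
  0 < p' <= 2 -> 0 < k -> k <= 1 -> k <= B / 2 ->
  k * (2 / B * (3 * A + 2) + 2 + A) <= d * B -> `|p' - p| <= k -> 0 < w -> 0 < W ->
  `|z - A * w| <= k * w -> `|z * p' - B * W| <= k * W ->
  `|W - A * p / B * w| <= d * w.
Proof.
move=> A0 B0 p0 p2 /andP[p'0 p'2] k0 k1 kB kD pp w0 W0 g1 g2.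
have g4 : `|z * p' - A * p * w| <= (2 + A) * k * w.
  have -> : z * p' - A * p * w = (z - A * w) * p' + A * w * (p' - p) by ring.
  apply: le_trans (ler_normD _ _) _; rewrite !normrM (gtr0_norm p'0) (gtr0_norm A0) (gtr0_norm w0).
  have a1 : `|z - A * w| * p' <= k * w * 2 by apply: ler_pM => //; exact: ltW.
  have a2 : A * w * `|p' - p| <= A * w * k by rewrite ler_pM2l // mulr_gt0.
  lra.
have g5 : `|B * W - A * p * w| <= k * W + (2 + A) * k * w.
  have -> : B * W - A * p * w = (z * p' - A * p * w) - (z * p' - B * W) by ring.
  by apply: le_trans (ler_normB _ _) _; lra.
(* An a priori bound on [W] by a multiple of [w] turns the error [k * W] into one relative to
   [w]. *)
have g6 : W <= 2 / B * (3 * A + 2) * w.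
  have b1 := le_trans (ler_norm _) g5.
  have b2 : k * W <= B / 2 * W by rewrite ler_pM2r.
  have b3 : A * p * w <= A * 2 * w by rewrite ler_pM2r // ler_pM2l // ltW.
  have b4 : (2 + A) * k * w <= (2 + A) * w.
    by rewrite ler_pM2r // -[leRHS]mulr1 ler_pM2l //; lra.
  have b5 : B / 2 * W <= (3 * A + 2) * w by lra.
  have -> : W = 2 / B * (B / 2 * W) by field; rewrite gt_eqF.
  by rewrite -[leRHS]mulrA ler_pM2l // divr_gt0.
have g7 : `|B * (W - A * p / B * w)| <= B * (d * w).
  have -> : B * (W - A * p / B * w) = B * W - A * p * w by field; rewrite gt_eqF.
  apply: le_trans g5 _.
  have c1 : k * W <= k * (2 / B * (3 * A + 2) * w) by rewrite ler_pM2l.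
  have c2 : k * (2 / B * (3 * A + 2) + 2 + A) * w <= d * B * w by rewrite ler_pM2r.
  lra.
by move: g7; rewrite normrM (gtr0_norm B0) ler_pM2l.
Qed.

End RealEstimates.

Section StrictDerivative.
Variable R : realType.
Implicit Types (f phi : R -> R).

Lemma slope0_derivable f x s : slope0 (fun y => f (x + y) - f x) s ->
  derivable f x 1 /\ derive1 f x = s.
Proof.
move=> hs.
have key : (fun y : R => y^-1 *: (f (y *: 1 + x) - f x)) @ 0^' --> s.
  apply/cvgrPdist_le => e e0; have [d d0 dP] := hs e e0.
  apply/nbhs_ballP; exists d => // y; rewrite /ball /= sub0r normrN => yd y0.
  have := dP y yd; rewrite /GRing.scale /= mulr1 (addrC y x) => h.
  have -> : s - y^-1 * (f (x + y) - f x) = - ((f (x + y) - f x - s * y) / y).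
    by rewrite mulrBl mulfK // opprB mulrC.
  by rewrite normrN normrM normfV ler_pdivrMr ?normr_gt0.
split; first by apply/cvg_ex; exists s.
by rewrite derive1E /derive; apply: cvg_lim.
Qed.

(** Since the base point [x'] is free, positive increments also cover the negative ones. For
    continuity, the expansions at [y] given by [x] and by [y] itself are compared for one common
    [t]. *)
Lemma strict_C1 f phi j1 j2 :
  (forall x, j1 < x < j2 -> forall eta, 0 < eta -> exists2 e, 0 < e & forall x' t,
     `|x' - x| < e -> 0 < t < e -> `|f (x' + t) - f x' - phi x * t| <= eta * t) ->
  C1_on j1 j2 f /\ {in `]j1, j2[, forall x, derive1 f x = phi x}.
Proof.
move=> hf.
have der x : j1 < x < j2 -> derivable f x 1 /\ derive1 f x = phi x.
  move=> xI; apply: slope0_derivable => eta eta0; have [e e0 eP] := hf x xI eta eta0.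
  exists e => // y ye; have [y0|y0|->] := ltgtP y 0.
  - have := eP (x + y) (- y); rewrite addrK addrAC subrr add0r ye oppr_gt0 y0 -(ltr0_norm y0) ye.
    move=> /(_ isT isT); rewrite (ltr0_norm y0)
      (_ : f x - _ - _ = - (f (x + y) - f x - phi x * y)) ?normrN //.
    by ring.
  - have := eP x y; rewrite subrr normr0 e0 y0 -{1}(gtr0_norm y0) ye.
    by move=> /(_ isT isT); rewrite (gtr0_norm y0).
  - by rewrite addr0 subrr mulr0 subrr !normr0 mulr0.
split; last by move=> x; rewrite in_itv /= => /der[].
split=> x; rewrite in_itv /= => xI; first by have [] := der x xI.
apply/contP => eta eta0; have eta4 : 0 < eta / 4 by rewrite divr_gt0.
have [e e0 eP] := hf x xI _ eta4; have /andP[x1 x2] := xI.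
exists (Num.min e (Num.min (x - j1) (j2 - x))); first by rewrite !lt_min e0 !subr_gt0 x1.
move=> y; rewrite !lt_min => /andP[ye /andP[]].
rewrite !(ltr_norml (y - x) (_ - _)) => /andP[y1 y2] /andP[y3 y4].
have yI : j1 < y < j2 by apply/andP; split; lra.
have [_ ->] := der y yI; have [_ ->] := der x xI.
have [e' e'0 e'P] := hf y yI _ eta4.
pose t := Num.min e e' / 2; have [t0 te te'] := min_half e0 e'0; rewrite -/t in t0 te te'.
have := eP y t ye; rewrite t0 te => /(_ isT) h1.
have := e'P y t; rewrite subrr normr0 t0 te' => /(_ e'0 isT) h2.
have h3 : `|(phi y - phi x) * t| <= eta / 2 * t.
  have -> : (phi y - phi x) * t = (f (y + t) - f y - phi x * t) - (f (y + t) - f y - phi y * t) by ring.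
  by apply: le_trans (ler_normB _ _) _; lra.
move: h3; rewrite normrM (gtr0_norm t0) ler_pM2r // => h3.
by apply: le_lt_trans h3 _; lra.
Qed.

Lemma nat_ratio (x y : R) : 0 <= x -> x < y -> exists m n : nat,
  [/\ (0 < n)%N, x * n%:R < m%:R & m%:R < y * n%:R].
Proof.
move=> x0 xy; have d0 : 0 < y - x by rewrite subr_gt0.
pose n := (Num.truncn (y - x)^-1).+1.
have hn : 1 < (y - x) * n%:R.
  by rewrite mulrC -ltr_pdivrMr // div1r truncnS_gt // invr_ge0 ltW.
exists (Num.truncn (x * n%:R)).+1, n.
have := truncn_itv (mulr_ge0 x0 (ler0n R n)) => /andP[h1 h2]; split=> //.
by rewrite -natr1; lra.
Qed.

End StrictDerivative.

(** * A non-affine function from regular increments *)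

Section FieldToNonaffine.
Variables (R : realType) (L : language) (M : fo_structure L R).
Hypothesis Mexp : expands_ordered_add_group M.
Variables (C : chart M) (a b : R).
Hypothesis domE : forall t, cdom C t <-> a < t < b.
Local Notation h := (cval C).
Hypothesis h_lt : forall x y, a < x -> x < y -> y < b -> h x < h y.
Local Notation H := (incr C).
Variables (x0 p1 p2 : R) (om : R -> R).
Hypotheses (x0I : a < x0 < b) (ap : a < p1) (p12 : p1 < p2) (pb : p2 < b).
Hypothesis conv0 : forall y, p1 < y < p2 -> 0 < om y /\ forall eta, 0 < eta -> exists2 e, 0 < e &
    forall y' t, `|y' - y| < e -> 0 < t < e -> `|H t y' / H t x0 - om y| <= eta.

Let wt t := H t x0.

Let wt_gt0 t : 0 < t -> t < b - x0 -> 0 < wt t.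
Proof. by move=> t0 tb; case/andP: x0I => ax _; apply: (incr_gt0 h_lt) => //; lra. Qed.

Let wt_le t t' : 0 < t -> t <= t' -> t' < b - x0 -> wt t <= wt t'.
Proof.
move=> t0 tt' tb; case/andP: x0I => ax xb; rewrite /wt /incr lerD2r.
by rewrite (chart_leE h_lt); [lra|apply/andP; split; lra|apply/andP; split; lra].
Qed.

Let conv y eta : p1 < y < p2 -> 0 < eta -> exists2 e, 0 < e & e <= b - x0 /\
    forall y' t, `|y' - y| < e -> 0 < t < e -> `|H t y' - om y * wt t| <= eta * wt t.
Proof.
move=> yI eta0; have [_ /(_ eta eta0)[e e0 eP]] := conv0 yI.
case/andP: x0I => ax xb.
exists (Num.min e (b - x0)); first by rewrite lt_min e0 subr_gt0.
split; first by rewrite ge_min lexx orbT.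
move=> y' t; rewrite !lt_min => /andP[ye _] /andP[t0 /andP[te tb]].
have w0 := wt_gt0 t0 tb.
have := eP y' t ye; rewrite t0 te => /(_ isT) hh.
have -> : H t y' - om y * wt t = (H t y' / H t x0 - om y) * wt t.
  by rewrite mulrBl divfK // gt_eqF.
by rewrite normrM (gtr0_norm w0) ler_pM2r.
Qed.

(** Near a fixed [y], the increment over [m%:R * t] is the sum of [m] increments over [t], each
    about [om y * wt t]; it is also about [om y * wt (m%:R * t)]. *)
Let wt_mul m dl : 0 < dl -> exists2 e, 0 < e & forall t, 0 < t < e ->
  `|wt (m%:R * t) - m%:R * wt t| <= dl * wt t.
Proof.
case: m => [|m] dl0.
  exists (b - x0); first by case/andP: x0I; rewrite subr_gt0.
  move=> t /andP[t0 tb]; rewrite !mul0r subr0 /wt /incr addr0 subrr normr0.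
  by rewrite mulr_ge0 ?ltW // wt_gt0.
set n := m.+1; have n0 : 0 < n%:R :> R by rewrite ltr0n.
have n1 : 1 <= n%:R :> R by rewrite ler1n.
pose y := (p1 + p2) / 2; have yI : p1 < y < p2 by have p12' := p12; rewrite /y; apply/andP; split; lra.
have [om0 _] := conv0 yI.
(* The first bound gives [wt (n%:R * t) <= 3 * (n%:R * wt t)]; the total error is then
   [4 * n%:R * eta * wt t], which the second bound absorbs. *)
pose eta := Num.min (om y / 2) (dl * om y / (4 * n%:R)).
have eta0 : 0 < eta by rewrite lt_min !divr_gt0 ?mulr_gt0.
have eta1 : eta <= om y / 2 by rewrite ge_min lexx.
have eta2 : 4 * n%:R * eta <= dl * om y.
  by rewrite mulrC -ler_pdivlMr ?mulr_gt0 // ge_min lexx orbT.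
have [e e0 [eb eP]] := conv yI eta0.
exists (e / n%:R); first by rewrite divr_gt0.
move=> t /andP[t0]; rewrite ltr_pdivlMr // mulrC => tn.
have te : t < e by apply: le_lt_trans tn; rewrite ler_peMl // ltW.
have w0 : 0 < wt t by apply: wt_gt0 => //; lra.
have tel k : (k <= n)%N -> `|H (k%:R * t) y - k%:R * (om y * wt t)| <= k%:R * (eta * wt t).
  elim: k => [_|k IH kn]; first by rewrite !mul0r subr0 /incr addr0 subrr normr0.
  have kt : k%:R * t < e.
    by apply: le_lt_trans tn; rewrite ler_pM2r // ler_nat ltnW.
  have := eP (y + k%:R * t) t; rewrite addrAC subrr add0r.
  have kt0 : 0 <= k%:R * t by rewrite mulr_ge0 // ltW.
  rewrite (ger0_norm kt0) kt t0 te.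
  move=> /(_ isT isT) h1; have h2 := IH (ltnW kn).
  have e1 : k.+1%:R * t = k%:R * t + t by rewrite -natr1 mulrDl mul1r.
  have -> : H (k.+1%:R * t) y - k.+1%:R * (om y * wt t) =
    (H (k%:R * t) y - k%:R * (om y * wt t)) + (H t (y + k%:R * t) - om y * wt t).
    by rewrite /incr e1 -natr1 addrA; ring.
  have -> : k.+1%:R * (eta * wt t) = k%:R * (eta * wt t) + eta * wt t by rewrite -natr1 mulrDl mul1r.
  by apply: le_trans (ler_normD _ _) _; lra.
have h1 := tel n (leqnn n).
have nt0 : 0 < n%:R * t by rewrite mulr_gt0.
have := eP y (n%:R * t); rewrite subrr normr0 e0 nt0 tn => /(_ isT isT) h2.
have W0 : 0 < wt (n%:R * t) by apply: wt_gt0 => //; lra.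
move: (wt (n%:R * t)) (wt t) (H (n%:R * t) y) (om y) h1 h2 W0 w0 om0 eta1 eta2 => W w hy o.
move=> h1 h2 W0 w0 om0 eta1 eta2.
have h3 : `|o * W - n%:R * (o * w)| <= eta * W + n%:R * (eta * w).
  have -> : o * W - n%:R * (o * w) = (hy - n%:R * (o * w)) - (hy - o * W) by ring.
  by apply: le_trans (ler_normB _ _) _; lra.
have h4 : W <= 3 * (n%:R * w).
  have : o * W - n%:R * (o * w) <= eta * W + n%:R * (eta * w).
    exact: le_trans (ler_norm _) h3.
  have a1 : eta * W <= o / 2 * W by rewrite ler_pM2r.
  have a2 : n%:R * (eta * w) <= n%:R * (o / 2 * w) by rewrite ler_pM2l // ler_pM2r.
  move=> h5; have : o * W <= o * (3 * (n%:R * w)) by lra.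
  by rewrite ler_pM2l.
have h5 : `|o * (W - n%:R * w)| <= o * (dl * w).
  have -> : o * (W - n%:R * w) = o * W - n%:R * (o * w) by ring.
  apply: le_trans h3 _.
  have a1 : eta * W <= eta * (3 * (n%:R * w)) by rewrite ler_pM2l.
  have a2 : 4 * n%:R * eta * w <= dl * o * w by rewrite ler_pM2r.
  lra.
by move: h5; rewrite normrM (gtr0_norm om0) ler_pM2l.
Qed.

(** Ratios of [wt] determine ratios of lengths. If [T / t] were too large, a fraction [m / n] would
    fit between; with [t = n%:R * u], monotonicity and [wt_mul] would make [wt T / wt t] almost
    [m / n] or larger. The lower bound is symmetric. *)
Let wt_inv phi eta : 0 < phi -> 0 < eta -> exists dl e, [/\ 0 < dl, 0 < e &
  forall t T, 0 < t < e -> 0 < T < e -> `|wt T - phi * wt t| <= dl * wt t ->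
  `|T - phi * t| <= eta * t].
Proof.
move=> phi0 eta0.
have [ax xb] := andP x0I.
have up : exists e, 0 < e /\ forall t T, 0 < t < e -> 0 < T < e ->
    wt T <= (phi + eta / 4) * wt t -> T <= (phi + eta) * t.
  have [||m [n [n0 h1 h2]]] := @nat_ratio R (phi + eta / 2) (phi + eta); [lra|lra|].
  have n0' : 0 < n%:R :> R by rewrite ltr0n.
  (* [k] collects the coefficients of the error [d1] on both sides; together they cost
     [n%:R * eta / 8], less than the margin [n%:R * eta / 4]. *)
  pose k := 1 + phi + eta / 4; have k0 : 0 < k by rewrite /k; lra.
  pose d1 := n%:R * eta / 8 / k; have d10 : 0 < d1 by rewrite !divr_gt0 ?mulr_gt0.
  have d1k : d1 * k = n%:R * eta / 8 by rewrite /d1 divfK // gt_eqF.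
  have [e1 e10 P1] := wt_mul m d10; have [e2 e20 P2] := wt_mul n d10.
  exists (Num.min (Num.min e1 e2) (b - x0)); split; first by rewrite !lt_min e10 e20 subr_gt0.
  move=> t T /andP[t0]; rewrite !lt_min => /andP[/andP[te1 te2] tb] /andP[T0 /andP[_ Tb]] hw.
  rewrite leNgt; apply/negP => hT.
  have [u u0 tu] : exists2 u, 0 < u & n%:R * u = t.
    by exists (t / n%:R); [rewrite divr_gt0|rewrite mulrC divfK // gt_eqF].
  have ut : u <= t by rewrite -tu; apply: ler_peMl; [exact: ltW|rewrite ler1n].
  have := P1 u; have := P2 u; rewrite u0 (le_lt_trans ut te1) (le_lt_trans ut te2) tu.
  move=> /(_ isT) /ler_normlP[_ a2] /(_ isT) /ler_normlP[a3 _].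
  have m0 : 0 < m%:R :> R by apply: le_lt_trans h1; rewrite mulr_ge0 // ltW //; lra.
  have mu : m%:R * u < T.
    apply: le_lt_trans hT; rewrite -tu mulrA ler_pM2r //; exact: ltW.
  have a4 : wt (m%:R * u) <= wt T by apply: wt_le; rewrite ?mulr_gt0 // ltW.
  have w0 : 0 < wt u by apply: wt_gt0 => //; lra.
  have a5 : (m%:R - d1) * wt u <= (phi + eta / 4) * ((n%:R + d1) * wt u).
    have : (phi + eta / 4) * wt t <= (phi + eta / 4) * ((n%:R + d1) * wt u).
      by rewrite ler_pM2l; lra.
    lra.
  move: a5; rewrite mulrA ler_pM2r // => a5.
  by move: d1k; rewrite /k; lra.
have low : exists e, 0 < e /\ forall t T, 0 < t < e -> 0 < T < e ->
    (phi - eta / 4) * wt t <= wt T -> (phi - eta) * t <= T.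
  have [pe|pe] := leP phi eta.
    exists 1; split=> // t T /andP[t0 _] /andP[T0 _] _.
    by apply: le_trans (ltW T0); rewrite mulr_le0_ge0 ?subr_le0 // ltW.
  have [||m [n [n0 h1 h2]]] := @nat_ratio R (phi - eta) (phi - eta / 2); [lra|lra|].
  have n0' : 0 < n%:R :> R by rewrite ltr0n.
  pose k := 1 + phi; have k0 : 0 < k by rewrite /k; lra.
  pose d1 := n%:R * eta / 8 / k; have d10 : 0 < d1 by rewrite !divr_gt0 ?mulr_gt0.
  have d1k : d1 * k = n%:R * eta / 8 by rewrite /d1 divfK // gt_eqF.
  have [e1 e10 P1] := wt_mul m d10; have [e2 e20 P2] := wt_mul n d10.
  have m1 : 0 < m%:R + 1 :> R by rewrite ltr_wpDl.
  exists (Num.min (Num.min e1 e2) ((b - x0) / (m%:R + 1))); split.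
    by rewrite !lt_min e10 e20 divr_gt0 ?subr_gt0.
  move=> t T /andP[t0]; rewrite !lt_min (ltr_pdivlMr _ _ m1) => /andP[/andP[te1 te2] tb] /andP[T0 _] hw.
  rewrite leNgt; apply/negP => hT.
  have [u u0 tu] : exists2 u, 0 < u & n%:R * u = t.
    by exists (t / n%:R); [rewrite divr_gt0|rewrite mulrC divfK // gt_eqF].
  have ut : u <= t by rewrite -tu; apply: ler_peMl; [exact: ltW|rewrite ler1n].
  have := P1 u; have := P2 u; rewrite u0 (le_lt_trans ut te1) (le_lt_trans ut te2) tu.
  move=> /(_ isT) /ler_normlP[a2 _] /(_ isT) /ler_normlP[_ a3].
  have m0 : 0 <= m%:R :> R by [].
  have mu : T < m%:R * u.
    apply: lt_le_trans hT _; rewrite -tu mulrA ler_pM2r //; exact: ltW.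
  have mut : m%:R * u <= m%:R * t by rewrite ler_wpM2l.
  have a4 : wt T <= wt (m%:R * u) by apply: wt_le; rewrite ?ltW //; lra.
  have w0 : 0 < wt u by apply: wt_gt0 => //; have := mulr_ge0 m0 (ltW t0); lra.
  have a5 : (phi - eta / 4) * ((n%:R - d1) * wt u) <= (m%:R + d1) * wt u.
    have : (phi - eta / 4) * ((n%:R - d1) * wt u) <= (phi - eta / 4) * wt t.
      by rewrite ler_pM2l; lra.
    lra.
  move: a5; rewrite mulrA ler_pM2r // => a5.
  have : 0 < eta * d1 by rewrite mulr_gt0.
  by move: d1k; rewrite /k; lra.
have [e1 [e10 P1]] := up; have [e2 [e20 P2]] := low.
exists (eta / 4), (Num.min e1 e2); split; [by rewrite divr_gt0|by rewrite lt_min e10|].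
move=> t T; rewrite !lt_min => /andP[t0 /andP[t1 t2]] /andP[T0 /andP[T1 T2]].
rewrite ler_norml => /andP[hw1 hw2].
have := P1 t T; rewrite t0 t1 T0 T1 => /(_ isT isT) b1.
have := P2 t T; rewrite t0 t2 T0 T2 => /(_ isT isT) b2.
have c1 : T <= (phi + eta) * t by apply: b1; lra.
have c2 : (phi - eta) * t <= T by apply: b2; lra.
by rewrite ler_norml; apply/andP; split; lra.
Qed.

Let vi r := s2val (cid2 (cval_surj C r)).

Let vi_in r : a < vi r < b.
Proof. by apply/domE; exact: (s2valP (cid2 (cval_surj C r))). Qed.

Let viK r : h (vi r) = r. Proof. exact: (s2valP' (cid2 (cval_surj C r))). Qed.

Let valK x : a < x < b -> vi (h x) = x.
Proof. by move=> xI; apply: (@cval_inj _ _ _ C); [exact/domE|exact/domE|rewrite viK]. Qed.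

Let vi_cont r : {for r, continuous vi}.
Proof.
apply/contP => e e0; have /andP[ax xb] := vi_in r; set x := vi r in ax xb *.
pose k := Num.min (e / 2) (Num.min ((x - a) / 2) ((b - x) / 2)).
have k0 : 0 < k by rewrite !lt_min !divr_gt0 ?subr_gt0.
have [ke ka kb] : [/\ k <= e / 2, k <= (x - a) / 2 & k <= (b - x) / 2].
  by rewrite /k !ge_min !lexx ?orbT.
have I1 : a < x - k < b by apply/andP; split; lra.
have I2 : a < x + k < b by apply/andP; split; lra.
have h1 : h (x - k) < r by rewrite -(viK r) -/x; apply: h_lt; lra.
have h2 : r < h (x + k) by rewrite -{1}(viK r) -/x; apply: h_lt; lra.
exists (Num.min (r - h (x - k)) (h (x + k) - r)); first by rewrite lt_min !subr_gt0 h1.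
move=> r'; rewrite lt_min !ltr_norml => /andP[/andP[b1 b2] /andP[b3 b4]].
have c1 : x - k < vi r' by rewrite -(chart_ltE h_lt) // viK; lra.
have c2 : vi r' < x + k by rewrite -(chart_ltE h_lt) // viK; lra.
by apply/andP; split; lra.
Qed.

Lemma nonaffine_of_increments : defines_nonaffine_C1 M.
Proof.
have ap' := ap; have pb' := pb; have p12' := p12.
pose x1 := (p1 + p2) / 2.
have x1p : p1 < x1 < p2 by rewrite /x1; apply/andP; split; lra.
have pI x : p1 < x < p2 -> a < x < b by move=> /andP[? ?]; apply/andP; split; lra.
have x1I := pI _ x1p.
pose s1 := h x1.
(* [f] fixes [x1] with derivative 1 there, so it could only be affine as the identity. *)
pose f x := vi (h x + (h x - s1) * (h x - s1)).
have fI x : a < f x < b by exact: vi_in.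
have hf x : h (f x) = h x + (h x - s1) * (h x - s1) by exact: viK.
have fx1 : f x1 = x1 by rewrite /f /s1 subrr mulr0 addr0 valK.
have hc x : a < x < b -> {for x, continuous h} by exact: (chart_cont domE h_lt).
have fc x : a < x < b -> {for x, continuous f}.
  move=> /hc hx.
  have hx1 : {for x, continuous (fun x => h x - s1)} by apply: cont_addc.
  have hp : {for x, continuous (fun x => h x + (h x - s1) * (h x - s1))}.
    exact: (@continuousD R R R h (fun x => (h x - s1) * (h x - s1)) x hx
      (@continuousM R R (fun x => h x - s1) (fun x => h x - s1) x hx1 hx1)).
  apply/contP => e e0.
  have /contP/(_ e e0)[k k0 P1] : {for (h x + (h x - s1) * (h x - s1)), continuous vi}.
    exact: vi_cont.
  by have /contP/(_ k k0)[d d0 P2] := hp; exists d => // y /P2/P1.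
(* The bound 1/4 keeps the difference quotients of [s + (s - s1) ^ 2] between 1/2 and 3/2, so [f] is
   increasing here. *)
have [d d0 dP] : exists2 d, 0 < d & forall x, `|x - x1| < d ->
    [/\ p1 < x < p2, p1 < f x < p2 & `|h x - s1| < 4^-1].
  have /contP/(_ 4^-1) := hc _ x1I; rewrite invr_gt0 ltr0n => /(_ isT)[d1 d10 P1].
  have l0 : 0 < (p2 - p1) / 2 by rewrite divr_gt0 // subr_gt0.
  have /contP/(_ _ l0)[d2 d20 P2] := fc _ x1I.
  exists (Num.min (Num.min d1 d2) ((p2 - p1) / 2)); first by rewrite !lt_min d10 d20.
  move=> x; rewrite !lt_min => /andP[/andP[/P1 q1 /P2]].
  rewrite fx1 (ltr_norml (f x - x1)) (ltr_norml (x - x1)) /x1 => /andP[? ?] /andP[? ?].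
  by split=> //; apply/andP; split; lra.
pose j1 := x1 - d; pose j2 := x1 + d.
have jP x : j1 < x < j2 -> [/\ p1 < x < p2, p1 < f x < p2 & `|h x - s1| < 4^-1].
  move=> /andP[q1 q2]; apply: dP; rewrite ltr_norml.
  by apply/andP; split; move: q1 q2; rewrite /j1 /j2; lra.
have x1j : j1 < x1 < j2 by rewrite /j1 /j2; apply/andP; split; lra.
(* The chain rule, with [om] in the role of a derivative of [h] relative to [wt]. It gives the limit
   of [wt T / wt t], which [wt_inv] converts into the limit of [T / t]. *)
pose phi x := om x * (1 + 2 * (h x - s1)) / om (f x).
have strict x : j1 < x < j2 -> forall eta, 0 < eta -> exists2 e, 0 < e & forall x' t,
     `|x' - x| < e -> 0 < t < e -> `|f (x' + t) - f x' - phi x * t| <= eta * t.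
  move=> xj eta eta0; have [xp fxp hx4] := jP x xj; have /andP[xj1 xj2] := xj.
  have [A0 _] := conv0 xp; have [B0 _] := conv0 fxp.
  pose A := om x; pose B := om (f x); pose pe := 1 + 2 * (h x - s1).
  have [pe0 pe2] : 0 < pe /\ pe < 2.
    by move: hx4; rewrite /pe ltr_norml => /andP[? ?]; split; lra.
  have phi0 : 0 < phi x by rewrite divr_gt0 // mulr_gt0.
  have [dl [e1 [dl0 e10 invP]]] := wt_inv phi0 eta0.
  pose Q := 2 / B * (3 * A + 2).
  have Q0 : 0 < Q by rewrite mulr_gt0 ?divr_gt0 //; have : 0 < A by []; lra.
  have D0 : 0 < Q + 2 + A by have : 0 < A by []; lra.
  pose k := Num.min 1 (Num.min (B / 2) (dl * B / (Q + 2 + A))).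
  have k0 : 0 < k by rewrite !lt_min ltr01 !divr_gt0 // mulr_gt0.
  have [k1 kB kD] : [/\ k <= 1, k <= B / 2 & k * (Q + 2 + A) <= dl * B].
    rewrite -ler_pdivlMr //; by rewrite /k !ge_min !lexx ?orbT.
  have [e2 e20 [e2b P2]] := conv xp k0.
  have [e3 e30 [e3b P3]] := conv fxp k0.
  have k20 : 0 < k / 2 by rewrite divr_gt0.
  have /contP/(_ _ k20)[d4 d40 P4] := hc x (pI _ xp).
  (* [T] is the distance of two points within [e13] of [f x], hence below [e1] and [e3]. *)
  pose e13 := Num.min e1 e3 / 2.
  have e130 : 0 < e13 by have [] := min_half e10 e30.
  have e13E : 2 * e13 = Num.min e1 e3 by rewrite /e13 mulrC divfK ?pnatr_eq0.
  have e131 : 2 * e13 <= e1 by rewrite e13E ge_min lexx.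
  have e133 : 2 * e13 <= e3 by rewrite e13E ge_min lexx orbT.
  have /contP/(_ _ e130)[d5 d50 P5] := fc x (pI _ xp).
  pose mm := Num.min (Num.min e1 e2) (Num.min (Num.min d4 d5) (Num.min (x - j1) (j2 - x))).
  have mm0 : 0 < mm by rewrite !lt_min e10 e20 d40 d50 !subr_gt0 xj1.
  have [[m1 m2 m4] [m5 mj1 mj2]] : [/\ mm <= e1, mm <= e2 & mm <= d4] /\
      [/\ mm <= d5, mm <= x - j1 & mm <= j2 - x].
    by rewrite /mm !ge_min !lexx ?orbT.
  exists (mm / 2); first by rewrite divr_gt0.
  move=> x' t x'x tI; have t0 : 0 < t by case/andP: tI.
  have [n1 n2 x'j x'tj tm] := near_shift x'x tI mj1 mj2.
  have [x'p fx'p hx'4] := jP _ x'j; have [x'tp fx'tp hx't4] := jP _ x'tj.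
  pose T := f (x' + t) - f x'.
  have fT : f x' + T = f (x' + t) by rewrite /T addrC subrK.
  pose pe' := 1 + ((h (x' + t) - s1) + (h x' - s1)).
  have HT : H T (f x') = H t x' * pe'.
    by rewrite /incr fT !hf /pe'; ring.
  have pe'I : 0 < pe' <= 2 by exact: one_plus_small.
  have /andP[pe'0 _] := pe'I.
  have Hp : 0 < H t x'.
    by case/andP: (pI _ x'p) => ? ?; case/andP: (pI _ x'tp) => ? ?; apply: (incr_gt0 h_lt).
  have T0 : 0 < T.
    rewrite subr_gt0 -(chart_ltE h_lt) ?fI // -subr_gt0.
    have -> : h (f (x' + t)) - h (f x') = H T (f x') by rewrite /incr fT.
    by rewrite HT mulr_gt0.
  have [Te1 _] := sub_near (P5 _ (lt_le_trans n1 m5)) (P5 _ (lt_le_trans n2 m5)) e131.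
  have [Te3 fn] := sub_near (P5 _ (lt_le_trans n1 m5)) (P5 _ (lt_le_trans n2 m5)) e133.
  have g1 : `|H t x' - A * wt t| <= k * wt t.
    by apply: P2; [exact: lt_le_trans n1 m2|rewrite t0 (lt_le_trans tm m2)].
  have g2 : `|H T (f x') - B * wt T| <= k * wt T by apply: P3 => //; rewrite T0.
  have g3 : `|pe' - pe| <= k.
    by apply: slope_near; apply: P4; [exact: lt_le_trans n1 m4|exact: lt_le_trans n2 m4].
  have w0 : 0 < wt t by apply: wt_gt0 => //; exact: lt_le_trans tm (le_trans m2 e2b).
  have W0 : 0 < wt T by apply: wt_gt0 => //; exact: lt_le_trans Te3 e3b.
  apply: (invP t T); [by rewrite t0 (lt_le_trans tm m1)|by rewrite T0|].
  rewrite HT in g2.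
  exact: (ratio_estimate A0 B0 pe0 pe2 pe'I k0 k1 kB kD g3 w0 W0 g1 g2).
have [C1 dE] := strict_C1 strict.
exists j1, j2, f; split => //.
- by case/andP: x1j; exact: lt_trans.
- apply: (@Def_to_definable _ _ M 2 0 (fun v => (j1 < v 0%N /\ v 0%N < j2) /\
     (cdom C (v 1%N) /\ h (v 1%N) = h (v 0%N) + (h (v 0%N) - s1) * (h (v 0%N) - s1)))).
    apply: Def_and; first by dfn C.
    apply: Def_and; first by dfn C.
    by apply: (Def_eqK (C := C)); dfn C.
  move=> z; split.
    move=> [x]; rewrite /= in_itv /= => /andP[q1 q2] <- /=; rewrite hf.
    by split=> //; split=> //; apply/domE.
  move=> [[q1 q2] [S1 e]]; exists (nth 0 z 0); first by rewrite /= in_itv /= q1.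
  have e1 : f (nth 0 z 0) = nth 0 z 1 by rewrite /f -e valK //; exact/domE.
  apply: eq_from_tnth => i; rewrite !(tnth_nth 0).
  by case: i => -[|[|//]] ? //=.
move=> [s [t aff]].
have affE x : j1 < x < j2 -> f x = s * x + t by move=> xj; apply: aff; rewrite in_itv.
have s_1 : s = 1.
  have d1 : derive1 f x1 = 1.
    rewrite dE ?in_itv //= /phi fx1 subrr mulr0 addr0 mulr1 divff //.
    by rewrite gt_eqF //; have [] := conv0 x1p.
  have sl : slope0 (fun y => f (x1 + y) - f x1) (derive1 f x1).
    by apply: derivable_slope0; case: C1 => + _; apply; rewrite in_itv.
  apply/eqP; rewrite -subr_eq0 -normr_le0 leNgt; apply/negP => n0.
  have n02 : 0 < `|s - 1| / 2 by rewrite divr_gt0.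
  have [e e0 eP] := sl _ n02.
  pose y := Num.min (e / 2) (d / 2).
  have y0 : 0 < y by rewrite lt_min !divr_gt0.
  have [ye yd] : y <= e / 2 /\ y <= d / 2 by rewrite /y !ge_min !lexx orbT.
  have := eP y; rewrite (gtr0_norm y0) d1 => /(_ _).
  have -> : y < e by lra.
  move=> /(_ isT); rewrite !affE //; last by rewrite /j1 /j2; apply/andP; split; lra.
  have -> : s * (x1 + y) + t - (s * x1 + t) - 1 * y = (s - 1) * y by ring.
  by rewrite normrM (gtr0_norm y0) ler_pM2r //; lra.
have fid x : j1 < x < j2 -> f x = x.
  by move=> xj; have := affE _ x1j; have := affE _ xj; rewrite fx1 s_1 !mul1r => -> e; lra.
(* An affine [f] would be the identity, yet [h] is moved by the nonzero amount [(h y - s1) ^ 2] at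
   [y]. *)
pose y := x1 + d / 2.
have yj : j1 < y < j2 by rewrite /y /j1 /j2; apply/andP; split; lra.
have [yp _ _] := jP y yj.
have := hf y; rewrite (fid y yj) => e.
have : (h y - s1) * (h y - s1) = 0 by lra.
move/eqP; rewrite mulf_eq0 orbb subr_eq0 => /eqP hy.
have : h x1 < h y 
  by apply: h_lt; [case/andP: x1I|rewrite /y ltrDl divr_gt0|case/andP: (pI _ yp)].
by rewrite hy /s1 ltxx.
Qed.

End FieldToNonaffine.

(** * A field on an interval as a chart *)

Section FieldChart.
Variables (R : realType) (L : language) (M : fo_structure L R).
Hypothesis Mexp : expands_ordered_add_group M.

Lemma definable_op_Def a b (op o : R -> R -> R) (h g : R -> R) :
  (forall x, a < x < b -> g x = h x) ->
  definable_op M `]a, b[ op ->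
  {in `]a, b[ &, forall x y, op x y \in `]a, b[} ->
  set_inj `]a, b[ h ->
  {in `]a, b[ &, forall x y, h (op x y) = o (h x) (h y)} ->
  Def3 M (fun x y z => [/\ a < x < b, a < y < b, a < z < b & o (g x) (g y) = g z]).
Proof.
move=> gh /definable_to_Def opd opI hinj hop; apply: Def_ext opd => v; split.
  move=> [x xI [y yI e]].
  have e0 : x = v 0%N by have := congr1 (fun t => tnth t ord0) e; rewrite tnth_mktuple.
  have e1 : y = v 1%N by have := congr1 (fun t => tnth t (@Ordinal 3 1 isT)) e; rewrite tnth_mktuple.
  have e2 : op x y = v 2%N by have := congr1 (fun t => tnth t ord_max) e; rewrite tnth_mktuple.
  have := opI x y xI yI; move: (xI) (yI) (hop x y xI yI).
  rewrite e2 e0 e1 /= !in_itv /= => I0 I1 hh I2.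
  by split=> //; rewrite !gh // hh.
move=> [I0 I1 I2 e]; rewrite !gh // in e.
have m0 : v 0%N \in `]a, b[ by rewrite in_itv.
have m1 : v 1%N \in `]a, b[ by rewrite in_itv.
exists (v 0%N) => //; exists (v 1%N) => //.
have e2 : op (v 0%N) (v 1%N) = v 2%N.
  apply: hinj; rewrite ?inE /= ?in_itv //=; first by have := opI _ _ m0 m1; rewrite in_itv.
  by rewrite hop.
by apply: eq_from_tnth => i; rewrite tnth_mktuple; case: i => -[|[|[|//]]] ? //=; rewrite -e2.
Qed.

Lemma field_to_nonaffine : ~ defines_PN_copy M -> field_type M -> defines_nonaffine_C1 M.
Proof.
move=> MPN [a [b [op [ot [[ab opI otI opd otd] [h [[hfun hinj hsurj] hlt hop hot]]]]]]].
(* Nothing is known of [h] off the interval, whereas a chart vanishes off its domain. *)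
pose g x := if a < x < b then h x else 0.
have gh x : a < x < b -> g x = h x by rewrite /g => ->.
have Sdef : Def1 M (fun x => a < x < b).
  apply: (@Def_ext _ _ _ (fun v => a < v 0%N /\ v 0%N < b)); first by move=> v; split=> /andP.
  by apply: Def_and; apply: Def_lt => //; (exact: DefT_cst || exact: DefT_var).
have gout x : ~ a < x < b -> g x = 0 by rewrite /g => /negP/negbTE ->.
have ginj x y : a < x < b -> a < y < b -> g x = g y -> x = y.
  by move=> xI yI; rewrite !gh // => e; apply: hinj; rewrite ?inE /= ?in_itv.
have gsurj r : exists2 x, a < x < b & g x = r.
  have [x + <-] := hsurj r I; rewrite /= in_itv /= => xI.
  by exists x => //; rewrite gh.
pose C := @Chart R L M (fun x => a < x < b) g Sdef gout ginj gsurj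
  (definable_op_Def gh opd opI hinj hop) (definable_op_Def gh otd otI hinj hot).
have domE t : cdom C t <-> a < t < b by [].
have h_lt x y : a < x -> x < y -> y < b -> cval C x < cval C y.
  move=> ax xy yb; have xI : a < x < b by rewrite ax (lt_trans xy).
  have yI : a < y < b by rewrite yb (lt_trans ax).
  by rewrite /= !gh // -hlt ?in_itv.
have [x0 [p1 [p2 [om [x0I ap p12 pb conv]]]]] := regular_increments Mexp MPN ab domE h_lt.
exact: (nonaffine_of_increments Mexp domE h_lt x0I ap p12 pb conv).
Qed.

End FieldChart.

Theorem theoremE (R : realType) (L : language) (M : fo_structure L R)
    (Mexp : expands_ordered_add_group M) (MPN : ~ defines_PN_copy M) :
  defines_nonaffine_C1 M <-> field_type M.
Proof.
by split; [exact: nonaffine_to_field|exact: field_to_nonaffine].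
Qed.
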